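(* Let $\mathfrak a$ be a fractional ideal of $K$ and $m\in\mathbb N$. The series $$\Psi^0(\mathfrak a,m,s,z)=2\sum_{\lambda\in\Lambda^+(\mathfrak a,m)}\sum_{a\in\mathbb Z}\Bigl(1+\frac{|\lambda z_1+\lambda'z_2+a|^2}{4y_1y_2mN(\mathfrak a)/D}\Bigr)^{-s}$$ converges normally for $z\in\mathbb H^2$ and $\operatorname{Re}(s)>1/2$ and has the Fourier expansion $$\begin{aligned}\Psi^0(\mathfrak a,m,s,z)=\ &2\Bigl(\frac{4y_1y_2mN(\mathfrak a)}{D}\Bigr)^s\mathrm B(\tfrac12,s-\tfrac12)\sum_{\lambda\in\Lambda^+(\mathfrak a,m)}(\lambda y_1-\lambda'y_2)^{1-2s}\\ &+\frac{4\pi^s}{\Gamma(s)}\Bigl(\frac{4y_1y_2mN(\mathfrak a)}{D}\Bigr)^s\sum_{\lambda\in\Lambda^+(\mathfrak a,m)}\sum_{n=1}^\infty\Bigl(\frac{n}{\lambda y_1-\lambda'y_2}\Bigr)^{s-1/2}K_{s-1/2}\bigl(2\pi n(\lambda y_1-\lambda'y_2)\bigr)\bigl(e(n\operatorname{tr}(\lambda x))+e(-n\operatorname{tr}(\lambda x))\bigr).\end{aligned}$$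
   Context: $K\subset\mathbb R$ is a real quadratic field of discriminant $D$ ($\sqrt D>0$), $x\mapsto x'$ conjugation, $N(x)=xx'$, $\mathfrak d=\sqrt D\,\mathcal O_K$; ideals are nonzero fractional ideals with norm $N(\mathfrak a)>0$. $e(w)=e^{2\pi iw}$, $z=(z_1,z_2)=(x_1+iy_1,x_2+iy_2)\in\mathbb H^2$, $\operatorname{tr}(\lambda x)=\lambda x_1+\lambda'x_2$. $\Lambda^+(\mathfrak a,m)=\{\lambda\in\mathfrak a\mathfrak d^{-1}:N(\lambda)=-mN(\mathfrak a)/D,\ \lambda>0\}$ (so $\lambda'<0$ for its elements). $\mathrm B(x,y)=\Gamma(x)\Gamma(y)/\Gamma(x+y)$ is the beta function and $K_\kappa$ the modified Bessel function of the second kind. *)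

(* Defs.v *)
From HB Require Import structures.
From mathcomp Require Import all_boot all_order all_algebra all_field.
From mathcomp Require Import all_classical all_reals all_analysis.
From mathcomp.real_closed Require Import complex.

Set Implicit Arguments.
Unset Strict Implicit.
Unset Printing Implicit Defensive.

Import Order.TTheory GRing.Theory Num.Theory.
Import numFieldNormedType.Exports.

Local Open Scope classical_set_scope.
Local Open Scope ring_scope.
Local Open Scope complex_scope.

(** * Real quadratic fields

    A quadratic subfield of [R] is represented by an extension [K] of [rat]
    of degree 2 with a ring morphism [iota : K -> R] (necessarily injective).
    The conjugation [x |-> x'] is [sigma], the only ring endomorphism of [K]
    other than the identity. *)
Section QuadraticField.
Variables (R : realType) (K : fieldExtType rat).
Variables (iota : {rmorphism K -> R}) (sigma : {rmorphism K -> K}).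

Definition is_conjugation : Prop := exists x : K, sigma x != x.

Definition qnorm (x : K) : K := x * sigma x.

Definition ring_of_integers : set K :=
  [set x | integralOver (intr : int -> K) x].

Definition zbasis (L : set K) (b : K * K) : Prop :=
  (forall x, L x <-> exists u v : int, x = b.1 *~ u + b.2 *~ v) /\
  (forall u v : int, b.1 *~ u + b.2 *~ v = 0 -> u = 0 /\ v = 0).

(** Determinant of the matrix formed by the conjugates of [b]. *)
Definition conj_det (b : K * K) : K := b.1 * sigma b.2 - b.2 * sigma b.1.

Definition has_discriminant (D : int) : Prop :=
  exists w, zbasis ring_of_integers w /\ D%:~R = conj_det w ^+ 2.

Definition fractional_ideal (a : set K) : Prop :=
  [/\ (exists2 x, a x & x != 0),
      (forall x y, a x -> a y -> a (x + y)),
      (forall c x, ring_of_integers c -> a x -> a (c * x)) &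
      (exists2 c, c != 0 & forall x, a x -> ring_of_integers (c * x))].

Definition ideal_mul (a b : set K) : set K :=
  [set x | exists (n : nat) (u v : 'I_n -> K),
     [/\ forall i, a (u i), forall i, b (v i) & x = \sum_i u i * v i]].

Definition ideal_inv (a : set K) : set K :=
  [set x | forall y, a y -> ring_of_integers (x * y)].

(** [N(a)] is the absolute value of the determinant of the matrix expressing
    a Z-basis [b] of [a] in a Z-basis [w] of the ring of integers (the index
    of [a] when [a] is integral). This matrix carries the conjugates of [w]
    to those of [b], whence the quotient below; it does not depend on the
    chosen bases. *)
Definition ideal_norm (a : set K) : R :=
  let b := xget (0, 0) (zbasis a) in
  let w := xget (0, 0) (zbasis ring_of_integers) in
  `|iota (conj_det b / conj_det w)|.

(** The ideal generated by the positive square root of [D]. *)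
Definition different (D : int) : set K :=
  [set x | exists2 y, ring_of_integers y &
             iota x = Num.sqrt (D%:~R : R) * iota y].

Definition Lambda_plus (D : int) (a : set K) (m : nat) : set K :=
  [set l | [/\ ideal_mul a (ideal_inv (different D)) l,
               iota (qnorm l) = - (m%:R * ideal_norm a / D%:~R) &
               0 < iota l]].

End QuadraticField.

(** * Complex-valued functions *)
Section ComplexAnalysis.
Variable R : realType.
Implicit Types (s z w nu : R[i]) (x : R).

Definition cexp w : R[i] :=
  (expR (complex.Re w) * cos (complex.Im w)) +i*
  (expR (complex.Re w) * sin (complex.Im w)).

Definition e2pi w : R[i] := cexp (2 * pi%:C * (0 +i* 1) * w).

(** [x ^ s] for a real base [x > 0], with the real logarithm. *)
Definition cpow x s : R[i] := cexp (s * (ln x)%:C).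

Definition cintegral (A : set R) (f : R -> R[i]) : R[i] :=
  (\int[lebesgue_measure]_(t in A) complex.Re (f t)) +i*
  (\int[lebesgue_measure]_(t in A) complex.Im (f t)).

(** Euler's integral; it converges for [0 < Re s]. *)
Definition Gamma s : R[i] :=
  cintegral `]0, +oo[ (fun t => cpow t (s - 1) * (expR (- t))%:C).

Definition Beta s w : R[i] := Gamma s * Gamma w / Gamma (s + w).

(** The modified Bessel function of the second kind at a real [x > 0]:
    K_nu(x) = 1/2 * int_0^oo t^(nu - 1) exp (- x (t + 1/t) / 2) dt,
    convergent for every complex [nu]. *)
Definition besselK nu x : R[i] :=
  2^-1 * cintegral `]0, +oo[
    (fun t => cpow t (nu - 1) * (expR (- (x * (t + t^-1) / 2)))%:C).

(** * Sums of absolutely convergent families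

    [csum D f] is meaningful when [csummable D f] holds; it is then the limit
    of the sums of [f] over the finite subsets of [D]. *)
Definition csummable (T : choiceType) (D : set T) (f : T -> R[i]) : Prop :=
  summable D (fun i => (Normc.normc (f i))%:E).

Definition rsum (T : choiceType) (D : set T) (f : T -> R) : R :=
  fine (\esum_(i in D) (Num.max (f i) 0)%:E) -
  fine (\esum_(i in D) (Num.max (- f i) 0)%:E).

Definition csum (T : choiceType) (D : set T) (f : T -> R[i]) : R[i] :=
  rsum D (fun i => complex.Re (f i)) +i* rsum D (fun i => complex.Im (f i)).

(** Normal convergence of [\sum_(i in D) f i] on [U]: the suprema of
    [|f i|] over any compact subset of [U] have a finite sum. *)
Definition normally_convergent (T : choiceType) (X : topologicalType)
    (D : set T) (f : T -> X -> R[i]) (U : set X) : Prop :=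
  forall C : set X, compact C -> C `<=` U ->
    (\esum_(i in D) ereal_sup [set (Normc.normc (f i x))%:E | x in C] < +oo)%E.

Definition upper_half_plane2 : set (R[i] * R[i]) :=
  [set z | 0 < complex.Im z.1 /\ 0 < complex.Im z.2].

End ComplexAnalysis.

Section Psi0.
Variables (R : realType) (K : fieldExtType rat).
Variables (iota : {rmorphism K -> R}) (sigma : {rmorphism K -> K}).
Variables (D : int) (a : set K) (m : nat).

(** The real number 4 y1 y2 m N(a) / D. *)
Definition psi_scale (z : R[i] * R[i]) : R :=
  4 * complex.Im z.1 * complex.Im z.2 * m%:R * ideal_norm iota sigma a
  / D%:~R.

Definition psi0_term (p : K * int) (z : R[i] * R[i]) (s : R[i]) : R[i] :=
  let w := (iota p.1)%:C * z.1 + (iota (sigma p.1))%:C * z.2 + p.2%:~R in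
  cpow (1 + Normc.normc w ^+ 2 / psi_scale z) (- s).

Definition Psi0 (s : R[i]) (z : R[i] * R[i]) : R[i] :=
  2 * csum (Lambda_plus iota sigma D a m)
        (fun l => csum [set: int] (fun k => psi0_term (l, k) z s)).

(** [l y1 - l' y2] *)
Definition psi_height (z : R[i] * R[i]) (l : K) : R :=
  iota l * complex.Im z.1 - iota (sigma l) * complex.Im z.2.

(** [tr (l x)] with [x = (Re z1, Re z2)] *)
Definition psi_trace (z : R[i] * R[i]) (l : K) : R :=
  iota l * complex.Re z.1 + iota (sigma l) * complex.Re z.2.

Definition psi0_const_term (s : R[i]) (z : R[i] * R[i]) (l : K) : R[i] :=
  cpow (psi_height z l) (1 - 2 * s).

Definition psi0_fourier_term (s : R[i]) (z : R[i] * R[i]) (l : K) (n : nat) :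
    R[i] :=
  cpow (n%:R / psi_height z l) (s - 2^-1) *
  besselK (s - 2^-1) (2 * pi * n%:R * psi_height z l) *
  (e2pi (n%:R * psi_trace z l)%:C + e2pi (- (n%:R * psi_trace z l)%:C)).

End Psi0.

(* Main.v *)
Require Import Defs.
From HB Require Import structures.
From mathcomp Require Import all_boot all_order all_algebra all_field.
From mathcomp Require Import all_classical all_reals all_analysis.
From mathcomp Require Import measurable_realfun lebesgue_integral_under.
From mathcomp.real_closed Require Import complex.
From mathcomp Require Import ring lra.

(** Fix [l] in [Lambda_plus] and let [h = psi_height z l], [t = psi_trace z l].
    The product of [l] and its conjugate is [- c] with [c = m N(a) / D], so that
    [|l z1 + l' z2 + k|^2 + 4 y1 y2 c = h^2 + (t + k)^2]: up to the factor
    [(4 y1 y2 c)^s] the inner sum is the sum of [(h^2 + (t + k)^2)^(- s)] over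
    the integers [k] ([psi0_termE]). There remain an identity for this lattice
    sum on a line, and an estimate for the sum over [l].

    Identity ([lattice_fourier]). Euler's integral writes [Gamma s] times the
    lattice sum as the integral of [tau^(s-1) exp (- h^2 tau)] against the
    periodized Gaussian. Poisson summation ([gaussian_poisson]) replaces the
    latter by a sum over frequencies [n]. The frequency 0 gives
    [Gamma (1/2) Gamma (s - 1/2) h^(1 - 2 s)], hence the Beta function after
    division by [Gamma s], which does not vanish ([Gamma_neq0]); the frequencies
    [n] and [- n] together give a Bessel integral ([cintegral_bessel_kernel])
    times [2 cos (2 pi n t)]. Integrating the sum over [n] term by term is
    legitimate because the Poisson formula at [t = 0] has positive terms: it
    bounds the sum of the Bessel integrals by the lattice sum at [t = 0]
    ([esum_bessel_kernel_le]). The Poisson formula itself follows from Chernoff's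
    proof that the Fourier series of a smooth function converges to it
    ([fourier_sum_at0]).

    Estimate. A nonzero algebraic integer has norm at least 1 in absolute value,
    so differences of distinct elements of [Lambda_plus] have norm bounded below
    ([Lambda_plus_separated]). As these elements lie on one branch of a
    hyperbola, their logarithms are separated, and their sizes
    [H = l + |l'|] grow exponentially ([rsummable_hyperbola]). When [z] stays in
    a compact set, [h >= e H] and [|t| <= M H], so that the double series is
    dominated by a multiple of the sum of [(H^2 + k^2)^(- p)], with [p > 1/2] a
    lower bound of [Re s]; this sum is finite ([esum_hyperbola_lattice]). It also
    bounds the Fourier series, through [esum_bessel_term_le]. *)

Import Order.TTheory GRing.Theory Num.Theory.
Import numFieldNormedType.Exports.
Local Open Scope classical_set_scope.
Local Open Scope ring_scope.
Local Open Scope complex_scope.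
Set Implicit Arguments.
Unset Strict Implicit.
Unset Printing Implicit Defensive.

(** * Sums of real and complex families *)

Section RealSums.
Variables (R : realType) (T : choiceType).
Implicit Types (D : set T) (f g : T -> R).

Lemma esumZl D (c : R) (a : T -> \bar R) : 0 <= c ->
  (forall i, D i -> 0 <= a i)%E ->
  (\esum_(i in D) (c%:E * a i) = c%:E * \esum_(i in D) a i)%E.
Proof.
move=> c0 a0; rewrite esum_mkcond [in RHS]esum_mkcond.
rewrite /esum -ereal_supZl//; last first.
  by apply/set0P; exists 0%E, set0; [exact: fsets_set0|rewrite fsbig_set0].
have e (X : set T) : (\sum_(i \in X) (if i \in D then c%:E * a i else 0) =
    c%:E * \sum_(i \in X) (if i \in D then a i else 0))%E.
  rewrite ge0_mule_fsumr => [|i]; last by case: ifPn => // /set_mem /a0.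
  by apply: eq_fsbigr => i _; case: ifPn => //; rewrite mule0.
congr ereal_sup; apply/seteqP; split=> [x [X XD <-]|x [y [X XD <-] <-]].
  by exists (\sum_(i \in X) if i \in D then a i else 0)%E; [exists X|].
by exists X.
Qed.

Definition rsummable D f := summable D (EFin \o f).

Lemma rsummableE D f : rsummable D f = (\esum_(i in D) (`|f i|)%:E < +oo)%E.
Proof. by []. Qed.

Lemma ge0_rsummable D f : (forall i, D i -> 0 <= f i) ->
  rsummable D f = (\esum_(i in D) (f i)%:E < +oo)%E.
Proof.
move=> f0; rewrite rsummableE; congr (_ < _)%E; apply: eq_esum => i Di.
by rewrite ger0_norm// f0.
Qed.

Lemma rsummable_fin D f : rsummable D f -> (forall i, D i -> 0 <= f i) ->
  (\esum_(i in D) (f i)%:E)%E \is a fin_num.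
Proof.
move=> sf f0; rewrite ge0_fin_numE; last by apply: esum_ge0 => i Di; rewrite lee_fin f0.
by rewrite -ge0_rsummable.
Qed.

Lemma le_rsummable D f g : (forall i, D i -> `|f i| <= g i) ->
  rsummable D g -> rsummable D f.
Proof.
move=> fg; apply: le_lt_trans; apply: le_esum => i Di /=; rewrite lee_fin.
exact: le_trans (fg _ Di) (ler_norm _).
Qed.

Lemma eq_rsummable D f g : (forall i, D i -> f i = g i) ->
  rsummable D f -> rsummable D g.
Proof.
by move=> fg; rewrite !rsummableE; under eq_esum => i Di do rewrite fg//.
Qed.

Lemma rsummableD D f g : rsummable D f -> rsummable D g -> rsummable D (f \+ g).
Proof. by move=> sf sg; rewrite /rsummable; have := summableD sf sg; apply. Qed.

Lemma rsummableZ D c f : rsummable D f -> rsummable D (fun i => c * f i).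
Proof.
rewrite !rsummableE => sf.
under eq_esum do rewrite normrM EFinM.
rewrite esumZl//.
by rewrite lte_mul_pinfty// lee_fin.
Qed.

Lemma rsummable_norm D f : rsummable D f -> rsummable D (fun i => `|f i|).
Proof.
move=> sf; apply: (@le_rsummable _ _ (fun i => `|f i|)) => [i _|].
  by rewrite normr_id.
by move: sf; rewrite !rsummableE; under [in X in _ -> X]eq_esum do rewrite normr_id.
Qed.

Lemma eq_rsum D f g : (forall i, D i -> f i = g i) -> rsum D f = rsum D g.
Proof.
move=> fg; rewrite /rsum; congr (fine _ - fine _); apply: eq_esum => i Di.
  by rewrite fg.
by rewrite fg.
Qed.

(** A signed sum may be computed from any splitting of its terms as a
    difference of nonnegative summable ones, not only the canonical one;
    linearity and the exchange with integrals follow from this. *)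
Lemma rsumBge0 D f g : rsummable D f -> rsummable D g ->
  (forall i, D i -> 0 <= f i) -> (forall i, D i -> 0 <= g i) ->
  rsum D (f \- g) =
    fine (\esum_(i in D) (f i)%:E)%E - fine (\esum_(i in D) (g i)%:E)%E.
Proof.
move=> sf sg f0 g0; rewrite -fineB; [|exact: rsummable_fin..].
rewrite -(@esumB _ _ D (EFin \o f) (EFin \o g)) => //; try by move=> i Di /=; rewrite lee_fin; auto.
have sfg : rsummable D (f \- g).
  by rewrite /rsummable; have := summableB sf sg; apply.
rewrite fineB.
- rewrite /rsum; congr (fine _ - fine _); apply: eq_esum => i Di.
    by rewrite funeposE /= -EFinB -EFin_max.
  by rewrite funenegE /= EFin_max EFinN EFinB.
- have := summable_funepos sfg; rewrite summableE.
  by under eq_esum do rewrite gee0_abs// .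
- have := summable_funeneg sfg; rewrite summableE.
  by under eq_esum do rewrite gee0_abs// .
Qed.

Lemma rsum_ge0E D f : (forall i, D i -> 0 <= f i) ->
  rsum D f = fine (\esum_(i in D) (f i)%:E)%E.
Proof.
move=> f0; rewrite /rsum [X in _ - fine X]esum1 ?subr0; last first.
  by move=> i Di; congr _%:E; apply/max_idPr; rewrite oppr_le0 f0.
by congr fine; apply: eq_esum => i Di; congr _%:E; apply/max_idPl/f0.
Qed.

Lemma rsumE D f : rsummable D f ->
  rsum D f = fine (\esum_(i in D) (f i + `|f i|)%:E)%E -
             fine (\esum_(i in D) `|f i|%:E)%E.
Proof.
move=> sf; rewrite -(@rsumBge0 D (fun i => f i + `|f i|) (fun i => `|f i|))//.
- by apply: eq_rsum => i _ /=; rewrite addrK.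
- exact/rsummableD/rsummable_norm.
- exact/rsummable_norm.
- by move=> i _; rewrite addrC -[f i]opprK subr_ge0 normrN ler_norm.
Qed.

Lemma rsumD D f g : rsummable D f -> rsummable D g ->
  rsum D (fun i => f i + g i) = rsum D f + rsum D g.
Proof.
move=> sf sg.
have h0 h (i : T) : 0 <= h i + `|h i| :> R.
  by rewrite addrC -[h i]opprK subr_ge0 normrN ler_norm.
have sp h : rsummable D h -> rsummable D (fun i => h i + `|h i|).
  by move=> sh; apply/rsummableD/rsummable_norm.
rewrite (rsumE sf) (rsumE sg).
rewrite -(@eq_rsum D ((fun i => (f i + `|f i|) + (g i + `|g i|)) \- (fun i => `|f i| + `|g i|))); last first.
  by move=> i _ /=; ring.
rewrite rsumBge0.
- under eq_esum do rewrite EFinD.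
  under [in X in _ - X]eq_esum do rewrite EFinD.
  rewrite !esumD; try by move=> i _; rewrite lee_fin.
  rewrite !fineD; try by apply: rsummable_fin => //; auto; exact: rsummable_norm.
  by ring.
- by apply: rsummableD; exact: sp.
- by apply: rsummableD; exact: rsummable_norm.
- by move=> i _; apply: addr_ge0.
- by move=> i _; apply: addr_ge0.
Qed.

Lemma rsumN D f : rsum D (fun i => - f i) = - rsum D f.
Proof.
rewrite /rsum opprB; congr (_ - fine _).
by apply: eq_esum => i _; rewrite opprK.
Qed.

Lemma rsumZ D c f : rsum D (fun i => c * f i) = c * rsum D f.
Proof.
wlog c0 : c / 0 <= c => [H|].
  have [/H//|/ltW cN] := leP 0 c.
  have /H e : 0 <= - c by rewrite oppr_ge0.
  rewrite -[c]opprK [in RHS]mulNr -e -rsumN.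
  by apply: eq_rsum => i _; rewrite opprK mulNr opprK.
have h g : (forall i, 0 <= g i) ->
    fine (\esum_(i in D) (c * g i)%:E)%E = c * fine (\esum_(i in D) (g i)%:E)%E.
  move=> g0; under eq_esum do rewrite EFinM.
  rewrite esumZl//; last by move=> i _; rewrite lee_fin.
  case: (\esum_(i in D) _)%E => [r| |] //=.
    by have [->|c1] := eqVneq c 0; rewrite ?mul0e ?mulr0// gt0_muley ?mulr0// lte_fin lt0r c1.
  by have [->|c1] := eqVneq c 0; rewrite ?mul0e ?mulr0// gt0_muleNy ?mulr0// lte_fin lt0r c1.
have m0 x : c * Num.max x 0 = Num.max (c * x) 0 by rewrite maxr_pMr// mulr0.
rewrite /rsum mulrBr -!h; try by move=> i; rewrite le_max lexx orbT.
congr (fine _ - fine _); apply: eq_esum => i _; rewrite m0//.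
by rewrite mulrN.
Qed.

Lemma rsum_le_norm D f : rsummable D f ->
  `|rsum D f| <= fine (\esum_(i in D) `|f i|%:E)%E.
Proof.
move=> sf.
have h g : (forall i, 0 <= g i) -> (forall i, g i <= `|f i|) ->
    0 <= fine (\esum_(i in D) (g i)%:E)%E <= fine (\esum_(i in D) `|f i|%:E)%E.
  move=> g0 gf; rewrite fine_ge0/=; last by apply: esum_ge0 => i _; rewrite lee_fin.
  apply: fine_le.
  - apply: rsummable_fin => //; apply: le_rsummable (rsummable_norm sf) => i _.
    by rewrite ger0_norm.
  - exact: rsummable_fin (rsummable_norm sf) _.
  - by apply: le_esum => i _; rewrite lee_fin.
have := h (fun i => Num.max (f i) 0); have := h (fun i => Num.max (- f i) 0).
move=> /(_ _ _)/andP[|i|n0 n1 /(_ _ _)/andP[|i|p0 p1]].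
- by move=> i; rewrite le_max lexx orbT.
- by rewrite ge_max normr_ge0 andbT -normrN ler_norm.
- by move=> i; rewrite le_max lexx orbT.
- by rewrite ge_max normr_ge0 andbT ler_norm.
by rewrite /rsum ler_norml; apply/andP; split; lra.
Qed.

Lemma norm_rsum_le D f g : (forall i, D i -> `|f i| <= g i) -> rsummable D g ->
  `|rsum D f| <= rsum D g.
Proof.
move=> fg sg; have g0 i : D i -> 0 <= g i by move=> /fg; exact: le_trans.
have sf := le_rsummable fg sg.
apply: le_trans (rsum_le_norm sf) _; rewrite (rsum_ge0E g0); apply: fine_le.
- by apply: rsummable_fin => //; exact: rsummable_norm.
- exact: rsummable_fin.
- by apply: le_esum => i Di; rewrite lee_fin fg.
Qed.

End RealSums.

Section CountableSums.
Variables (R : realType) (T : countType).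
Implicit Types D : set T.

(** Numbering the indices gives access to the theorems on series of
    nonnegative functions. *)
Lemma esum_nneseries D (f : T -> \bar R) : (forall i, D i -> 0 <= f i)%E ->
  (\esum_(i in D) f i =
   \sum_(n <oo) if pickle_inv n is Some i then if i \in D then f i else 0 else 0)%E.
Proof.
move=> f0; rewrite esum_mkcond.
rewrite nneseries_esumT => [|n]; last first.
  by case: pickle_inv => // i; case: ifPn => // /set_mem; exact: f0.
pose a n := (if @pickle_inv T n is Some i then if i \in D then f i else 0 else 0)%E.
transitivity (\esum_(n in pickle @` [set: T]) a n)%E.
  rewrite esum_image => [|x y _ _]; last exact: (pcan_inj pickleK).
  by apply: eq_esum => i _; rewrite /a pickleK_inv.
rewrite esum_mkcond; apply: eq_esum => n _; case: ifPn => //.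
rewrite /a => /negP nT; have := @pickle_invK T n; case: pickle_inv => //= i ni.
by exfalso; apply: nT; apply/mem_set; exists i.
Qed.

Variables (d : measure_display) (X : measurableType d).
Variables (mu : {measure set X -> \bar R}) (A : set X) (mA : measurable A).

Lemma measurable_esum D (f : T -> X -> \bar R) :
  (forall i, D i -> measurable_fun A (f i)) ->
  (forall i x, D i -> A x -> 0 <= f i x)%E ->
  measurable_fun A (fun x => \esum_(i in D) f i x)%E.
Proof.
move=> mf f0.
apply: (@eq_measurable_fun _ _ _ _ A (fun x => \sum_(n <oo) if @pickle_inv T n is Some i
    then if i \in D then f i x else 0 else 0)%E).
  by move=> x /set_mem Ax; rewrite esum_nneseries// => i Di; exact: f0.
apply: ge0_emeasurable_sum => [n x Ax _|n _].
  by case: pickle_inv => // i; case: ifPn => // /set_mem Di; exact: f0.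
case: (@pickle_inv T n) => [i|]; last exact: measurable_cst.
by case Di: (i \in D); [apply: mf; exact: set_mem|exact: measurable_cst].
Qed.

Lemma integral_esum D (f : T -> X -> \bar R) :
  (forall i, D i -> measurable_fun A (f i)) ->
  (forall i x, D i -> A x -> 0 <= f i x)%E ->
  ((\int[mu]_(x in A) \esum_(i in D) f i x) =
   \esum_(i in D) \int[mu]_(x in A) f i x)%E.
Proof.
move=> mf f0.
rewrite esum_nneseries; last by move=> i Di; apply: integral_ge0 => x; exact: f0.
pose g n x := (if @pickle_inv T n is Some i then if i \in D then f i x else 0 else 0)%E.
transitivity (\int[mu]_(x in A) \sum_(n <oo) g n x)%E.
  apply: eq_integral => x /set_mem Ax; rewrite esum_nneseries// => i Di; exact: f0.
rewrite integral_nneseries//.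
- apply: eq_eseriesr => n _; rewrite /g; case: pickle_inv => [i|]; last by rewrite integral0.
  by case: ifPn => // _; rewrite integral0.
- move=> n; rewrite /g; case: (@pickle_inv T n) => [i|]; last exact: measurable_cst.
  by case Di: (i \in D); [apply: mf; exact: set_mem|exact: measurable_cst].
- move=> n x Ax; rewrite /g; case: pickle_inv => // i.
  by case: ifPn => // /set_mem Di; exact: f0.
Qed.

Lemma esum_ub D (a : T -> \bar R) i : (forall i, D i -> 0 <= a i)%E -> D i ->
  (a i <= \esum_(i in D) a i)%E.
Proof.
move=> a0 Di; rewrite (esumID [set i])//.
have -> : D `&` [set i] = [set i] by apply/seteqP; split=> [x []|x ->].
rewrite esum_set1//; last exact: a0.
by rewrite leeDl// esum_ge0// => j [/a0].
Qed.

(** Termwise integration of an absolutely summable family of real functions: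
    both sides are split into nonnegative parts, where it is Tonelli. *)
Lemma rsum_Rintegral D (f : T -> X -> R) :
  (forall i, D i -> measurable_fun A (f i)) ->
  (forall x, A x -> rsummable D (f ^~ x)) ->
  (\esum_(i in D) \int[mu]_(x in A) `|f i x|%:E < +oo)%E ->
  [/\ mu.-integrable A (EFin \o (fun x => rsum D (f ^~ x))),
      rsummable D (fun i => \int[mu]_(x in A) f i x) &
      rsum D (fun i => \int[mu]_(x in A) f i x) =
        \int[mu]_(x in A) rsum D (f ^~ x)].
Proof.
move=> mf sf If.
pose k i x := `|f i x|; pose g i x := f i x + `|f i x|.
have g0 i x : 0 <= g i x by rewrite /g addrC -[f i x]opprK subr_ge0 normrN ler_norm.
have k0 i x : 0 <= k i x by rewrite /k.
have mk i : D i -> measurable_fun A (EFin \o k i).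
  by move=> Di; apply/measurable_EFinP; exact: measurableT_comp (mf _ Di).
have mg i : D i -> measurable_fun A (EFin \o g i).
  move=> Di; apply/measurable_EFinP/measurable_funD; first exact: mf.
  exact: measurableT_comp (mf _ Di).
have If1 i : D i -> (\int[mu]_(x in A) (k i x)%:E < +oo)%E.
  move=> Di; apply: le_lt_trans If; apply: (esum_ub _ Di) => j _.
  by apply: integral_ge0 => x _; rewrite lee_fin.
have ik i : D i -> mu.-integrable A (EFin \o k i).
  move=> Di; apply/integrableP; split; first exact: mk.
  by under eq_integral do rewrite /= /k normr_id; exact: If1.
have ifi i : D i -> mu.-integrable A (EFin \o f i).
  by move=> Di; apply/integrableP; split; [apply/measurable_EFinP/mf|exact: If1].
have ig i : D i -> mu.-integrable A (EFin \o g i).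
  move=> Di; have -> : EFin \o g i = ((EFin \o f i) \+ (EFin \o k i))%E by apply/funext.
  by apply: integrableD => //; [exact: ifi|exact: ik].
have gk i x : g i x <= 2 * k i x.
  by rewrite /g /k; have := ler_norm (f i x); lra.
have Ig : (\esum_(i in D) \int[mu]_(x in A) (g i x)%:E < +oo)%E.
  apply: (@le_lt_trans _ _ (\esum_(i in D) (2%:E * \int[mu]_(x in A) (k i x)%:E))%E).
    apply: le_esum => i Di; rewrite -ge0_integralZl//.
    - apply: ge0_le_integral => //; try by move=> x _; rewrite ?mule_ge0 lee_fin.
      + exact: mg.
      + by apply: emeasurable_funM; [exact: measurable_cst|exact: mk].
    - exact: mk.
    - by move=> x _; rewrite lee_fin.
  rewrite esumZl//; last by move=> i _; apply: integral_ge0 => x _; rewrite lee_fin.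
  by rewrite lte_mul_pinfty.
have sk x : A x -> rsummable D (k ^~ x) by move=> /sf; exact: rsummable_norm.
have sg x : A x -> rsummable D (g ^~ x).
  by move=> Ax; apply: rsummableD; [exact: sf|exact: sk].
pose G x := fine (\esum_(i in D) (g i x)%:E)%E.
pose K x := fine (\esum_(i in D) (k i x)%:E)%E.
have fubini h : (forall i x, 0 <= h i x) -> (forall i, D i -> mu.-integrable A (EFin \o h i)) ->
  (\esum_(i in D) \int[mu]_(x in A) (h i x)%:E < +oo)%E ->
  (forall x, A x -> rsummable D (h ^~ x)) ->
  let H x := fine (\esum_(i in D) (h i x)%:E)%E in
  mu.-integrable A (EFin \o H) /\
  fine (\esum_(i in D) (\int[mu]_(x in A) h i x)%:E)%E = \int[mu]_(x in A) H x.
  move=> h0 ih Ih sh H.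
  have HE x : A x -> (H x)%:E = (\esum_(i in D) (h i x)%:E)%E.
    by move=> Ax; rewrite /H fineK// rsummable_fin// sh.
  have eI : ((\int[mu]_(x in A) (H x)%:E) = \esum_(i in D) \int[mu]_(x in A) (h i x)%:E)%E.
    rewrite -integral_esum//; first by apply: eq_integral => x /set_mem /HE.
      by move=> i Di; exact: measurable_int (ih _ Di).
    by move=> i x _ _; rewrite lee_fin.
  split.
    apply/integrableP; split.
      apply: (@eq_measurable_fun _ _ _ _ A (fun x => \esum_(i in D) (h i x)%:E)%E).
        by move=> x /set_mem /HE /=.
      apply: measurable_esum => [i Di|i x _ _]; last by rewrite lee_fin.
      exact: measurable_int (ih _ Di).
    under eq_integral => x Ax.
      rewrite /= ger0_norm; last by rewrite /H fine_ge0// esum_ge0// => i _; rewrite lee_fin.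
      over.
    by rewrite eI.
  rewrite /Rintegral eI; congr fine; apply: eq_esum => i Di.
  by rewrite fineK//; apply: integrable_fin_num (ih _ Di).
have [iG eG] := fubini g g0 ig Ig sg; have [iK eK] := fubini k k0 ik If sk.
have rE x : A x -> rsum D (f ^~ x) = G x - K x by move=> Ax; rewrite (rsumE (sf _ Ax)).
have ifE i : D i -> \int[mu]_(x in A) f i x =
    \int[mu]_(x in A) g i x - \int[mu]_(x in A) k i x.
  move=> Di; rewrite -RintegralB//; [|exact: ig|exact: ik].
  by apply: eq_Rintegral => x _; rewrite /g /k addrK.
have sI h : (forall i x, 0 <= h i x) -> (forall i, D i -> mu.-integrable A (EFin \o h i)) ->
  (\esum_(i in D) \int[mu]_(x in A) (h i x)%:E < +oo)%E ->
  rsummable D (fun i => \int[mu]_(x in A) h i x).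
  move=> h0 ih Ih; rewrite ge0_rsummable; last by move=> i Di; exact: Rintegral_ge0.
  apply: le_lt_trans Ih; apply: le_esum => i Di.
  by rewrite fineK//; apply: integrable_fin_num (ih _ Di).
split.
- apply: (@eq_integrable _ _ _ mu A mA ((EFin \o G) \- (EFin \o K))%E).
    by move=> x /set_mem Ax /=; rewrite rE// EFinB.
  exact: integrableB.
- apply: (@eq_rsummable _ _ D (fun i => \int[mu]_(x in A) g i x - \int[mu]_(x in A) k i x)).
    by move=> i /ifE.
  by rewrite /rsummable; have := summableB (sI _ g0 ig Ig) (sI _ k0 ik If); apply.
- rewrite (@eq_rsum _ _ D _ ((fun i => \int[mu]_(x in A) g i x) \- (fun i => \int[mu]_(x in A) k i x))).
    rewrite rsumBge0; try (by move=> i Di; exact: Rintegral_ge0); try exact: sI.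
    by rewrite eG eK -RintegralB//; apply: eq_Rintegral => x /set_mem /rE.
  by move=> i /ifE.
Qed.

End CountableSums.

Section ComplexKit.
Variable R : realType.
Implicit Types (x y : R) (s w c : R[i]).

Lemma ReM s w : complex.Re (s * w) =
  complex.Re s * complex.Re w - complex.Im s * complex.Im w.
Proof. by case: s w => [a b] [c d]. Qed.

Lemma ImM s w : complex.Im (s * w) =
  complex.Re s * complex.Im w + complex.Im s * complex.Re w.
Proof. by case: s w => [a b] [c d]. Qed.

Lemma ReZ x s : complex.Re (x%:C * s) = x * complex.Re s.
Proof. by rewrite ReM /= mul0r subr0. Qed.

Lemma ImZ x s : complex.Im (x%:C * s) = x * complex.Im s.
Proof. by rewrite ImM /= mul0r addr0. Qed.

Lemma ReD s w : complex.Re (s + w) = complex.Re s + complex.Re w.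
Proof. by case: s w => [a b] [c d]. Qed.

Lemma ImD s w : complex.Im (s + w) = complex.Im s + complex.Im w.
Proof. by case: s w => [a b] [c d]. Qed.

Lemma ReN s : complex.Re (- s) = - complex.Re s.
Proof. by case: s => [a b]. Qed.

Lemma ImN s : complex.Im (- s) = - complex.Im s.
Proof. by case: s => [a b]. Qed.

Lemma Re1 : complex.Re (1 : R[i]) = 1. Proof. by []. Qed.

Lemma complex_eq s w :
  complex.Re s = complex.Re w -> complex.Im s = complex.Im w -> s = w.
Proof. by case: s w => [a b] [c d] /= -> ->. Qed.

Lemma normc_ge0 s : 0 <= Normc.normc s.
Proof. by case: s => [a b]; exact: sqrtr_ge0. Qed.

Lemma normcE s :
  Normc.normc s = Num.sqrt (complex.Re s ^+ 2 + complex.Im s ^+ 2).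
Proof. by case: s. Qed.

Lemma normc_sqr s :
  Normc.normc s ^+ 2 = complex.Re s ^+ 2 + complex.Im s ^+ 2.
Proof. by rewrite normcE sqr_sqrtr// addr_ge0// sqr_ge0. Qed.

Lemma le_Re_normc s : `|complex.Re s| <= Normc.normc s.
Proof.
by rewrite -(@ler_pXn2r _ 2)// ?nnegrE ?normc_ge0// normc_sqr real_normK ?num_real// lerDl sqr_ge0.
Qed.

Lemma le_Im_normc s : `|complex.Im s| <= Normc.normc s.
Proof.
by rewrite -(@ler_pXn2r _ 2)// ?nnegrE ?normc_ge0// normc_sqr real_normK ?num_real// lerDr sqr_ge0.
Qed.

Lemma normc_le s : Normc.normc s <= `|complex.Re s| + `|complex.Im s|.
Proof.
rewrite -(@ler_pXn2r _ 2)// ?nnegrE ?normc_ge0 ?addr_ge0//.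
by rewrite normc_sqr sqrrD !real_normK ?num_real// addrAC lerDl mulrn_wge0 ?mulr_ge0.
Qed.

Lemma normc_real x : Normc.normc (x%:C) = `|x|.
Proof. by rewrite normcE /= expr0n/= addr0 sqrtr_sqr. Qed.

Lemma cexpD s w : cexp (s + w) = cexp s * cexp w.
Proof.
apply: complex_eq; rewrite ?ReM ?ImM /= ReD ImD ?cosD ?sinD expRD; ring.
Qed.

Lemma cexp_real x : cexp (x%:C) = (expR x)%:C.
Proof. by rewrite /cexp /= cos0 sin0 mulr1 mulr0. Qed.

Lemma normc_cexp s : Normc.normc (cexp s) = expR (complex.Re s).
Proof.
rewrite normcE /= !exprMn -mulrDr cos2Dsin2 mulr1 sqrtr_sqr ger0_norm//.
Qed.

Lemma cpowE x s : cpow x s =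
  (expR (complex.Re s * ln x) * cos (complex.Im s * ln x)) +i*
  (expR (complex.Re s * ln x) * sin (complex.Im s * ln x)).
Proof. by rewrite /cpow /cexp ReM ImM /= !mulr0 subr0 add0r. Qed.

Lemma normc_cpow x s : 0 < x -> Normc.normc (cpow x s) = x `^ complex.Re s.
Proof.
by move=> x0; rewrite normc_cexp ReM /= mulr0 subr0 /powR gt_eqF.
Qed.

Lemma cpow_real x y : 0 < x -> cpow x y%:C = (x `^ y)%:C.
Proof. by move=> x0; rewrite /cpow -rmorphM cexp_real /powR gt_eqF. Qed.

Lemma cpowD x s w : cpow x (s + w) = cpow x s * cpow x w.
Proof. by rewrite /cpow mulrDl cexpD. Qed.

Lemma cpow0 x : cpow x 0 = 1.
Proof. by rewrite /cpow mul0r (cexp_real 0) expR0. Qed.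

Lemma cpowN x s : cpow x (- s) * cpow x s = 1.
Proof. by rewrite -cpowD addNr cpow0. Qed.

Lemma cpow_neq0 x s : cpow x s != 0.
Proof.
apply/eqP => x0; have := cpowN x s; rewrite x0 mulr0 => /esym/eqP.
by rewrite oner_eq0.
Qed.

Lemma cpowV x s : cpow x (- s) = (cpow x s)^-1.
Proof.
by apply: (mulIf (cpow_neq0 x s)); rewrite cpowN mulVf// cpow_neq0.
Qed.

Lemma cpowM x y s : 0 < x -> 0 < y -> cpow (x * y) s = cpow x s * cpow y s.
Proof. by move=> x0 y0; rewrite /cpow lnM ?posrE// rmorphD mulrDr cexpD. Qed.

Lemma cpowVl x s : 0 < x -> cpow x^-1 s = cpow x (- s).
Proof. by move=> x0; rewrite /cpow lnV ?posrE// rmorphN mulrN mulNr. Qed.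

Lemma cpow_sqr x s : 0 < x -> cpow (x ^+ 2) s = cpow x (2 * s).
Proof.
move=> x0; rewrite expr2 cpowM// -cpowD; congr cpow; ring.
Qed.

Lemma e2piE x : e2pi x%:C = (cos (2 * pi * x)) +i* (sin (2 * pi * x)).
Proof.
have -> : e2pi x%:C = cexp (0 +i* (2 * pi * x)).
  by rewrite /e2pi; congr cexp; apply: complex_eq; rewrite !(ReM, ImM) /=; ring.
by rewrite /cexp /= expR0 !mul1r.
Qed.

Lemma e2piDN x : e2pi x%:C + e2pi (- x%:C) = (2 * cos (2 * pi * x))%:C.
Proof.
rewrite -[- x%:C](rmorphN (real_complex R)) !e2piE mulrN cosN sinN.
by apply: complex_eq; rewrite ?ReD ?ImD /=; ring.
Qed.

Section CSum.
Variable T : choiceType.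
Implicit Types (D : set T) (f g : T -> R[i]).

Lemma csummableE D f :
  csummable D f = rsummable D (fun i => Normc.normc (f i)).
Proof. by []. Qed.

Lemma csummable_Re D f : csummable D f -> rsummable D (fun i => complex.Re (f i)).
Proof. by apply: le_rsummable => i _; exact: le_Re_normc. Qed.

Lemma csummable_Im D f : csummable D f -> rsummable D (fun i => complex.Im (f i)).
Proof. by apply: le_rsummable => i _; exact: le_Im_normc. Qed.

Lemma le_csummable D f (g : T -> R) : (forall i, D i -> Normc.normc (f i) <= g i) ->
  rsummable D g -> csummable D f.
Proof.
move=> fg; rewrite csummableE; apply: le_rsummable => i Di.
by rewrite ger0_norm ?normc_ge0// fg.
Qed.

Lemma eq_csum D f g : (forall i, D i -> f i = g i) -> csum D f = csum D g.
Proof.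
by move=> fg; rewrite /csum; congr (_ +i* _); apply: eq_rsum => i Di; rewrite fg.
Qed.

Lemma eq_csummable D f g : (forall i, D i -> f i = g i) ->
  csummable D f -> csummable D g.
Proof. by move=> fg; apply: eq_rsummable => i Di; rewrite fg. Qed.

Lemma csummableZ D c f : csummable D f -> csummable D (fun i => c * f i).
Proof.
move=> sf; rewrite csummableE.
apply: (@eq_rsummable _ _ _ (fun i => Normc.normc c * Normc.normc (f i))).
  by move=> i _; rewrite Normc.normcM.
exact: rsummableZ.
Qed.

Lemma csumZ D c f : csummable D f -> csum D (fun i => c * f i) = c * csum D f.
Proof.
move=> sf; have sr := csummable_Re sf; have si := csummable_Im sf.
apply: complex_eq; rewrite ?ReM ?ImM /=.
  rewrite -mulNr -!rsumZ -rsumD; try exact: rsummableZ.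
  by apply: eq_rsum => i _; rewrite ReM mulNr.
rewrite -!rsumZ -rsumD; try exact: rsummableZ.
by apply: eq_rsum => i _; rewrite ImM.
Qed.

Lemma csumD D f g : csummable D f -> csummable D g ->
  csum D (fun i => f i + g i) = csum D f + csum D g.
Proof.
move=> sf sg; apply: complex_eq; rewrite ?ReD ?ImD /= -rsumD.
- by apply: eq_rsum => i _; rewrite ReD.
- exact: csummable_Re.
- exact: csummable_Re.
- by apply: eq_rsum => i _; rewrite ImD.
- exact: csummable_Im.
- exact: csummable_Im.
Qed.

(** The factor 2 pays for the separate treatment of the real and imaginary
    parts. *)
Lemma normc_csum_le D f : csummable D f ->
  Normc.normc (csum D f) <= 2 * fine (\esum_(i in D) (Normc.normc (f i))%:E)%E.
Proof.
move=> sf; apply: le_trans (normc_le _) _ => /=.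
have le2 (h : T -> R) : (forall i, `|h i| <= Normc.normc (f i)) ->
    `|rsum D h| <= fine (\esum_(i in D) (Normc.normc (f i))%:E)%E.
  move=> hf; have sh : rsummable D h by apply: le_rsummable sf => i _; exact: hf.
  apply: le_trans (rsum_le_norm sh) _; apply: fine_le.
  - by apply: rsummable_fin => //; exact: rsummable_norm.
  - by apply: rsummable_fin => // i _; exact: normc_ge0.
  - by apply: le_esum => i _; rewrite lee_fin.
have := le2 _ (fun i => le_Re_normc (f i)); have := le2 _ (fun i => le_Im_normc (f i)).
lra.
Qed.

End CSum.

Section CIntegral.
Variables (A : set R) (mA : measurable A).
Implicit Types f g : R -> R[i].
Local Notation mu := (@lebesgue_measure R).

Lemma integrable_mulrl (k : R) (h : R -> R) : mu.-integrable A (EFin \o h) ->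
  mu.-integrable A (EFin \o (fun t => k * h t)).
Proof. by move=> ih; apply: (@integrableZl _ _ _ mu _ mA k (EFin \o h) ih). Qed.

Lemma integrable_addr (h1 h2 : R -> R) : mu.-integrable A (EFin \o h1) ->
  mu.-integrable A (EFin \o h2) -> mu.-integrable A (EFin \o (fun t => h1 t + h2 t)).
Proof.
by move=> i1 i2; apply: (@integrableD _ _ _ mu _ mA (EFin \o h1) (EFin \o h2) i1 i2).
Qed.

Lemma integral_EFinE (h : R -> R) : mu.-integrable A (EFin \o h) ->
  (\int[mu]_(t in A) (h t)%:E)%E = (\int[mu]_(t in A) h t)%:E.
Proof.
by move=> ih; rewrite /Rintegral fineK// (@integrable_fin_num _ _ _ mu _ mA _ ih).
Qed.

Definition cintegrable f := mu.-integrable A (EFin \o (fun t => complex.Re (f t))) /\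
  mu.-integrable A (EFin \o (fun t => complex.Im (f t))).

Definition cmeasurable f := measurable_fun A (fun t => complex.Re (f t)) /\
  measurable_fun A (fun t => complex.Im (f t)).

Lemma le_cintegrable f (g : R -> R) : cmeasurable f ->
  (forall t, A t -> Normc.normc (f t) <= g t) ->
  mu.-integrable A (EFin \o g) -> cintegrable f.
Proof.
move=> [mr mi] fg ig; split; apply: le_integrable ig => //.
- exact/measurable_EFinP.
- move=> t At /=; rewrite lee_fin (le_trans (le_Re_normc _))// (le_trans (fg _ At))//.
  exact: ler_norm.
- exact/measurable_EFinP.
- move=> t At /=; rewrite lee_fin (le_trans (le_Im_normc _))// (le_trans (fg _ At))//.
  exact: ler_norm.
Qed.

Lemma eq_cintegral f g : (forall t, A t -> f t = g t) ->
  cintegral A f = cintegral A g.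
Proof.
by move=> fg; rewrite /cintegral; congr (_ +i* _); apply: eq_Rintegral => t /set_mem At; rewrite fg.
Qed.

Lemma cintegrableD f g : cintegrable f -> cintegrable g ->
  cintegrable (fun t => f t + g t).
Proof.
move=> [fr fi] [gr gi]; split.
  rewrite (_ : (fun t => _) = (fun t => complex.Re (f t) + complex.Re (g t))).
    exact: integrable_addr.
  by apply/funext => t; exact: ReD.
rewrite (_ : (fun t => _) = (fun t => complex.Im (f t) + complex.Im (g t))).
  exact: integrable_addr.
by apply/funext => t; exact: ImD.
Qed.

Lemma cintegralD f g : cintegrable f -> cintegrable g ->
  cintegral A (fun t => f t + g t) = cintegral A f + cintegral A g.
Proof.
move=> [fr fi] [gr gi]; apply: complex_eq; rewrite ?ReD ?ImD /= -RintegralD//.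
  by apply: eq_Rintegral => t _; rewrite ReD.
by apply: eq_Rintegral => t _; rewrite ImD.
Qed.

Lemma cintegralZ c f : cintegrable f ->
  cintegral A (fun t => c * f t) = c * cintegral A f.
Proof.
move=> [fr fi].
have iZ := integrable_mulrl.
apply: complex_eq; rewrite ?ReM ?ImM /= -!RintegralZl//.
  rewrite -RintegralB//; try exact: iZ.
  by apply: eq_Rintegral => t _; rewrite ReM.
rewrite -RintegralD//; try exact: iZ.
by apply: eq_Rintegral => t _; rewrite ImM.
Qed.

Lemma normc_cintegral_le f (g : R -> R) : cintegrable f ->
  (forall t, A t -> Normc.normc (f t) <= g t) ->
  mu.-integrable A (EFin \o g) ->
  Normc.normc (cintegral A f) <= 2 * \int[mu]_(t in A) g t.
Proof.
move=> [fr fi] fg ig; apply: le_trans (normc_le _) _ => /=.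
have h (k : R -> R) : mu.-integrable A (EFin \o k) ->
    (forall t, A t -> `|k t| <= g t) ->
    `|\int[mu]_(t in A) k t| <= \int[mu]_(t in A) g t.
  move=> ik kg; apply: le_trans (le_normr_Rintegral _ _) _ => //.
  apply: le_Rintegral => //.
  exact: integrable_norm.
have := h _ fr (fun t At => le_trans (le_Re_normc _) (fg t At)).
have := h _ fi (fun t At => le_trans (le_Im_normc _) (fg t At)).
by move=> hi hr; rewrite mulr_natl mulr2n lerD.
Qed.

Lemma measurable_normc f : cmeasurable f ->
  measurable_fun A (fun t => Normc.normc (f t)).
Proof.
move=> [mr mi]; apply: (@eq_measurable_fun _ _ _ _ A
    (fun t => Num.sqrt (complex.Re (f t) ^+ 2 + complex.Im (f t) ^+ 2))).
  by move=> t _; rewrite normcE.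
apply: measurableT_comp => //.
  by apply: continuous_measurable_fun; exact: sqrt_continuous.
by apply: measurable_funD; apply: measurable_funX.
Qed.

Lemma cintegrable_normc f : cintegrable f ->
  mu.-integrable A (EFin \o (fun t => Normc.normc (f t))).
Proof.
move=> [fr fi]; have nr := @integrable_norm _ _ _ mu A _ fr.
have ni := @integrable_norm _ _ _ mu A _ fi.
apply: le_integrable (integrable_addr nr ni) => //.
  apply/measurable_EFinP; apply: measurable_normc; split.
    by apply/measurable_EFinP; exact: measurable_int fr.
  by apply/measurable_EFinP; exact: measurable_int fi.
move=> t At /=; rewrite lee_fin ger0_norm ?normc_ge0// ger0_norm ?addr_ge0//.
exact: normc_le.
Qed.

(** Absolute convergence passes to the real and imaginary parts, to which
    [rsum_Rintegral] applies. *)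
Lemma csum_cintegral (T : countType) (D : set T) (f : T -> R -> R[i]) :
  (forall i, D i -> cmeasurable (f i)) ->
  (forall t, A t -> csummable D (f ^~ t)) ->
  (\esum_(i in D) \int[mu]_(t in A) (Normc.normc (f i t))%:E < +oo)%E ->
  cintegrable (fun t => csum D (f ^~ t)) /\
  csum D (fun i => cintegral A (f i)) = cintegral A (fun t => csum D (f ^~ t)).
Proof.
move=> mf sf If.
have le (h : R[i] -> R) : (forall s, `|h s| <= Normc.normc s) ->
    (forall i, D i -> measurable_fun A (fun t => h (f i t))) ->
    (\esum_(i in D) \int[mu]_(t in A) `|h (f i t)|%:E < +oo)%E.
  move=> hn mh; apply: le_lt_trans If; apply: le_esum => i Di.
  apply: ge0_le_integral => //.
  - by apply/measurable_EFinP; apply: measurableT_comp => //; exact: mh.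
  - apply/measurable_EFinP.
    exact: measurable_normc (mf _ Di).
  - by move=> t _; rewrite lee_fin.
have [ir _ er] := @rsum_Rintegral R T _ _ mu A mA D (fun i t => complex.Re (f i t))
   (fun i Di => (mf i Di).1) (fun t At => csummable_Re (sf t At)) (le _ le_Re_normc (fun i Di => (mf i Di).1)).
have [ii _ ei] := @rsum_Rintegral R T _ _ mu A mA D (fun i t => complex.Im (f i t))
   (fun i Di => (mf i Di).2) (fun t At => csummable_Im (sf t At)) (le _ le_Im_normc (fun i Di => (mf i Di).2)).
by split=> //; rewrite /csum /cintegral; congr (_ +i* _).
Qed.

End CIntegral.
End ComplexKit.

(** * Changes of variables and improper integrals *)

Section AffineChange.
Variables (R : realType) (k b : R).
Hypothesis k0 : 0 < k.
Local Notation mu := (@lebesgue_measure R).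

Let phi : measurableTypeR R -> measurableTypeR R := fun x => k * x + b.

Lemma measurable_affine : measurable_fun [set: measurableTypeR R] phi.
Proof. by apply: measurable_funD => //; apply: measurable_funM. Qed.

Let push : {measure set (measurableTypeR R) -> \bar R} :=
  measure_function_pushforward__canonical__measure_function_Measure mu measurable_affine.

Let m := mscale (NngNum (ltW k0)) push.

(** The scaled image measure agrees with Lebesgue measure on half-open
    intervals. *)
Lemma lebesgue_measure_affine A : measurable A -> mu A = m A.
Proof.
move=> mA; apply: lebesgue_measure_unique => //= _ [[c d]] _ <-.
rewrite /m /mscale/= /pushforward.
have -> : phi @^-1` [set` `]c, d]] = [set` `](c - b) / k, (d - b) / k]].
  apply/seteqP; split => x; rewrite /= !in_itv/= /phi.
    by rewrite ltr_pdivrMr// ler_pdivlMr// ltrBlDr lerBrDr mulrC.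
  by rewrite ltr_pdivrMr// ler_pdivlMr// ltrBlDr lerBrDr mulrC.
rewrite !lebesgue_measure_itv/= !lte_fin ltr_pM2r ?invr_gt0// ltrD2r.
case: ifPn => _; last by rewrite mule0.
rewrite -!EFinB -EFinM; congr _%:E.
by field; rewrite gt_eqF.
Qed.

Lemma ge0_integral_affine (D : set (measurableTypeR R)) (f : R -> \bar R) :
  measurable D -> measurable_fun D f -> (forall x, D x -> 0 <= f x)%E ->
  ((\int[mu]_(x in D) f x) =
   k%:E * \int[mu]_(x in phi @^-1` D) f (k * x + b)%R)%E.
Proof.
move=> mD mf f0.
rewrite (@eq_measure_integral _ _ _ D m) => [|A mA _]; last exact: lebesgue_measure_affine.
rewrite ge0_integral_mscale//=.
rewrite ge0_integral_pushforward//; first exact: measurable_affine.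
by move=> x /set_mem; exact: f0.
Qed.

Lemma measurable_affine_preimage (D : set (measurableTypeR R)) :
  measurable D -> measurable (phi @^-1` D).
Proof. by move=> mD; rewrite -[X in measurable X]setTI; exact: measurable_affine. Qed.

Lemma integrable_affine (D : set (measurableTypeR R)) (f : R -> R) :
  measurable D -> mu.-integrable D (EFin \o f) ->
  mu.-integrable (phi @^-1` D) (EFin \o (fun x => f (k * x + b))) /\
  \int[mu]_(x in D) f x = k * \int[mu]_(x in phi @^-1` D) f (k * x + b).
Proof.
move=> mD fi.
have mf : measurable_fun D (EFin \o f) by exact: measurable_int fi.
have mp := measurable_affine_preimage mD.
have mf' : measurable_fun (phi @^-1` D) (EFin \o (f \o phi)).
  apply: (@measurable_comp _ _ _ _ _ _ D (EFin \o f) _ phi) => //.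
  - by move=> _ [x /= ? <-].
  - exact: measurable_funS measurable_affine.
have iff : mu.-integrable (phi @^-1` D) (EFin \o (f \o phi)).
  apply/integrableP; split => //.
  have ma : measurable_fun D (fun x => `|f x|%:E).
    by move/measurable_EFinP : mf => mf2; apply/measurable_EFinP; exact: measurableT_comp.
  move/integrableP : (fi) => [_ /=]; rewrite (ge0_integral_affine mD ma)//=.
  set X := (X in (_ * X < _)%E -> _); set Y := (Y in _ -> (Y < _)%E).
  have -> : Y = X by [].
  have : (0 <= X)%E by apply: integral_ge0 => x _.
  by case: X => [r _ _|_|//]; [exact: ltry|rewrite gt0_muley// lte_fin].
split => //; rewrite /Rintegral integralE [in RHS]integralE.
have fp : measurable_fun D (EFin \o f)^\+%E by exact: measurable_funepos.
have fn : measurable_fun D (EFin \o f)^\-%E by exact: measurable_funeneg.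
rewrite !(ge0_integral_affine mD)//.
have := integrable_pos_fin_num mp iff; have := integrable_neg_fin_num mp iff.
set X := integral _ _ _; set Y := integral _ _ _ => Xf Yf.
transitivity (fine (k%:E * Y - k%:E * X)%E).
  congr (fine (_ * _ - _ * _)%E); apply: eq_integral => x _.
    by rewrite !funeposE.
  by rewrite !funenegE.
by rewrite -(fineK Xf) -(fineK Yf) -!EFinM -!EFinB /= mulrBr.
Qed.

End AffineChange.

Section ImproperFTC.
Variable R : realType.
Local Notation mu := (@lebesgue_measure R).
Local Notation pos := (`]0, +oo[%classic : set R).

Let cpt (n : nat) : set R := `[(n.+2%:R)^-1, n.+2%:R]%classic.

Let cpt_lt n : (n.+2%:R)^-1 < n.+2%:R :> R.
Proof.
by rewrite (@lt_trans _ _ 1)// ?ltr1n// invf_lt1// ltr1n.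
Qed.

Let cpt_nd : nondecreasing_seq cpt.
Proof.
apply/nondecreasing_seqP => n; apply/subsetPset => x; rewrite /cpt/= !in_itv/= => /andP[h1 h2].
apply/andP; split; first by apply: le_trans h1; rewrite lef_pV2 ?posrE// ler_nat.
by apply: le_trans h2 _; rewrite ler_nat.
Qed.

Let cpt_bigcup : \bigcup_n cpt n = pos.
Proof.
apply/seteqP; split => x.
  move=> [n _]; rewrite /cpt/= !in_itv/= => /andP[h1 _]; rewrite andbT.
  by apply: lt_le_trans h1.
rewrite /= in_itv/= andbT => x0.
pose n := maxn (Num.bound x) (Num.bound x^-1).
exists n => //; rewrite /cpt/= in_itv/=; apply/andP; split.
  rewrite -[x]invrK lef_pV2 ?posrE ?invr_gt0//.
  apply: ltW; apply: lt_le_trans (archi_boundP _) _; first by rewrite invr_ge0 ltW.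
  by rewrite ler_nat -addn2 (leq_trans (leq_maxr (Num.bound x) _))// leq_addr.
apply: ltW; apply: lt_le_trans (archi_boundP (ltW x0)) _.
by rewrite ler_nat -addn2 (leq_trans (leq_maxl _ (Num.bound x^-1)))// leq_addr.
Qed.

Let cpt_measurable n : measurable (cpt n). Proof. exact: measurable_itv. Qed.

Let cpt_sub n : cpt n `<=` pos.
Proof. by rewrite -cpt_bigcup; exact: bigcup_sup. Qed.

Section FTC.
Variables (f F : R -> R) (l0 l1 : R).
Hypothesis cf : forall x : R, 0 < x -> {for x, continuous f}.
Hypothesis dF : forall x : R, 0 < x -> is_derive x (1:R) F (f x).
Hypothesis F0 : F x @[x --> 0^'+] --> l0.
Hypothesis F1 : F x @[x --> +oo] --> l1.

Let FTC_cpt n :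
  (\int[mu]_(x in cpt n) (f x)%:E = (F n.+2%:R - F (n.+2%:R)^-1)%:E)%E.
Proof.
rewrite EFinB; apply: continuous_FTC2; first exact: cpt_lt.
- apply: continuous_in_subspaceT => x /set_mem /cpt_sub /=.
  by rewrite in_itv/= andbT; exact: cf.
- have cF x : 0 < x -> {for x, continuous F}.
    by move=> x0; apply/differentiable_continuous/derivable1_diffP; have [] := dF x0.
  split.
  + move=> x; rewrite in_itv/= => /andP[x0 _].
    by have [] := dF (lt_trans (_ : 0 < (n.+2%:R)^-1) x0) => //; rewrite invr_gt0.
  + by apply: cvg_at_right_filter; apply: cF; rewrite invr_gt0.
  + by apply: cvg_at_left_filter; apply: cF.
- move=> x; rewrite in_itv/= => /andP[x0 _].
  by rewrite derive1E; have [] := dF (lt_trans (_ : 0 < (n.+2%:R)^-1) x0) => //; rewrite invr_gt0.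
Qed.

Let cvg_F : (F n.+2%:R - F (n.+2%:R)^-1) @[n --> \oo] --> l1 - l0.
Proof.
apply: cvgB.
  apply: (cvg_pinftyP F l1).1 F1 (fun n => n.+2%:R) _.
  apply/cvgryPge => A; near=> n; apply: (@le_trans _ _ n%:R).
    by near: n; exact: nbhs_infty_ger.
  by rewrite ler_nat -addn2 leq_addr.
apply: (cvg_at_rightP F 0 l0).1 F0 (fun n => (n.+2%:R)^-1) _.
split=> [n|]; first by rewrite invr_gt0.
by rewrite (cvg_shiftS (fun n => (n.+1%:R)^-1 : R)); exact: cvg_harmonic.
Unshelve. all: by end_near. Qed.

Let mpos : measurable pos. Proof. exact: measurable_itv. Qed.

Let mf : measurable_fun pos f.
Proof.
apply: open_continuous_measurable_fun => //.
by move=> x /set_mem /=; rewrite in_itv/= andbT; exact: cf.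
Qed.

Let cvg_cpt (g : R -> \bar R) : measurable_fun pos g ->
    (forall x, 0 <= g x)%E ->
  (\int[mu]_(x in cpt n) g x)%E @[n --> \oo] --> (\int[mu]_(x in pos) g x)%E.
Proof.
move=> mg g0; rewrite -cpt_bigcup; apply: ge0_nondecreasing_set_cvg_integral => //.
by move=> n; apply: measurable_funS mg => //; exact: cpt_sub.
Qed.

(** The fundamental theorem of calculus on the half-line, by exhaustion with
    compact intervals. *)
Lemma ge0_FTC_pos : (forall x, 0 < x -> 0 <= f x) ->
  (\int[mu]_(x in pos) (f x)%:E)%E = (l1 - l0)%:E.
Proof.
move=> f0; pose g x := (Num.max (f x) 0)%:E.
have gf x : pos x -> g x = (f x)%:E.
  by rewrite /= in_itv/= andbT => /f0 fx; rewrite /g; congr _%:E; apply/max_idPl.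
transitivity (\int[mu]_(x in pos) g x)%E.
  by apply: eq_integral => x /set_mem /gf.
have : (\int[mu]_(x in cpt n) g x)%E @[n --> \oo] --> (\int[mu]_(x in pos) g x)%E.
  apply: cvg_cpt => [|x]; last by rewrite lee_fin le_max lexx orbT.
  by apply/measurable_EFinP; exact: measurable_maxr.
move/cvg_lim => <- //; apply/cvg_lim => //.
rewrite (_ : (fun n => _) = EFin \o (fun n => F n.+2%:R - F (n.+2%:R)^-1)).
  by apply/fine_cvgP; split; [exact: nearW|exact: cvg_F].
apply/funext => n /=; rewrite -FTC_cpt; apply: eq_integral => x /set_mem.
by move=> /cpt_sub /gf.
Qed.

Lemma ge0_FTC_pos_integrable : (forall x, 0 < x -> 0 <= f x) ->
  mu.-integrable pos (EFin \o f).
Proof.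
move=> f0; apply/integrableP; split; first exact/measurable_EFinP.
rewrite (_ : integral _ _ _ = (l1 - l0)%:E) ?ltry//.
rewrite -ge0_FTC_pos//; apply: eq_integral => x /set_mem /=.
by rewrite in_itv/= andbT => /f0 fx; rewrite ger0_norm.
Qed.

(** The integrals of the positive and of the negative part converge separately
    along the exhaustion. *)
Lemma FTC_pos : mu.-integrable pos (EFin \o f) ->
  \int[mu]_(x in pos) f x = l1 - l0.
Proof.
move=> fi; rewrite /Rintegral.
suff -> : (\int[mu]_(x in pos) (f x)%:E)%E = (l1 - l0)%:E by [].
have fp := @cvg_cpt ((EFin \o f)^\+)%E (measurable_funepos (measurable_int mu fi)) (funepos_ge0 _).
have fn := @cvg_cpt ((EFin \o f)^\-)%E (measurable_funeneg (measurable_int mu fi)) (funeneg_ge0 _).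
rewrite integralE.
have := cvgeB _ fp fn.
have pfin := @integrable_pos_fin_num _ _ _ mu _ mpos _ fi.
move=> /(_ _ (fin_num_adde_defr _ pfin))/cvg_lim <- //; apply/cvg_lim => //.
rewrite (_ : (fun n => _) = EFin \o (fun n => F n.+2%:R - F (n.+2%:R)^-1)).
  by apply/fine_cvgP; split; [exact: nearW|exact: cvg_F].
by apply/funext => n; rewrite [RHS]/= -FTC_cpt [RHS]integralE.
Qed.

End FTC.
End ImproperFTC.

Section RealDerivatives.
Variable R : realType.
Implicit Types (f g : R -> R) (x a b : R).

Lemma derive_continuous f x a : is_derive x 1 f a -> {for x, continuous f}.
Proof.
by move=> [df _]; apply/differentiable_continuous/derivable1_diffP.
Qed.

Lemma derive_eq f x a b : is_derive x 1 f a -> a = b -> is_derive x 1 f b.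
Proof. by move=> df <-. Qed.

Lemma is_deriveDf f g x a b : is_derive x 1 f a -> is_derive x 1 g b ->
  is_derive x 1 (fun t => f t + g t) (a + b).
Proof. by move=> df dg; exact: is_deriveD. Qed.

Lemma is_deriveMf f g x a b : is_derive x 1 f a -> is_derive x 1 g b ->
  is_derive x 1 (fun t => f t * g t) (f x * b + a * g x).
Proof.
by move=> df dg; apply: derive_eq (is_deriveM df dg) _; rewrite /GRing.scale/=; ring.
Qed.

Lemma is_derive_cstf c x : is_derive x 1 (fun _ : R => c : R) 0.
Proof. exact: is_derive_cst. Qed.

Lemma is_deriveZf c f x a : is_derive x 1 f a ->
  is_derive x 1 (fun t => c * f t) (c * a).
Proof. by move=> df; apply: derive_eq (is_deriveMf (is_derive_cstf c x) df) _; rewrite mul0r addr0. Qed.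

Lemma is_deriveNf f x a : is_derive x 1 f a -> is_derive x 1 (fun t => - f t) (- a).
Proof. by move=> df; exact: is_deriveN. Qed.

Lemma is_deriveVf f x a : is_derive x 1 f a -> f x != 0 ->
  is_derive x 1 (fun t => (f t)^-1) (- (a / f x ^+ 2)).
Proof.
move=> df fx; apply: derive_eq (is_deriveV fx df) _.
by rewrite /GRing.scale/= mulNr mulrC.
Qed.

Lemma is_derive_idf x : is_derive x 1 (fun t : R => t) 1.
Proof. exact: is_derive_id. Qed.

End RealDerivatives.

(** * Euler's integral *)

Section GammaIntegral.
Variable R : realType.
Local Notation mu := (@lebesgue_measure R).
Local Notation pos := (`]0, +oo[%classic : set R).
Implicit Types (x t p q : R) (s : R[i]).

Lemma posE t : pos t = (0 < t) :> Prop.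
Proof. by rewrite /= in_itv/= andbT. Qed.

Lemma measurable_pos : measurable pos.
Proof. exact: measurable_itv. Qed.

Lemma measurable_expRNM (D : set R) x :
  measurable_fun D (fun t : R => expR (- (x * t))).
Proof.
apply: measurableT_comp; first exact: measurable_expR.
apply: measurableT_comp; first exact: oppr_measurable.
exact: measurable_funM.
Qed.

(** With [u = t x / p] this is [ln u <= u]. *)
Lemma powR_expR_le p x t : 0 < p -> 0 < x -> 0 < t ->
  t `^ p * expR (- (x * t)) <= (p / x) `^ p.
Proof.
move=> p0 x0 t0; have q0 : 0 < p / x by rewrite divr_gt0.
pose u := t / (p / x); have u0 : 0 < u by rewrite divr_gt0.
have -> : t = (p / x) * u by rewrite mulrC divfK// gt_eqF.
rewrite (powRM p (ltW q0) (ltW u0)) -mulrA ler_piMr ?powR_ge0//.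
rewrite expRN ler_pdivrMr ?expR_gt0// mul1r.
rewrite /powR gt_eqF// ler_expR.
have -> : x * (p / x * u) = p * u by field; rewrite gt_eqF.
by rewrite ler_pM2l// ltW// ln_sublinear.
Qed.

Lemma powR_pinfty p : 0 < p -> t `^ p @[t --> +oo] --> +oo.
Proof.
move=> p0; apply/cvgryPge => A; near=> t.
have t1 : Num.max A 1 `^ p^-1 <= t by near: t; exact: nbhs_pinfty_ge.
have A0 : 0 <= Num.max A 1 by rewrite le_max ler01 orbT.
apply: (@le_trans _ _ (Num.max A 1)); first by rewrite le_max lexx.
have -> : Num.max A 1 = (Num.max A 1 `^ p^-1) `^ p.
  by rewrite -powRrM mulVf ?gt_eqF// powRr1.
apply: ge0_ler_powR => //; rewrite ?nnegrE ?powR_ge0// ?ltW//.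
Unshelve. all: by end_near. Qed.

(** The integrand is dominated by a multiple of the derivative of the bounded
    increasing function [1 - (1 + t ^ p)^-1]: this takes care at once of the
    singularity at the origin and of infinity. *)
Lemma integrable_gamma p x : 0 < p -> 0 < x ->
  mu.-integrable pos (EFin \o (fun t => t `^ (p - 1) * expR (- (x * t)))).
Proof.
move=> p0 x0.
pose F t : R := 1 - (1 + t `^ p)^-1; pose f t : R := (1 + t `^ p) ^- 2 * (p * t `^ (p - 1)).
have pw t : 0 <= t `^ p by exact: powR_ge0.
have p1 t : 0 < 1 + t `^ p by rewrite ltr_pwDl.
have dp t : 0 < t -> is_derive t (1:R) (fun t => 1 + t `^ p) (p * t `^ (p - 1)).
  move=> t0; apply: derive_eq (is_deriveDf (is_derive_cstf 1 t) (is_derive1_powR p t0)) _.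
  by rewrite add0r.
have dF t : 0 < t -> is_derive t (1 : R) F (f t).
  move=> t0; have nz : 1 + t `^ p != 0 by rewrite gt_eqF.
  rewrite /F; apply: derive_eq (is_deriveDf (is_derive_cstf 1 t) (is_deriveNf (is_deriveVf (dp _ t0) nz))) _.
  by rewrite /f add0r opprK mulrC.
have f0 t : 0 < t -> 0 <= f t.
  by move=> t0; rewrite /f mulr_ge0 ?invr_ge0 ?exprn_ge0 ?mulr_ge0 ?powR_ge0 ?addr_ge0// ltW.
have df t : 0 < t -> exists d, is_derive t (1:R) f d.
  move=> t0; eexists.
  have nz : (1 + t `^ p) ^+ 2 != 0 by rewrite expf_neq0// gt_eqF.
  exact: is_deriveMf (is_deriveVf (is_deriveX 2 (dp _ t0)) nz)
    (is_deriveZf p (is_derive1_powR (p - 1) t0)).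
have F0 : F t @[t --> 0^'+] --> (1 - (1 + 0)^-1 : R).
  apply: cvgB; first exact: cvg_cst.
  apply: cvgV; first by rewrite addr0 oner_neq0.
  apply: cvgD; first exact: cvg_cst.
  exact: powR_cvg0.
rewrite addr0 invr1 subrr in F0.
have F1 : F t @[t --> +oo] --> (1 - 0 : R).
  apply: cvgB; first exact: cvg_cst.
  apply/gtr0_cvgV0; first by apply: nearW.
  apply: (@ger_cvgy _ _ _ _ (fun t => t `^ p)); last exact: powR_pinfty.
  by apply: nearW => t; rewrite lerDr.
have cf t : 0 < t -> {for t, continuous f}.
  by move=> /df[d]; exact: derive_continuous.
have cF := ge0_FTC_pos_integrable cf dF F0 F1 f0.
pose M := 2 + 2 * (p *+ 2 / x) `^ (p *+ 2).
have M0 : 0 <= M / p by rewrite divr_ge0 ?addr_ge0 ?mulr_ge0 ?powR_ge0 ?(ltW p0).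
have : mu.-integrable pos (EFin \o (fun t => M / p * f t)).
  exact: (@integrableZl _ _ _ mu _ measurable_pos (M / p) (EFin \o f)).
apply: le_integrable => //.
  apply/measurable_EFinP; apply: measurable_funM.
    exact: measurable_funS (measurable_powR _).
  exact: measurable_expRNM.
move=> t; rewrite posE => t0 /=; rewrite lee_fin.
rewrite ger0_norm ?mulr_ge0 ?powR_ge0 ?expR_ge0// ger0_norm; last first.
  by rewrite mulr_ge0 ?f0.
rewrite /f.
have -> : M / p * ((1 + t `^ p) ^- 2 * (p * t `^ (p - 1))) = t `^ (p - 1) * (M / (1 + t `^ p) ^+ 2).
  by field; rewrite gt_eqF// gt_eqF.
rewrite ler_wpM2l ?powR_ge0// ler_pdivlMr ?exprn_gt0//.
have e1 : expR (- (x * t)) <= 1 by rewrite -expR0 ler_expR oppr_le0 mulr_ge0// ltW.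
have := @powR_expR_le (p *+ 2) x t; rewrite pmulrn_lgt0// => /(_ p0 x0 t0).
have -> : t `^ (p *+ 2) = (t `^ p) ^+ 2.
  by rewrite -mulr_natr powRrM powR_mulrn ?powR_ge0.
rewrite /M; have := expR_gt0 (- (x * t)); have := pw t.
move: e1; set a := t `^ p; set b := expR _; set c := powR _ _ => e1 a0 b0 abc.
have := mulr_ge0 (ltW b0) (sqr_ge0 (1 - a)).
by clear -e1 abc; lra.
Qed.

Lemma cmeasurable_cpow s (g : R -> R) : measurable_fun pos g ->
  cmeasurable pos (fun t => cpow t s * (g t)%:C).
Proof.
move=> mg.
have ml : measurable_fun pos (@ln R) by exact: measurable_funS (@measurable_ln R).
have mc (k : R) : measurable_fun pos (fun t => k * ln t) by exact: measurable_funM.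
have me : measurable_fun pos (fun t => expR (complex.Re s * ln t)).
  by apply: measurableT_comp; [exact: measurable_expR|exact: mc].
split.
  apply: (@eq_measurable_fun _ _ _ _ pos (fun t => expR (complex.Re s * ln t) * cos (complex.Im s * ln t) * g t)).
    by move=> t _; rewrite ReM cpowE /= mulr0 subr0.
  apply: measurable_funM => //; apply: measurable_funM => //.
  apply: measurableT_comp; last exact: mc.
  by apply: continuous_measurable_fun; exact: continuous_cos.
apply: (@eq_measurable_fun _ _ _ _ pos (fun t => expR (complex.Re s * ln t) * sin (complex.Im s * ln t) * g t)).
  by move=> t _; rewrite ImM cpowE /= mulr0 add0r.
apply: measurable_funM => //; apply: measurable_funM => //.
apply: measurableT_comp; last exact: mc.
by apply: continuous_measurable_fun; exact: continuous_sin.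
Qed.

(** Euler's integrand with the exponential rescaled by [x]. *)
Definition gamma_kernel s x t : R[i] := cpow t (s - 1) * (expR (- (x * t)))%:C.

Lemma normc_gamma_kernel s x t : 0 < t ->
  Normc.normc (gamma_kernel s x t) = t `^ (complex.Re s - 1) * expR (- (x * t)).
Proof.
move=> t0; rewrite /gamma_kernel Normc.normcM normc_cpow// normc_real ger0_norm//.
by rewrite ReD ReN Re1.
Qed.

Lemma cmeasurable_gamma_kernel s x : cmeasurable pos (gamma_kernel s x).
Proof.
apply: (@cmeasurable_cpow (s - 1) (fun t => expR (- (x * t)))).
exact: measurable_expRNM.
Qed.

Lemma cintegrable_gamma_kernel s x : 0 < complex.Re s -> 0 < x ->
  cintegrable pos (gamma_kernel s x).
Proof.
move=> s0 x0; apply: (le_cintegrable measurable_pos) (integrable_gamma s0 x0).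
  exact: cmeasurable_gamma_kernel.
by move=> t; rewrite posE => t0; rewrite normc_gamma_kernel.
Qed.

Lemma GammaE s : Gamma s = cintegral pos (gamma_kernel s 1).
Proof. by apply: eq_cintegral => t _; rewrite /gamma_kernel mul1r. Qed.

Lemma cintegral_scale k (f : R -> R[i]) : 0 < k -> cintegrable pos f ->
  cintegral pos f = k%:C * cintegral pos (fun t => f (k * t)).
Proof.
move=> k0 [fr fi].
have e : (fun x : R => k * x + 0) @^-1` pos = pos.
  by apply/seteqP; split=> t; rewrite /preimage/= !in_itv/= !andbT addr0 pmulr_rgt0.
have h (g : R -> R) : mu.-integrable pos (EFin \o g) ->
    \int[mu]_(t in pos) g t = k * \int[mu]_(t in pos) g (k * t).
  move=> gi; have [_ ->] := @integrable_affine R k 0 k0 pos g measurable_pos gi.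
  by rewrite e; under eq_Rintegral do rewrite addr0.
by apply: complex_eq; rewrite ?ReM ?ImM /= ?mul0r ?subr0 ?addr0 h.
Qed.

Lemma cintegral_gamma_kernel s x : 0 < complex.Re s -> 0 < x ->
  cintegral pos (gamma_kernel s x) = cpow x (- s) * Gamma s.
Proof.
move=> s0 x0; rewrite GammaE (cintegral_scale x0 (cintegrable_gamma_kernel s0 ltr01)).
rewrite -[x%:C](_ : cpow x 1 = _); last by rewrite (cpow_real 1 x0) powRr1 ?ltW.
rewrite [in RHS](eq_cintegral (g := fun t => cpow x (s - 1) * gamma_kernel s x t)); last first.
  move=> t; rewrite posE => t0; rewrite /gamma_kernel cpowM// mul1r mulrA//.
rewrite (cintegralZ measurable_pos); last exact: cintegrable_gamma_kernel.
by rewrite !mulrA -!cpowD (_ : - s + 1 + (s - 1) = 0) ?cpow0 ?mul1r//; ring.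
Qed.

End GammaIntegral.
Arguments measurable_pos {R}.

Section GammaEquation.
Variable R : realType.
Local Notation mu := (@lebesgue_measure R).
Local Notation pos := (`]0, +oo[%classic : set R).
Implicit Types (x t p q y : R) (s : R[i]).

Lemma gamma_kernelS s t : 0 < t ->
  gamma_kernel (s + 1) 1 t = cpow t s * (expR (- t))%:C.
Proof. by move=> t0; rewrite /gamma_kernel addrK mul1r. Qed.

Lemma gamma_kernelV s t : 0 < t ->
  gamma_kernel s 1 t = cpow t s * (t^-1 * expR (- t))%:C.
Proof.
move=> t0; rewrite /gamma_kernel cpowD mul1r -mulrA; congr (_ * _).
by rewrite cpowV (cpow_real 1 t0) powRr1 ?ltW// -fmorphV -rmorphM.
Qed.

Let bound0 s t : 0 < t ->
  Normc.normc (cpow t s * (expR (- t))%:C) <= t `^ complex.Re s.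
Proof.
move=> t0; rewrite Normc.normcM normc_cpow// normc_real ger0_norm ?expR_ge0//.
by rewrite ler_piMr ?powR_ge0// -expR0 ler_expR oppr_le0 ltW.
Qed.

Let bound1 s t : 0 < complex.Re s -> 0 < t ->
  Normc.normc (cpow t s * (expR (- t))%:C) <=
  (complex.Re s / 2^-1) `^ complex.Re s * expR (- (2^-1 * t)).
Proof.
move=> s0 t0; rewrite Normc.normcM normc_cpow// normc_real ger0_norm ?expR_ge0//.
have -> : - t = - (2^-1 * t) + - (2^-1 * t) by field.
rewrite expRD mulrA ler_wpM2r ?expR_ge0//.
by apply: powR_expR_le => //; rewrite invr_gt0.
Qed.

Let cvg0 s (h : R[i] -> R) : 0 < complex.Re s ->
  (forall z, `|h z| <= Normc.normc z) ->
  h (cpow t s * (expR (- t))%:C) @[t --> 0^'+] --> (0 : R).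
Proof.
move=> s0 hn; apply: (@squeeze_cvgr _ _ _ _ (fun t => - t `^ complex.Re s) (fun t => t `^ complex.Re s)).
- near=> t; have t0 : 0 < t by near: t; exact: nbhs_right_gt.
  by rewrite -ler_norml; apply: le_trans (hn _) (bound0 _ t0).
- by have := cvgN (powR_cvg0 s0); rewrite oppr0; exact.
- exact: powR_cvg0.
Unshelve. all: by end_near. Qed.

Let cvg1 s (h : R[i] -> R) : 0 < complex.Re s ->
  (forall z, `|h z| <= Normc.normc z) ->
  h (cpow t s * (expR (- t))%:C) @[t --> +oo] --> (0 : R).
Proof.
move=> s0 hn; pose M := (complex.Re s / 2^-1) `^ complex.Re s.
have cM : M * expR (- (2^-1 * t)) @[t --> +oo] --> (0 : R).
  suff c : expR (- (2^-1 * t)) @[t --> +oo] --> (0 : R).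
    by have := cvgM (cvg_cst M) c; rewrite mulr0; exact.
  apply: (cvg_comp (fun t => 2^-1 * t) (fun t => expR (- t))); last exact: cvgr_expR.
  by apply: gt0_cvgMry => //; rewrite invr_gt0.
apply: (@squeeze_cvgr _ _ _ _ (fun t => - (M * expR (- (2^-1 * t)))) (fun t => M * expR (- (2^-1 * t)))).
- near=> t; have t0 : 0 < t by near: t; exact: nbhs_pinfty_gt.
  by rewrite -ler_norml; apply: le_trans (hn _) (bound1 s0 t0).
- by have := cvgN cM; rewrite oppr0; exact.
- exact: cM.
Unshelve. all: by end_near. Qed.

Let dfun s t := s * gamma_kernel s 1 t - gamma_kernel (s + 1) 1 t.

Let pwr s t := expR (complex.Re s * ln t).
Let arg s t := complex.Im s * ln t.

Let dln c t : 0 < t -> is_derive t (1:R) (fun t => c * ln t) (c * t^-1).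
Proof. by move=> t0; apply: is_deriveZf; exact: is_derive1_ln. Qed.

Let dpwr s t : 0 < t -> is_derive t (1:R) (pwr s) (pwr s t * (complex.Re s * t^-1)).
Proof.
move=> t0; exact: (is_derive1_comp (f := expR) (is_derive_expR _) (dln (complex.Re s) t0)).
Qed.

Let dcosarg s t : 0 < t ->
  is_derive t (1:R) (fun t => cos (arg s t)) (- sin (arg s t) * (complex.Im s * t^-1)).
Proof.
move=> t0; exact: (is_derive1_comp (f := @cos R) (is_derive_cos _) (dln (complex.Im s) t0)).
Qed.

Let dsinarg s t : 0 < t ->
  is_derive t (1:R) (fun t => sin (arg s t)) (cos (arg s t) * (complex.Im s * t^-1)).
Proof.
move=> t0; exact: (is_derive1_comp (f := @sin R) (is_derive_sin _) (dln (complex.Im s) t0)).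
Qed.

Let dexpN t : is_derive t (1:R) (fun t => expR (- t)) (- expR (- t)).
Proof.
apply: derive_eq (is_derive1_comp (f := expR) (is_derive_expR _) (is_deriveNf (is_derive_idf t))) _.
by rewrite mulrN1.
Qed.

Let dfunRe s t : 0 < t -> complex.Re (dfun s t) =
  pwr s t * expR (- t) * (cos (arg s t) * (complex.Re s * t^-1 - 1) - sin (arg s t) * (complex.Im s * t^-1)).
Proof.
move=> t0; rewrite /dfun gamma_kernelS// gamma_kernelV// cpowE ReD ReN !ReM !ImM /=.
rewrite /pwr /arg; ring.
Qed.

Let dfunIm s t : 0 < t -> complex.Im (dfun s t) =
  pwr s t * expR (- t) * (sin (arg s t) * (complex.Re s * t^-1 - 1) + cos (arg s t) * (complex.Im s * t^-1)).
Proof.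
move=> t0; rewrite /dfun gamma_kernelS// gamma_kernelV// cpowE ImD ImN !ImM !ReM /=.
rewrite /pwr /arg; ring.
Qed.

Let dV t : 0 < t -> is_derive t (1:R) (fun t => t^-1) (- (1 / t ^+ 2)).
Proof. by move=> t0; apply: is_deriveVf (is_derive_idf t) _; rewrite gt_eqF. Qed.

Let cdfun (u v : R -> R) a b s t : 0 < t -> is_derive t (1:R) u a -> is_derive t (1:R) v b ->
  {for t, continuous (fun t => pwr s t * expR (- t) *
     (u t * (complex.Re s * t^-1 - 1) + v t * (complex.Im s * t^-1)))}.
Proof.
move=> t0 du dv; apply: derive_continuous.
have h c := is_deriveZf c (dV t0).
exact: (is_deriveMf (is_deriveMf (dpwr s t0) (dexpN t))
  (is_deriveDf (is_deriveMf du (is_deriveDf (h (complex.Re s)) (is_derive_cstf (-1) t)))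
    (is_deriveMf dv (h (complex.Im s))))).
Qed.

Let integral_dfun (h : R[i] -> R) s (u v : R -> R) :
  0 < complex.Re s ->
  (forall z, `|h z| <= Normc.normc z) ->
  (forall t, 0 < t -> h (cpow t s * (expR (- t))%:C) = pwr s t * u t * expR (- t)) ->
  (forall t, 0 < t -> h (dfun s t) = pwr s t * expR (- t) *
     (u t * (complex.Re s * t^-1 - 1) + v t * (complex.Im s * t^-1))) ->
  (forall t, 0 < t -> is_derive t (1:R) u (v t * (complex.Im s * t^-1))) ->
  (forall t, 0 < t -> exists b, is_derive t (1:R) v b) ->
  mu.-integrable pos (EFin \o (fun t => h (dfun s t))) ->
  \int[mu]_(t in pos) h (dfun s t) = 0.
Proof.
move=> s0 hn hF hd du dv hi.
pose f t := pwr s t * expR (- t) *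
     (u t * (complex.Re s * t^-1 - 1) + v t * (complex.Im s * t^-1)).
pose F t := pwr s t * u t * expR (- t).
have fi : mu.-integrable pos (EFin \o f).
  by apply: eq_integrable hi => //= t; rewrite inE posE => t0 /=; rewrite hd.
have cf t : 0 < t -> {for t, continuous f}.
  by move=> t0; have [b vb] := dv _ t0; apply: (cdfun t0 (du _ t0) vb).
have dF t : 0 < t -> is_derive t (1:R) F (f t).
  move=> t0; apply: derive_eq (is_deriveMf (is_deriveMf (dpwr s t0) (du _ t0)) (dexpN t)) _.
  by rewrite /f; ring.
have F0 : F t @[t --> 0^'+] --> (0 : R).
  apply: cvg_trans (cvg0 s0 hn); apply: near_eq_cvg; near=> t.
  by rewrite hF//; near: t; exact: nbhs_right_gt.
have F1 : F t @[t --> +oo] --> (0 : R).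
  apply: cvg_trans (cvg1 s0 hn); apply: near_eq_cvg; near=> t.
  by rewrite hF//; near: t; exact: nbhs_pinfty_gt.
transitivity (\int[mu]_(t in pos) f t); last by rewrite (FTC_pos cf dF F0 F1 fi) subrr.
by apply: eq_Rintegral => t; rewrite inE posE => t0; rewrite hd.
Unshelve. all: by end_near. Qed.

(** The integrand of [s Gamma s - Gamma (s + 1)] is the derivative of
    [t^s exp (- t)], which vanishes at both ends. *)
Lemma GammaS s : 0 < complex.Re s -> Gamma (s + 1) = s * Gamma s.
Proof.
move=> s0.
have s1 : 0 < complex.Re (s + 1) by rewrite ReD addr_gt0.
have i0 := cintegrable_gamma_kernel s0 ltr01.
have i1 := cintegrable_gamma_kernel s1 ltr01.
have [r0 m0] := i0; have [r1 m1] := i1.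
have iL a b c (f g k : R -> R) : mu.-integrable pos (EFin \o f) ->
  mu.-integrable pos (EFin \o g) -> mu.-integrable pos (EFin \o k) ->
  mu.-integrable pos (EFin \o (fun t => a * f t + b * g t + c * k t)).
  move=> fi gi ki.
  have Z d h := @integrable_mulrl R pos measurable_pos d h.
  by do 2?apply: (integrable_addr measurable_pos); apply: Z.
have idr : mu.-integrable pos (EFin \o (fun t => complex.Re (dfun s t))).
  have := iL (complex.Re s) (- complex.Im s) (-1) _ _ _ r0 m0 r1.
  apply: eq_integrable => // t _; rewrite [LHS]/comp [RHS]/comp; congr _%:E.
  by rewrite /dfun ReD ReN (ReM s) mulNr mulN1r.
have idi : mu.-integrable pos (EFin \o (fun t => complex.Im (dfun s t))).
  have := iL (complex.Re s) (complex.Im s) (-1) _ _ _ m0 r0 m1.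
  apply: eq_integrable => // t _; rewrite [LHS]/comp [RHS]/comp; congr _%:E.
  by rewrite /dfun ImD ImN (ImM s) mulN1r.
have id : cintegrable pos (dfun s) by [].
apply/eqP; rewrite -subr_eq0 -opprB oppr_eq0; apply/eqP.
have -> : s * Gamma s - Gamma (s + 1) = cintegral pos (dfun s).
  have iZ : cintegrable pos (fun t => s * gamma_kernel s 1 t).
    split; [have := iL (complex.Re s) (- complex.Im s) 0 _ _ _ r0 m0 r0
           |have := iL (complex.Re s) (complex.Im s) 0 _ _ _ m0 r0 r0];
      apply: eq_integrable => // t _; rewrite [LHS]/comp [RHS]/comp; congr _%:E;
      rewrite ?(ReM s) ?(ImM s) mul0r addr0 ?mulNr//.
  rewrite !GammaE -(cintegralZ measurable_pos _ i0).
  apply/eqP; rewrite subr_eq; apply/eqP.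
  rewrite -(cintegralD measurable_pos id i1).
  by apply: eq_cintegral => t _; rewrite /dfun subrK.
apply: complex_eq.
  apply: (integral_dfun (h := @complex.Re R) (u := fun t => cos (arg s t)) (v := fun t => - sin (arg s t))) => //.
  - exact: le_Re_normc.
  - by move=> t t0; rewrite cpowE ReM /= /pwr /arg; ring.
  - by move=> t t0; rewrite dfunRe//; ring.
  - by move=> t t0; exact: dcosarg.
  - by move=> t t0; eexists; apply: is_deriveNf; exact: dsinarg.
apply: (integral_dfun (h := @complex.Im R) (u := fun t => sin (arg s t)) (v := fun t => cos (arg s t))) => //.
- exact: le_Im_normc.
- by move=> t t0; rewrite cpowE ImM /= /pwr /arg; ring.
- by move=> t t0; rewrite dfunIm.
- by move=> t t0; exact: dsinarg.
- by move=> t t0; eexists; exact: dcosarg.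
Qed.

End GammaEquation.

Section GammaNonvanishing.
Variable R : realType.
Local Notation mu := (@lebesgue_measure R).
Local Notation pos := (`]0, +oo[%classic : set R).
Implicit Types (x t p q y : R) (s : R[i]).

Lemma norm_sin_le x : `|sin x| <= `|x|.
Proof.
wlog x0 : x / 0 <= x => [H|].
  have [/H//|/ltW xN] := leP 0 x.
  by rewrite -normrN -sinN -[X in _ <= X]normrN H// oppr_ge0.
have cs : {within `[0, x], continuous (@sin R)}.
  by apply: continuous_subspaceT; exact: continuous_sin.
have [c _] := MVT_segment x0 (fun c _ => is_derive_sin c) cs.
rewrite sin0 !subr0 => ->; rewrite normrM ler_piMl//.
exact: cos_max.
Qed.

Lemma cos_ge x : 1 - x ^+ 2 / 2 <= cos x.
Proof.
have -> : cos x = 1 - sin (x / 2) ^+ 2 *+ 2.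
  rewrite {1}(_ : x = (x / 2) *+ 2); last by rewrite -mulr_natr divfK.
  by rewrite cos_mulr2n cos2sin2 mulrnBl; ring.
have : sin (x / 2) ^+ 2 <= (x / 2) ^+ 2.
  by rewrite -(real_normK (num_real (sin _))) -(real_normK (num_real (x / 2))) ler_pXn2r ?nnegrE// norm_sin_le.
rewrite exprMn; set a := sin _ ^+ 2; lra.
Qed.

(** The square of [x <= 2 sinh (x / 2)]. *)
Lemma sqr_le_expR x : x ^+ 2 <= expR x + expR (- x) - 2.
Proof.
wlog x0 : x / 0 <= x => [H|].
  have [/H//|/ltW xN] := leP 0 x.
  have /H : 0 <= - x by rewrite oppr_ge0.
  by rewrite sqrrN opprK [expR (- x) + _]addrC.
have le y : 0 <= y -> 2 * y <= expR y - expR (- y).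
  move=> y0; pose f (z : R) : R := expR z - expR (- z) - 2 * z.
  have df z : is_derive z (1 : R) f (expR z + expR (- z) - 2).
    apply: derive_eq (is_deriveDf (is_deriveDf (is_derive_expR z) (is_deriveNf (is_derive1_comp (f := expR) (is_derive_expR _) (is_deriveNf (is_derive_idf z))))) (is_deriveNf (is_deriveZf 2 (is_derive_idf z)))) _.
    by ring.
  have cf : {within `[0, y], continuous f}.
    apply: continuous_subspaceT => z; exact: derive_continuous (df z).
  have [c _] := MVT_segment y0 (fun c _ => df c) cf.
  rewrite {2}/f oppr0 expR0 subrr mulr0 subrr !subr0 /f => e.
  rewrite -subr_ge0 e; apply: mulr_ge0; last by rewrite addr0.
  rewrite expRN.
  have : 0 <= (expR c - 1) ^+ 2 / expR c by rewrite divr_ge0 ?sqr_ge0 ?expR_ge0.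
  by congr (_ <= _); field; rewrite gt_eqF// expR_gt0.
have x2 : 0 <= x / 2 by rewrite divr_ge0.
have := le _ x2.
have ex : expR x = expR (x / 2) ^+ 2 by rewrite -expRM_natl mulrC divfK.
have exN : expR (- x) = expR (- (x / 2)) ^+ 2.
  by rewrite -expRM_natl mulrN [2 * _]mulrC divfK.
have e1 : expR (x / 2) * expR (- (x / 2)) = 1 by rewrite expRxMexpNx_1.
rewrite ex exN; set a := expR (x / 2) in e1 *; set b := expR (- (x / 2)) in e1 * => le2.
have -> : a ^+ 2 + b ^+ 2 - 2 = (a - b) ^+ 2.
  have : (a - b) ^+ 2 = a ^+ 2 + b ^+ 2 - 2 * (a * b) by ring.
  by rewrite e1 mulr1.
have -> : x = 2 * (x / 2) by rewrite mulrC divfK.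
by rewrite ler_pXn2r// nnegrE ?mulr_ge0// (le_trans _ le2)// mulr_ge0.
Qed.

Let G p := \int[mu]_(t in pos) (t `^ (p - 1) * expR (- t)).

Let iG p : 0 < p -> mu.-integrable pos (EFin \o (fun t => t `^ (p - 1) * expR (- t))).
Proof.
move=> p0; apply: eq_integrable (integrable_gamma p0 ltr01) => //= t _.
by rewrite mul1r.
Qed.

Lemma Gamma_real p : Gamma p%:C = (G p)%:C.
Proof.
have e t : 0 < t -> gamma_kernel p%:C 1 t = (t `^ (p - 1) * expR (- t))%:C.
  move=> t0; rewrite /gamma_kernel mul1r.
  have -> : p%:C - 1 = (p - 1)%:C :> R[i] by rewrite rmorphB rmorph1.
  by rewrite cpow_real// -rmorphM.
rewrite GammaE (eq_cintegral (g := fun t => (t `^ (p - 1) * expR (- t))%:C)); last first.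
  by move=> t; rewrite posE; exact: e.
apply: complex_eq => //=; rewrite Rintegral_cst ?mul0r//; exact: measurable_pos.
Qed.

Let GS p : 0 < p -> G (p + 1) = p * G p.
Proof.
move=> p0; have p0' : 0 < complex.Re p%:C by [].
have := GammaS p0'.
have -> : p%:C + 1 = (p + 1)%:C :> R[i] by rewrite rmorphD rmorph1.
by rewrite !Gamma_real -rmorphM => -[].
Qed.

Let G_gt0 p : 1 < p -> 0 < G p.
Proof.
move=> p1; have p0 : 0 < p by rewrite (lt_trans ltr01).
have m12 : measurable (`[1, 2]%classic : set R) by exact: measurable_itv.
have s12 : `[1, 2]%classic `<=` pos.
  by move=> t /=; rewrite in_itv/= => /andP[t1 _]; rewrite in_itv/= andbT (lt_le_trans ltr01).
have : ((expR (-2))%:E <= \int[mu]_(t in pos) (t `^ (p - 1) * expR (- t))%:E)%E.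
  apply: (@le_trans _ _ (\int[mu]_(t in `[1%R, 2%R]) (t `^ (p - 1) * expR (- t))%:E)%E).
    apply: (@le_trans _ _ (\int[mu]_(t in `[1%R, 2%R]) (cst (expR (-2))%:E t))%E).
      rewrite integral_cst//= lebesgue_measure_itv/= lte_fin ltr1n/= -EFinB -EFinM lee_fin.
      by rewrite (_ : 2 - 1 = 1 :> R) ?mulr1//; ring.
    apply: ge0_le_integral => //=.
    - apply/measurable_EFinP; apply: measurable_funM.
        exact: measurable_funS (measurable_powR _).
      apply: (@eq_measurable_fun _ _ _ _ _ (fun t : R => expR (- (1 * t)))).
        by move=> t _; rewrite mul1r.
      exact: measurable_expRNM.
    - move=> t; rewrite in_itv/= => /andP[t1 t2]; rewrite lee_fin.
      rewrite -[leLHS]mul1r ler_pM ?expR_ge0//; last by rewrite ler_expR lerN2.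
      by rewrite -[leLHS](powRr0 t) ler_powR// subr_ge0 ltW.
  apply: ge0_subset_integral => //.
  - exact: measurable_int (iG p0).
  - by move=> t _; rewrite lee_fin mulr_ge0 ?powR_ge0 ?expR_ge0.
rewrite (integral_EFinE measurable_pos (iG p0)) lee_fin.
by apply: lt_le_trans; exact: expR_gt0.
Qed.

(** If [Gamma s = 0] then [Gamma] vanishes at every [s + n]. This is impossible
    for large [n]: the density proportional to [t ^ (p - 1) exp (- t)], with
    [p] the real part of [s + n], has mean [p], and the mean of the inverse is
    [1 / (p - 1)], so that it concentrates around [p] on the logarithmic scale
    and the phase [t ^ (i y)] is nearly constant on it. *)
Lemma Gamma_neq0 s : 0 < complex.Re s -> Gamma s != 0.
Proof.
move=> s0; apply/eqP => G0.
have Gn n : Gamma (s + n%:R) = 0.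
  elim: n => [|n IH]; first by rewrite addr0.
  rewrite -natr1 addrA GammaS ?IH ?mulr0//.
  by rewrite ReD -[n%:R](rmorph_nat (real_complex R))/= ltr_wpDr.
pose y := complex.Im s.
pose n := Num.bound (2 + y ^+ 2).
pose p := complex.Re s + n%:R.
have np : 2 + y ^+ 2 < n%:R by apply: archi_boundP; rewrite addr_ge0// sqr_ge0.
have p2 : 2 + y ^+ 2 < p by rewrite (lt_trans np)// /p ltrDr.
have y2 := sqr_ge0 y.
have p1 : 1 < p - 1 by clear -p2 y2; lra.
have p0 : 0 < p by clear -p1; lra.
have pn0 : p != 0 by rewrite gt_eqF.
have [pm1 pp1] : 0 < p - 1 /\ 0 < p + 1 by clear -p1; split; lra.
have sE : s + n%:R = p%:C + (0 +i* y).
  rewrite -[n%:R](rmorph_nat (real_complex R)).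
  by apply: complex_eq; rewrite ?ReD ?ImD /= ?addr0 ?add0r.
have k0 t : 0 < t -> gamma_kernel (s + n%:R) 1 t =
    (t `^ (p - 1) * expR (- t))%:C * cpow t (0 +i* y).
  move=> t0; rewrite /gamma_kernel mul1r sE.
  have -> : p%:C + (0 +i* y) - 1 = (p - 1)%:C + (0 +i* y).
    by rewrite rmorphB rmorph1 addrAC.
  by rewrite cpowD cpow_real// rmorphM mulrAC.
(* the phase relative to its value at the mean *)
have : complex.Re (cpow p (- (0 +i* y)) * Gamma (s + n%:R)) = 0 by rewrite Gn mulr0.
have sn0 : 0 < complex.Re (s + n%:R) by rewrite sE ReD /= addr0.
have ik := cintegrable_gamma_kernel sn0 ltr01.
rewrite GammaE -(cintegralZ measurable_pos _ ik).
pose w t := t `^ (p - 1) * expR (- t).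
have w0 t : 0 <= w t by rewrite mulr_ge0 ?powR_ge0 ?expR_ge0.
have kE t : 0 < t -> complex.Re (cpow p (- (0 +i* y)) * gamma_kernel (s + n%:R) 1 t) =
    w t * cos (y * ln (t / p)).
  move=> t0; rewrite k0// mulrCA ReZ; congr (_ * _).
  rewrite ln_div ?posrE// mulrBr cosB !cpowE ReM /= oppr0 !mul0r expR0 !mul1r.
  by rewrite mulNr cosN sinN mulNr opprK mulrC [sin _ * _]mulrC.
rewrite -[complex.Re (cintegral _ _)]/(\int[mu]_(t in pos)
  complex.Re (cpow p (- (0 +i* y)) * gamma_kernel (s + n%:R) 1 t)).
have iZ := @integrable_mulrl R pos measurable_pos.
have iD := @integrable_addr R pos measurable_pos.
have iw : mu.-integrable pos (EFin \o w) by exact: iG.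
have iwS : mu.-integrable pos (EFin \o (fun t => t `^ p * expR (- t))).
  by apply: eq_integrable (iG pp1) => // t _ /=; rewrite addrK.
have iwV : mu.-integrable pos (EFin \o (fun t => t `^ (p - 1 - 1) * expR (- t))).
  exact: iG.
pose g t := (1 + y ^+ 2) * w t + (- (y ^+ 2 / 2 / p) * (t `^ p * expR (- t)) +
   - (y ^+ 2 / 2 * p) * (t `^ (p - 1 - 1) * expR (- t))).
have ig : mu.-integrable pos (EFin \o g).
  by apply: (iD _ _) (iZ _ _ iw) (iD _ _ (iZ _ _ iwS) (iZ _ _ iwV)).
have Ig : \int[mu]_(t in pos) g t = G p * (1 - y ^+ 2 / 2 / (p - 1)).
  rewrite /g RintegralD//; [|exact: (iZ)|exact: (iD _ _ (iZ _ _ iwS) (iZ _ _ iwV))].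
  rewrite RintegralD//; [|exact: (iZ)|exact: (iZ)].
  rewrite !RintegralZl//.
  rewrite -[\int[mu]_(t in pos) w t]/(G p) -[\int[mu]_(t in pos) (t `^ (p - 1 - 1) * _)]/(G (p - 1)).
  have -> : \int[mu]_(t in pos) (t `^ p * expR (- t)) = p * G p.
    by rewrite -(GS p0); apply: eq_Rintegral => t _; rewrite addrK.
  have := GS pm1; rewrite subrK => ->.
  by field; rewrite pn0 gt_eqF.
suff : 0 < \int[mu]_(t in pos) complex.Re (cpow p (- (0 +i* y)) * gamma_kernel (s + n%:R) 1 t).
  by move=> /[swap] ->; rewrite ltxx.
apply: (@lt_le_trans _ _ (\int[mu]_(t in pos) g t)).
  rewrite Ig mulr_gt0// ?G_gt0//; first by clear -p1; lra.
  by rewrite subr_gt0 ltr_pdivrMr// mul1r; clear -p2 y2; lra.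
apply: le_Rintegral => //.
  have [iRe iIm] := ik.
  have := iD _ _ (iZ (complex.Re (cpow p (- (0 +i* y)))) _ iRe) (iZ (- complex.Im (cpow p (- (0 +i* y)))) _ iIm).
  apply: eq_integrable => // t _; rewrite [LHS]/comp [RHS]/comp; congr _%:E.
  by rewrite (ReM (cpow p _)) mulNr.
move=> t; rewrite posE => t0; rewrite kE//.
have tp : 0 < t / p by rewrite divr_gt0.
have := sqr_le_expR (ln (t / p)).
rewrite expRN lnK ?posrE// => l2.
have -> : g t = w t * (1 - y ^+ 2 / 2 * (t / p + (t / p)^-1 - 2)).
  rewrite /g /w.
  have -> : t `^ p = t `^ (p - 1 - 1) * t ^+ 2.
    by rewrite -powR_mulrn ?ltW// -powRD ?(gt_eqF t0) ?implybT//; congr (_ `^ _); ring.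
  have -> : t `^ (p - 1) = t `^ (p - 1 - 1) * t.
    by rewrite -[X in _ * X](powRr1 (ltW t0)) -powRD ?(gt_eqF t0) ?implybT//; congr (_ `^ _); ring.
  by field; rewrite pn0 gt_eqF.
rewrite ler_wpM2l//; apply: le_trans (cos_ge _).
rewrite lerD2l lerN2 exprMn [leLHS]mulrAC ler_wpM2l ?divr_ge0//.
Qed.

Lemma cvg_integral0_gauss :
  gauss_integral_proof.integral0_gauss x @[x --> +oo] --> (Num.sqrt pi / 2 : R).
Proof.
have : Num.sqrt (gauss_integral_proof.integral0_gauss x ^+ 2) @[x --> +oo] --> Num.sqrt (pi / 4 : R).
  apply: continuous_cvg; [exact: sqrt_continuous|].
  exact: gauss_integral_proof.cvg_integral0_gauss_sqr.
have -> : Num.sqrt (pi / 4) = Num.sqrt pi / 2 :> R.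
  rewrite sqrtrM ?pi_ge0// sqrtrV// (_ : 4 = 2 ^+ 2) ?sqrtr_sqr ?ger0_norm//.
  by rewrite expr2 -natrM.
apply: cvg_trans; apply: near_eq_cvg; apply: nearW => x.
by rewrite sqrtr_sqr ger0_norm// gauss_integral_proof.integral0_gauss_ge0.
Qed.

(** The substitution [t = u ^ 2] in the Gaussian integral. *)
Lemma Gamma_half : Gamma 2^-1 = (Num.sqrt pi : R)%:C.
Proof.
have -> : 2^-1 = (2^-1 : R)%:C :> R[i] by rewrite fmorphV rmorph_nat.
rewrite Gamma_real; congr _%:C.
pose E := @gauss_integral_proof.integral0_gauss R.
pose F t : R := 2 * E (Num.sqrt t).
pose f t : R := t `^ (2^-1 - 1) * expR (- t).
have dE (u : R) : 0 < u -> is_derive u (1:R) E (gauss_fun u).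
  move=> u0.
  have ig : mu.-integrable `[0, u + 1] (EFin \o gauss_fun).
    apply: (@integrableS _ _ _ mu setT) => //.
    exact: integrableT_gauss.
  have uu : u < u + 1 by rewrite ltrDl.
  have cg : {for u, continuous (@gauss_fun R)} by exact: continuous_gauss_fun.
  have [dE eE] := @continuous_FTC1_closed R gauss_fun 0 u (u + 1) uu ig u0 cg.
  by split; [exact: dE|rewrite -derive1E].
have fE t : 0 < t -> f t = 2 * (gauss_fun (Num.sqrt t) * (2 * Num.sqrt t)^-1).
  move=> t0; rewrite /f /gauss_fun sqr_sqrtr ?ltW//.
  have -> : 2^-1 - 1 = - 2^-1 :> R by field.
  rewrite powRN powR12_sqrt ?ltW//; field; rewrite gt_eqF// sqrtr_gt0//.
have dF t : 0 < t -> is_derive t (1:R) F (f t).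
  move=> t0; have s0 : 0 < Num.sqrt t by rewrite sqrtr_gt0.
  rewrite fE//; exact: is_deriveZf (is_derive1_comp (dE _ s0) (is_derive1_sqrt t0)).
have cf t : 0 < t -> {for t, continuous f}.
  move=> t0; apply: derive_continuous.
  exact: is_deriveMf (is_derive1_powR (2^-1 - 1) t0)
    (is_derive1_comp (f := expR) (is_derive_expR _) (is_deriveNf (is_derive_idf t))).
have F1 : F t @[t --> +oo] --> Num.sqrt pi.
  have -> : Num.sqrt pi = 2 * (Num.sqrt pi / 2) :> R by rewrite mulrC divfK.
  apply: cvgM; first exact: cvg_cst.
  apply: (cvg_comp (@Num.sqrt R) E _ cvg_integral0_gauss).
  have := @powR_pinfty R 2^-1; rewrite invr_gt0 => /(_ (ltr0n _ 2)).
  apply: cvg_trans; apply: near_eq_cvg; near=> t.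
  by rewrite powR12_sqrt//; near: t; exact: nbhs_pinfty_ge.
have F0 : F t @[t --> 0^'+] --> (0 : R).
  apply: (@squeeze_cvgr _ _ _ _ (fun=> 0) (fun t => 2 * Num.sqrt t)).
  - near=> t; have t0 : 0 < t by near: t; exact: nbhs_right_gt.
    rewrite mulr_ge0 ?gauss_integral_proof.integral0_gauss_ge0//=.
    rewrite ler_wpM2l// /E /gauss_integral_proof.integral0_gauss.
    have s0 := sqrtr_ge0 t.
    apply: (@le_trans _ _ (\int[mu]_(t in `[0, Num.sqrt t]) (cst 1 t))).
      apply: le_Rintegral => //.
      - apply: (@integrableS _ _ _ mu setT) => //.
        exact: integrableT_gauss.
      - apply: continuous_compact_integrable; first exact: segment_compact.
        by apply: continuous_subspaceT => ?; exact: cst_continuous.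
      - by move=> u _; exact: gauss_fun_le1.
    rewrite Rintegral_cst//= lebesgue_measure_itv/=; case: ifPn => //=.
      by rewrite oppr0 addr0 mul1r.
    by rewrite mul1r.
  - exact: cvg_cst.
  - suff c : Num.sqrt t @[t --> 0^'+] --> (0 : R).
      by have := cvgM (cvg_cst (2 : R)) c; rewrite mulr0; exact.
    have := @powR_cvg0 R 2^-1; rewrite invr_gt0 => /(_ (ltr0n _ 2)).
    apply: cvg_trans; apply: near_eq_cvg; near=> t.
    by rewrite powR12_sqrt// ltW//; near: t; exact: nbhs_right_gt.
have ff0 t : 0 < t -> 0 <= f t by move=> t0; rewrite mulr_ge0 ?powR_ge0 ?expR_ge0.
by rewrite -[RHS]subr0 -(FTC_pos cf dF F0 F1 (ge0_FTC_pos_integrable cf dF F0 F1 ff0)).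
Unshelve. all: by end_near. Qed.

End GammaNonvanishing.

(** * Summation over the integers *)

Section IntegerSums.
Variable R : realType.
Implicit Types (p e : R).

Lemma esum_int (f : int -> \bar R) : (forall k, 0 <= f k)%E ->
  (\esum_(k in [set: int]) f k =
   \esum_(n in [set: nat]) f (Posz n) + \esum_(n in [set: nat]) f (Negz n))%E.
Proof.
move=> f0; rewrite (esumID (Posz @` setT))//; congr (_ + _)%E.
  rewrite setTI esum_image// => x y _ _ [] //.
rewrite -(esum_image setT Negz); last by move=> x y _ _ [].
congr esum; apply/seteqP; split => [[n|n]/= [_ h]|k [n _ <-]].
- by exfalso; apply: h; exists n.
- by exists n.
- by split=> // -[].
Qed.

(** A telescoping majorant of the terms of the zeta series, which replaces the
    comparison with an integral; it comes from [1 + u <= expR u] and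
    [ln v <= v - 1]. *)
Lemma powRN_telescope e (n : nat) : 0 < e ->
  n.+2%:R `^ (- 1 - e) <= e^-1 * (n.+1%:R `^ (- e) - n.+2%:R `^ (- e)).
Proof.
move=> e0; set x : R := n.+1%:R; set y : R := n.+2%:R.
have x0 : 0 < x by rewrite ltr0n.
have y0 : 0 < y by rewrite ltr0n.
have yx : y = x + 1 by rewrite /x /y natr1.
have -> : y `^ (- 1 - e) = y `^ (- e) * y^-1.
  by rewrite powRD ?(gt_eqF y0) ?implybT// mulrC powR_inv1// ltW.
have -> : x `^ (- e) = y `^ (- e) * expR (e * ln (y / x)).
  rewrite /powR !gt_eqF// -expRD ln_div ?posrE//; congr expR; ring.
rewrite -[X in _ * (_ - X)]mulr1 -mulrBr mulrCA ler_wpM2l ?powR_ge0//.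
rewrite ler_pdivlMl//; apply: (@le_trans _ _ (e * ln (y / x))); last first.
  by rewrite lerBrDl expR_ge1Dx.
rewrite ler_wpM2l ?(ltW e0)//.
have xy : 0 < x / y by rewrite divr_gt0.
have -> : y / x = (x / y)^-1 by rewrite invf_div.
rewrite lnV ?posrE// lerNr.
have := @le_ln1Dx R (x / y - 1).
have -> : 1 + (x / y - 1) = x / y by rewrite addrC subrK.
move=> h; apply: le_trans (h _) _; first by rewrite ltrBrDl subrr.
rewrite [X in X / _](_ : x = y - 1); last by rewrite yx addrK.
by rewrite mulrBl divff ?gt_eqF// mul1r addrAC subrr add0r.
Qed.

Lemma powR_antimono p (x y : R) : 0 <= p -> 0 < x -> x <= y -> y `^ (- p) <= x `^ (- p).
Proof.
move=> p0 x0 xy; have y0 : 0 < y by exact: lt_le_trans xy.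
rewrite !powRN lef_pV2 ?posrE ?powR_gt0//.
by apply: ge0_ler_powR => //; rewrite nnegrE ltW.
Qed.

Lemma esum_nat_lty p : 2^-1 < p ->
  (\esum_(n in [set: nat]) ((1 + n%:R ^+ 2) `^ (- p))%:E < +oo :> \bar R)%E.
Proof.
move=> p1; pose e := 2 * p - 1.
have e0 : 0 < e by rewrite /e; lra.
have p0 : 0 <= p by lra.
rewrite -nneseries_esumT; last by move=> n; rewrite lee_fin powR_ge0.
pose c n : R := (1 + n%:R ^+ 2) `^ (- p).
have cle n : c n.+2 <= e^-1 * (n.+1%:R `^ (- e) - n.+2%:R `^ (- e)).
  apply: le_trans (powRN_telescope n e0).
  have -> : n.+2%:R `^ (- 1 - e) = (n.+2%:R ^+ 2) `^ (- p) :> R.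
    by rewrite -powR_mulrn// -powRrM; congr (_ `^ _); rewrite /e; ring.
  by apply: powR_antimono => //; rewrite lerDr.
have SN N : \sum_(0 <= n < N.+2) c n <= 2 + e^-1 * (1 - N.+1%:R `^ (- e)).
  elim: N => [|N IH].
    rewrite powR1 subrr mulr0 addr0 !big_nat_recr//= big_nil add0r.
    have c1 n : c n <= 1.
      have -> : 1 = 1 `^ (- p) :> R by rewrite powR1.
      apply: powR_antimono => //.
      by rewrite lerDl sqr_ge0.
    by rewrite -[2]/(1 + 1) lerD.
  rewrite big_nat_recr//=; apply: le_trans (lerD IH (cle N)) _.
  by rewrite -addrA -mulrDr addrA subrK.
apply: (@le_lt_trans _ _ (2 + e^-1)%:E); last exact: ltry.
apply: lime_le; first by apply: is_cvg_nneseries => n _ _; rewrite lee_fin powR_ge0.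
apply: nearW => N; rewrite sumEFin lee_fin.
apply: (@le_trans _ _ (\sum_(0 <= n < N.+2) c n)).
  rewrite [leRHS](@big_cat_nat _ _ _ N)//= ?lerDl ?sumr_ge0// => [n _|].
    by rewrite powR_ge0.
  by rewrite -addn2 leq_addr.
apply: le_trans (SN N) _; rewrite lerD2l -[leRHS]mulr1 ler_wpM2l ?invr_ge0 ?(ltW e0)//.
Qed.

Lemma rsummable_int p : 2^-1 < p ->
  rsummable [set: int] (fun k : int => (1 + k%:~R ^+ 2) `^ (- p) : R).
Proof.
move=> p1; rewrite ge0_rsummable; last by move=> k _; exact: powR_ge0.
rewrite esum_int; last by move=> k; rewrite lee_fin powR_ge0.
have fin := esum_nat_lty p1.
apply: lte_add_pinfty; first exact: fin.
apply: le_lt_trans fin; apply: le_esum => n _; rewrite lee_fin.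
apply: powR_antimono; first by lra.
- by rewrite ltr_pwDl ?sqr_ge0.
- rewrite lerD2l NegzE mulrNz sqrrN -pmulrn ler_pXn2r ?nnegrE//.
  by rewrite ler_nat.
Qed.

Lemma expRN_le_inv (x : R) : 0 <= x -> expR (- x) <= (1 + x)^-1.
Proof.
by move=> x0; rewrite expRN lef_pV2 ?posrE ?expR_gt0 ?expR_ge1Dx// ltr_pwDl.
Qed.

(** Through [expR (- u) <= 1 / (1 + u)], a Gaussian term is dominated by a
    multiple of [1 / (1 + k^2)]. *)
Lemma rsummable_gauss_shift (x t : R) : 0 < x ->
  rsummable [set: int] (fun k : int => expR (- (x * (t + k%:~R) ^+ 2))).
Proof.
move=> x0; pose C := (2 * t ^+ 2 + 1) + 2 / x.
have t2 := sqr_ge0 t; have x2 : 0 <= 2 / x by rewrite divr_ge0// ltW.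
have C0 : 0 <= C by apply: addr_ge0 => //; apply: addr_ge0 => //; exact: mulr_ge0.
have h := rsummableZ C (@rsummable_int 1 _).
apply: le_rsummable (h _); last by rewrite invf_lt1// ltr1n.
move=> k _; rewrite ger0_norm ?expR_ge0//.
apply: le_trans (expRN_le_inv _) _; first by rewrite mulr_ge0 ?sqr_ge0 ?(ltW x0).
have k2 : 0 < 1 + k%:~R ^+ 2 :> R by rewrite ltr_pwDl ?sqr_ge0.
have xk : 0 < 1 + x * (t + k%:~R) ^+ 2 by rewrite ltr_pwDl// mulr_ge0 ?sqr_ge0 ?(ltW x0).
rewrite powR_inv1 ?(ltW k2)// ler_pdivlMr// mulrC ler_pdivrMr//.
have -> : C * (1 + x * (t + k%:~R) ^+ 2) = (2 * t ^+ 2 + 1) + 2 * (t + k%:~R) ^+ 2 +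
   (2 / x + (2 * t ^+ 2 + 1) * (x * (t + k%:~R) ^+ 2)).
  by rewrite /C; field; rewrite gt_eqF.
have h1 : 0 <= 2 / x + (2 * t ^+ 2 + 1) * (x * (t + k%:~R) ^+ 2).
  apply: addr_ge0 => //; apply: mulr_ge0; first by apply: addr_ge0 => //; exact: mulr_ge0.
  by rewrite mulr_ge0 ?sqr_ge0 ?(ltW x0).
rewrite -[leLHS]addr0; apply: lerD h1.
have := sqr_ge0 (2 * t + k%:~R); set z : R := k%:~R.
clear; move=> h; have : 2 * t ^+ 2 + 1 + 2 * (t + z) ^+ 2 = 1 + z ^+ 2 + (2 * t + z) ^+ 2 by ring.
by lra.
Qed.

End IntegerSums.

(** * Poisson summation for Gaussians *)

Section GaussianFourier.
Variable R : realType.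
Local Notation mu := (@lebesgue_measure R).
Local Notation pos := (`]0, +oo[%classic : set R).
Implicit Types (x t u b : R).

Lemma gauss_pos : \int[mu]_(u in pos) gauss_fun u = Num.sqrt pi / 2.
Proof.
rewrite /Rintegral.
have := @integral0y_gauss R; rewrite -integral_itv_obnd_cbnd; last first.
  by apply/measurable_EFinP; apply: measurable_funTS; exact: measurable_gauss_fun.
by move=> ->.
Qed.

Lemma integrable_gauss (A : set R) : measurable A ->
  mu.-integrable A (EFin \o @gauss_fun R).
Proof.
move=> mA; apply: (@integrableS _ _ _ mu setT) => //.
exact: integrableT_gauss.
Qed.

Let dgauss u : is_derive u (1:R) (@gauss_fun R) (- (2 * u * gauss_fun u)).
Proof.
have d2 : is_derive u (1:R) (fun u : R => - u ^+ 2) (- (2 * u)).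
  apply: derive_eq (is_deriveNf (is_deriveMf (is_derive_idf u) (is_derive_idf u))) _.
  by ring.
apply: derive_eq (is_derive1_comp (f := expR) (is_derive_expR _) d2) _.
by rewrite /gauss_fun; ring.
Qed.

Let cvg_gauss0 (k : R -> R) : (forall u, `|k u| <= 1) ->
  gauss_fun u * k u @[u --> +oo] --> (0 : R).
Proof.
move=> k1; apply: (@squeeze_cvgr _ _ _ _ (fun u => - gauss_fun u) (@gauss_fun R)).
- apply: nearW => u; rewrite -ler_norml normrM ger0_norm ?gauss_fun_ge0//.
  by rewrite ler_piMr ?gauss_fun_ge0.
- by have := cvgN (@cvg_gauss_fun R); rewrite oppr0; exact.
- exact: cvg_gauss_fun.
Qed.

Let integrable_mulgauss : mu.-integrable pos (EFin \o (fun u => u * gauss_fun u)).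
Proof.
pose F u : R := - 2^-1 * gauss_fun u.
have dF u : 0 < u -> is_derive u (1 : R) F (u * gauss_fun u).
  move=> _; apply: derive_eq (is_deriveZf (- 2^-1) (dgauss u)) _.
  by field.
have cf u : 0 < u -> {for u, continuous (fun u => u * gauss_fun u)}.
  move=> _; exact: derive_continuous (is_deriveMf (is_derive_idf u) (dgauss u)).
have cg : F u @[u --> 0^'+] --> F 0.
  apply: cvg_at_right_filter; exact: derive_continuous (is_deriveZf _ (dgauss 0)).
have c1 : F u @[u --> +oo] --> (- 2^-1 * 0 : R).
  by apply: cvgM; [exact: cvg_cst|exact: cvg_gauss_fun].
apply: (ge0_FTC_pos_integrable cf dF cg c1) => u u0.
by rewrite mulr_ge0 ?gauss_fun_ge0 ?ltW.
Qed.

Let le_int (f g : R -> R) : mu.-integrable pos (EFin \o g) -> measurable_fun pos f ->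
  (forall u, 0 < u -> `|f u| <= g u) -> mu.-integrable pos (EFin \o f).
Proof.
move=> ig mf fg; apply: le_integrable ig => //; first exact/measurable_EFinP.
move=> u; rewrite posE => u0 /=; rewrite lee_fin (le_trans (fg _ u0))//.
exact: ler_norm.
Qed.

Let mgauss : measurable_fun pos (@gauss_fun R).
Proof. by apply: measurable_funTS; exact: measurable_gauss_fun. Qed.

Let mcos b : measurable_fun pos (fun u : R => cos (b * u)).
Proof.
apply: measurableT_comp; last exact: measurable_funM.
by apply: continuous_measurable_fun; exact: continuous_cos.
Qed.

Let msin b : measurable_fun pos (fun u : R => sin (b * u)).
Proof.
apply: measurableT_comp; last exact: measurable_funM.
by apply: continuous_measurable_fun; exact: continuous_sin.
Qed.

Let igc b : mu.-integrable pos (EFin \o (fun u => gauss_fun u * cos (b * u))).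
Proof.
apply: le_int (integrable_gauss measurable_pos) _ _; first exact: measurable_funM.
move=> u _; rewrite normrM ger0_norm ?gauss_fun_ge0// ler_piMr ?gauss_fun_ge0//.
exact: cos_max.
Qed.

Let igs b : mu.-integrable pos (EFin \o (fun u => u * gauss_fun u * sin (b * u))).
Proof.
apply: le_int integrable_mulgauss _ _.
  by apply: measurable_funM => //; apply: measurable_funM.
move=> u u0; rewrite normrM ger0_norm ?mulr_ge0 ?gauss_fun_ge0 ?(ltW u0)//.
by rewrite ler_piMr ?mulr_ge0 ?gauss_fun_ge0 ?(ltW u0)// sin_max.
Qed.

Let dsin b u : is_derive u (1:R) (fun u => sin (b * u)) (b * cos (b * u)).
Proof.
apply: derive_eq (is_derive1_comp (f := @sin R) (is_derive_sin _) (is_deriveZf b (is_derive_idf u))) _.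
by ring.
Qed.

Let I b : R := \int[mu]_(u in pos) (gauss_fun u * cos (b * u)).
Let J b : R := \int[mu]_(u in pos) (u * gauss_fun u * sin (b * u)).

(** Integration by parts. Together with [I' = - J] ([dI] below) it yields the
    differential equation [I' = - (b / 2) I] of the cosine transform [I] of the
    Gaussian. *)
Let IJ b : 2 * J b = b * I b.
Proof.
pose F u : R := gauss_fun u * sin (b * u).
pose f u : R := (- 2) * (u * gauss_fun u * sin (b * u)) + b * (gauss_fun u * cos (b * u)).
have dF u : is_derive u (1 : R) F (f u).
  apply: derive_eq (is_deriveMf (dgauss u) (dsin b u)) _.
  by rewrite /f; ring.
have dcos u : is_derive u (1:R) (fun u => cos (b * u)) (- sin (b * u) * (b * 1)).
  exact: (is_derive1_comp (f := @cos R) (is_derive_cos _) (is_deriveZf b (is_derive_idf u))).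
have cf u : 0 < u -> {for u, continuous f}.
  move=> _; exact: derive_continuous (is_deriveDf
   (is_deriveZf (-2) (is_deriveMf (is_deriveMf (is_derive_idf u) (dgauss u)) (dsin b u)))
   (is_deriveZf b (is_deriveMf (dgauss u) (dcos u)))).
have F0 : F u @[u --> 0^'+] --> F 0.
  apply: cvg_at_right_filter; exact: derive_continuous (dF 0).
have F1 : F u @[u --> +oo] --> (0 : R) by apply: cvg_gauss0 => u; exact: sin_max.
have i1 := integrable_mulrl measurable_pos (-2) (igs b).
have i2 := integrable_mulrl measurable_pos b (igc b).
have fi : mu.-integrable pos (EFin \o f) := integrable_addr measurable_pos i1 i2.
have := FTC_pos cf (fun u _ => dF u) F0 F1 fi.
rewrite /f RintegralD// !RintegralZl// -/(I b) -/(J b).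
by rewrite /F mulr0 sin0 mulr0 subr0 => /eqP; rewrite addrC mulNr subr_eq0 => /eqP ->.
Qed.

Let dI b : is_derive b (1 : R) I (- J b).
Proof.
pose f b u : R := gauss_fun u * cos (b * u).
pose G u : R := `|u| * gauss_fun u.
have Ia : `]b - 1, b + 1[%classic b.
  by rewrite /= in_itv/=; apply/andP; split; lra.
have dfb y u : is_derive y (1:R) (fun b => f b u) (gauss_fun u * (- sin (y * u) * u)).
  apply: derive_eq (is_deriveZf (gauss_fun u) (is_derive1_comp (f := @cos R) (is_derive_cos _)
    (is_deriveMf (is_derive_idf y) (is_derive_cstf u y)))) _.
  by ring.
have iG : mu.-integrable pos (EFin \o G).
  apply: eq_integrable integrable_mulgauss => // u; rewrite inE posE => u0.
  by rewrite /G/= gtr0_norm.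
have d1 y u : partial1of2 f y u = gauss_fun u * (- sin (y * u) * u).
  by rewrite partial1of2E; have [_ ->] := dfb y u.
have igf x (_ : `]b - 1, b + 1[%classic x) : mu.-integrable pos (EFin \o f x) by exact: igc.
have dff x y (_ : `]b - 1, b + 1[%classic x) (_ : pos y) : derivable (f ^~ y) x 1.
  by have [] := dfb x y.
have G0 y : 0 <= G y by rewrite mulr_ge0 ?gauss_fun_ge0.
have Gub x y (_ : `]b - 1, b + 1[%classic x) (_ : pos y) : `|partial1of2 f x y| <= G y.
  rewrite d1 !normrM normrN (ger0_norm (gauss_fun_ge0 _)) mulrCA /G [leRHS]mulrC ler_piMl//.
    by rewrite mulr_ge0 ?gauss_fun_ge0.
  exact: sin_max.
split.
  by have := @derivable_under_integral R _ _ mu f pos measurable_pos b (b - 1) (b + 1) Ia igf dff G G0 iG Gub.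
rewrite -derive1E (@differentiation_under_integral R _ _ mu f pos measurable_pos b (b - 1) (b + 1) Ia igf dff G G0 iG Gub).
rewrite -mulN1r -RintegralZl//; apply: eq_Rintegral => u _.
by rewrite d1; ring.
Qed.

Let I_exp b : I b = I 0 * expR (- (b ^+ 2 / 4)).
Proof.
pose K b : R := I b * expR (b ^+ 2 / 4).
have dK c : is_derive c (1 : R) K 0.
  have d2 : is_derive c (1:R) (fun c : R => c ^+ 2 / 4) (c / 2).
    apply: derive_eq (is_deriveMf (is_deriveMf (is_derive_idf c) (is_derive_idf c)) (is_derive_cstf 4^-1 c)) _.
    by field.
  apply: derive_eq (is_deriveMf (dI c) (is_derive1_comp (f := expR) (is_derive_expR _) d2)) _.
  have -> : J c = c / 2 * I c.
    by rewrite mulrAC -IJ mulrAC divff// mul1r.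
  by rewrite /=; ring.
have := is_derive_0_is_cst 0 b dK.
rewrite /K expr0n/= mul0r expR0 mulr1 => ->.
by rewrite -mulrA -expRD subrr expR0 mulr1.
Qed.

Lemma gauss_fourier_pos b :
  \int[mu]_(u in pos) (gauss_fun u * cos (b * u)) =
  Num.sqrt pi / 2 * expR (- (b ^+ 2 / 4)).
Proof.
rewrite -/(I b) I_exp; congr (_ * _); rewrite -gauss_pos.
by apply: eq_Rintegral => u _; rewrite mul0r cos0 mulr1.
Qed.

Lemma integrable_gauss_cos b : mu.-integrable [set: R] (EFin \o (fun u => gauss_fun u * cos (b * u))).
Proof.
apply: le_integrable (integrable_gauss measurableT) => //.
  apply/measurable_EFinP; apply: measurable_funM; first exact: measurable_gauss_fun.
  apply: measurableT_comp; last exact: measurable_funM.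
  by apply: continuous_measurable_fun; exact: continuous_cos.
move=> u _ /=; rewrite lee_fin normrM ler_piMr//.
exact: cos_max.
Qed.

(** The integrand plus [gauss_fun] is even and nonnegative, which reduces the
    integral over the line to the one over the half-line. *)
Lemma gauss_fourier b :
  \int[mu]_(u in [set: R]) (gauss_fun u * cos (b * u)) =
  Num.sqrt pi * expR (- (b ^+ 2 / 4)).
Proof.
pose f u : R := gauss_fun u + gauss_fun u * cos (b * u).
have iT := integrable_gauss measurableT; have icT := integrable_gauss_cos b.
have f0 u : 0 <= f u.
  by rewrite /f -[X in X + _]mulr1 -mulrDr mulr_ge0 ?gauss_fun_ge0// -lerBlDl sub0r cos_geN1.
have cf : continuous f.
  move=> u; apply: cvgD; first exact: continuous_gauss_fun.
  apply: cvgM; first exact: continuous_gauss_fun.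
  apply: continuous_comp; last exact: continuous_cos.
  by apply: cvgM; [exact: cvg_cst|exact: cvg_id].
have ef : f =1 f \o -%R.
  by move=> u; rewrite /f /= /gauss_fun sqrrN mulrN cosN.
have fi : mu.-integrable [set: R] (EFin \o f) := integrable_addr measurableT iT icT.
have iP := integrable_gauss measurable_pos; have icP := igc b.
have fiP : mu.-integrable pos (EFin \o f) := integrable_addr measurable_pos iP icP.
have := ge0_symfun_integralT f0 cf ef.
rewrite (integral_EFinE measurableT fi) -set_itvcy -integral_itv_obnd_cbnd; last first.
  exact: measurable_int fiP.
rewrite (integral_EFinE measurable_pos fiP) -EFinM => -[].
rewrite /f !RintegralD// gauss_fourier_pos gauss_pos.
have -> : \int[mu]_(u in [set: R]) gauss_fun u = Num.sqrt pi.
  by rewrite /Rintegral integralT_gauss.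
move/(congr1 (fun z => z - Num.sqrt pi)); rewrite addrAC subrr add0r => ->.
by field.
Qed.

End GaussianFourier.

Section Trigonometry.
Variable R : realType.
Local Notation mu := (@lebesgue_measure R).
Implicit Types (x t u : R).

Lemma cosD2piM x (k : int) : cos (x + 2 * pi * k%:~R) = cos x.
Proof.
have h (n : nat) (y : R) : cos (y + 2 * pi * n%:R) = cos y.
  elim: n => [|n IH]; first by rewrite mulr0 addr0.
  have -> : y + 2 * pi * n.+1%:R = (y + 2 * pi * n%:R) + pi *+ 2.
    by rewrite -natr1 -mulr_natl; ring.
  by rewrite cosD2pi IH.
case: k => [n|n]; first exact: h.
rewrite NegzE mulrNz -[in LHS](h n.+1); congr cos.
by rewrite -pmulrn mulrN subrK.
Qed.

(** For [pi u <= 1] the mean value theorem gives [sin (pi u) >= pi u / 2]; beyond,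
    [sin] increases and [u <= 1 / 2] is already below [sin 1]. *)
Lemma sqr_le_sin_sqr u : `|u| <= 2^-1 -> u ^+ 2 <= sin (pi * u) ^+ 2.
Proof.
wlog u0 : u / 0 <= u => [H|].
  have [/H//|/ltW uN] := leP 0 u.
  move=> u1; have := H (- u); rewrite oppr_ge0 normrN mulrN sinN !sqrrN; exact.
rewrite ger0_norm// => u1.
have p3 : 2 <= pi :> R by exact: pi_ge2.
have p4 : 0 < pi :> R by exact: pi_gt0.
have small (y : R) : 0 < y -> y <= 1 -> y / 2 <= sin y.
  move=> y0 y1.
  have cs : {within `[0, y], continuous (@sin R)}.
    by apply: continuous_subspaceT; exact: continuous_sin.
  have [c] := @MVT R (@sin R) (@cos R) 0 y y0 (fun x _ => is_derive_sin x) cs.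
  rewrite in_itv/= => /andP[c0 c1]; rewrite sin0 !subr0 => ->.
  rewrite mulrC ler_wpM2r ?(ltW y0)//; apply: le_trans (cos_ge c).
  have : c ^+ 2 <= 1 by rewrite expr_le1 ?ltW//; lra.
  lra.
have [->|un0] := eqVneq u 0; first by rewrite mulr0 sin0.
have up : 0 < u by rewrite lt0r un0.
have pu : 0 < pi * u by rewrite mulr_gt0.
suff us : u <= sin (pi * u).
  by rewrite ler_pXn2r// nnegrE// (le_trans u0).
have [y1|y1] := leP (pi * u) 1.
  apply: le_trans (small _ pu y1); rewrite mulrAC ler_peMl//.
  by rewrite ler_pdivlMr// mul1r.
apply: (le_trans u1); have := small 1 ltr01 (lexx _); rewrite mul1r => h.
apply: (le_trans h); have [<-//|y1'] := eqVneq 1 (pi * u).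
have yp : pi * u <= pi / 2 by rewrite ler_pM2l.
apply: ltW; rewrite ltr_sin// in_itv/=; apply/andP; split; lra.
Qed.

Lemma measurable_funVge0 (D : set R) (f : R -> R) : (forall x, 0 <= f x) ->
  measurable_fun D f -> measurable_fun D (fun x => (f x)^-1).
Proof.
move=> f0 mf; apply: (@eq_measurable_fun _ _ _ _ D (fun x => f x `^ (-1))).
  by move=> x _; rewrite powR_inv1.
by apply: (@measurableT_comp _ _ _ _ _ _ (fun y : R => y `^ (-1))).
Qed.

Lemma measurable_cosM (D : set R) x : measurable_fun D (fun u : R => cos (x * u)).
Proof.
apply: measurableT_comp; last exact: measurable_funM.
by apply: continuous_measurable_fun; exact: continuous_cos.
Qed.

(** Half-open, so that the integer translates tile the line; centred, so that
    [sin (pi u)] vanishes only at the origin. *)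
Definition unit_itv : set R := `[- 2^-1, 2^-1[%classic.

Lemma unit_itvE u : unit_itv u = (- 2^-1 <= u < 2^-1) :> Prop.
Proof. by rewrite /unit_itv /= in_itv. Qed.

Lemma measurable_unit_itv : measurable unit_itv.
Proof. exact: measurable_itv. Qed.

Lemma lebesgue_measure_unit_itv : (mu unit_itv = 1)%E.
Proof.
have h : - 2^-1 < 2^-1 :> R by lra.
have := @lebesgue_measure_itv R `[- 2^-1, 2^-1[.
rewrite /= lte_fin h -EFinB -/unit_itv => ->; congr _%:E; lra.
Qed.

Lemma integral_unit_itv_cst x : \int[mu]_(u in unit_itv) x = x.
Proof.
rewrite Rintegral_cst; last exact: measurable_itv.
by rewrite -[RHS]mulr1; congr (_ * _); exact: (congr1 fine lebesgue_measure_unit_itv).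
Qed.

Lemma integral_unit_itv_cos (n : nat) :
  \int[mu]_(u in unit_itv) cos (2 * pi * n%:R * u) = (n == 0)%:R.
Proof.
case: n => [|n].
  under eq_Rintegral do rewrite mulr0 mul0r cos0.
  exact: integral_unit_itv_cst.
set c := 2 * pi * _.
have c0 : 0 < c by rewrite !mulr_gt0 ?pi_gt0.
pose F u : R := c^-1 * sin (c * u).
have dF u : is_derive u (1:R) F (cos (c * u)).
  apply: derive_eq (is_deriveZf c^-1 (is_derive1_comp (f := @sin R) (is_derive_sin _) (is_deriveZf c (is_derive_idf u)))) _.
  by field; rewrite gt_eqF.
have dC u : is_derive u (1:R) (fun u => cos (c * u)) (- sin (c * u) * (c * 1)).
  exact: (is_derive1_comp (f := @cos R) (is_derive_cos _) (is_deriveZf c (is_derive_idf u))).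
have cF : continuous F by move=> u; exact: derive_continuous (dF u).
have h : - 2^-1 < 2^-1 :> R by lra.
have := @continuous_FTC2 R (fun u => cos (c * u)) F (- 2^-1) 2^-1 h.
have c1 : {within `[- 2^-1, 2^-1], continuous (fun u : R => cos (c * u))}.
  by apply: continuous_subspaceT => u; exact: derive_continuous (dC u).
have c2 : derivable_oo_LRcontinuous F (- 2^-1) 2^-1.
  split; first by move=> u _; have [] := dF u.
  + by apply: cvg_at_right_filter; exact: cF.
  + by apply: cvg_at_left_filter; exact: cF.
move=> /(_ c1 c2).
have c3 : {in `]- 2^-1, 2^-1[, F^`()%classic =1 (fun u => cos (c * u))}.
  by move=> u _; rewrite derive1E; have [_ ->] := dF u.
move=> /(_ c3).
rewrite -(integral_itv_bndo_bndc); last first.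
  by apply/measurable_EFinP; exact: measurable_cosM.
move=> h1; rewrite /Rintegral h1 -EFinB/= /F mulrN sinN.
have -> : c * 2^-1 = 0 + n.+1%:R * pi by rewrite /c; field.
have -> : sin (0 + n.+1%:R * pi) = 0 :> R.
  elim: n.+1 => [|k IH]; first by rewrite mul0r addr0 sin0.
  by rewrite -natr1 mulrDl mul1r addrA sinDpi IH oppr0.
by rewrite oppr0 mulr0 subrr.
Qed.

End Trigonometry.

Section Unfolding.
Variable R : realType.
Local Notation mu := (@lebesgue_measure R).
Local Notation I := (@unit_itv R).
Implicit Types (x t u tau b : R) (f : R -> R).

Lemma rsum_single (T : choiceType) (D : set T) i (f : T -> R) : D i ->
  (forall j, D j -> j != i -> f j = 0) ->
  rsummable D f /\ rsum D f = f i.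
Proof.
move=> Di f0.
have h (g : T -> R) : (forall j, 0 <= g j) -> (forall j, D j -> j != i -> g j = 0) ->
    (\esum_(j in D) (g j)%:E = (g i)%:E)%E.
  move=> g0 gi; rewrite (esumID [set i]); last by move=> j _; rewrite lee_fin.
  have -> : D `&` [set i] = [set i] by apply/seteqP; split=> [j []|j ->].
  rewrite esum_set1 ?lee_fin// esum1 ?adde0// => j [Dj /eqP ji].
  by rewrite gi.
have h0 x : 0 <= Num.max x 0 by rewrite le_max lexx orbT.
split.
  by rewrite rsummableE h ?ltry// => j Dj ji; rewrite f0// normr0.
rewrite /rsum !h//; try by move=> j Dj ji; rewrite f0// ?oppr0 maxxx.
rewrite /= !maxEle; case: ifP => [|/negbT]; case: ifP => [|/negbT]; rewrite -?ltNge; lra.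
Qed.

(** The half-open unit intervals around the integers tile the line. *)
Lemma integral_unfold f : mu.-integrable [set: R] (EFin \o f) ->
  let h (k : int) := \int[mu]_(u in I) f (k%:~R + u) in
  rsummable [set: int] h /\ rsum [set: int] h = \int[mu]_(u in [set: R]) f u.
Proof.
move=> fi h.
pose J (k : int) : set R := [set u | I (u - k%:~R)].
have preJ (k : int) : (fun x : R => 1 * x + k%:~R) @^-1` J k = I.
  by apply/seteqP; split=> u; rewrite /J /preimage/= mul1r addrK.
have JE (k : int) u : J k u = (Num.floor (u + 2^-1) == k) :> Prop.
  rewrite /J /= unit_itvE Num.Theory.floor_eq intrD; congr is_true.
  by apply/andP/andP => -[h1 h2]; split; lra.
have mJ k : measurable (J k).
  rewrite (_ : J k = [set` `[k%:~R - 2^-1, k%:~R + 2^-1[]); first exact: measurable_itv.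
  by apply/seteqP; split=> u; rewrite /J /= unit_itvE in_itv/= => /andP[h1 h2]; apply/andP; split; lra.
pose g (k : int) (u : R) : R := (f \_ (J k)) u.
have gE k u : g k u = if Num.floor (u + 2^-1) == k then f u else 0.
  rewrite /g patchE; case: ifPn => [/set_mem|]; first by rewrite JE => ->.
  by move=> /negP uJ; case: ifPn => // k0; exfalso; apply: uJ; apply/mem_set; rewrite JE.
have [mf Lf] := integrableP _ _ _ fi.
have mg k : measurable_fun [set: R] (g k).
  apply/(measurable_restrictT f (mJ k)).
  by apply: measurable_funTS; move/measurable_EFinP : mf.
have gs u : rsummable [set: int] (g ^~ u) /\ rsum [set: int] (g ^~ u) = f u.
  have [] := @rsum_single _ [set: int] (Num.floor (u + 2^-1)) (g ^~ u) Logic.I.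
    by move=> j _ ji; rewrite gE eq_sym (negbTE ji).
  by move=> h1 ->; split=> //; rewrite gE eqxx.
have gL : (\esum_(k in [set: int]) \int[mu]_(u in [set: R]) `|g k u|%:E < +oo)%E.
  rewrite -integral_esum//; last first.
    move=> k _; apply/measurable_EFinP; exact: measurableT_comp (mg k).
  apply: le_lt_trans Lf; apply: ge0_le_integral => //.
  - by move=> u _; apply: esum_ge0.
  - apply: measurable_esum => [k _|//]; apply/measurable_EFinP; exact: measurableT_comp (mg k).
  - by apply: measurableT_comp mf.
  - move=> u _; have [] := @rsum_single _ [set: int] (Num.floor (u + 2^-1)) (fun k => `|g k u|) Logic.I.
      by move=> j _ ji; rewrite gE eq_sym (negbTE ji) normr0.
    move=> sg; rewrite rsum_ge0E// => e; rewrite -[leLHS]fineK ?e; last first.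
      by apply: rsummable_fin sg _.
    by rewrite gE eqxx.
have [ig sg rg] := @rsum_Rintegral R _ _ _ mu _ measurableT [set: int] g (fun k _ => mg k) (fun u _ => (gs u).1) gL.
have e k : \int[mu]_(u in [set: R]) g k u = h k.
  rewrite /g -Rintegral_mkcond.
  have iJ : mu.-integrable (J k) (EFin \o f).
    by apply: (@integrableS _ _ _ mu setT) fi => //; exact: mJ.
  have [_ ->] := @integrable_affine R 1 k%:~R ltr01 (J k) f (mJ k) iJ.
  rewrite preJ mul1r; apply: eq_Rintegral => u _.
  by rewrite mul1r addrC.
split.
  by apply: eq_rsummable sg => k _; exact: e.
rewrite -(eq_rsum (fun k _ => e k)) rg; apply: eq_Rintegral => u _.
exact: (gs u).2.
Qed.

Definition gaussian tau x : R := expR (- (tau * x ^+ 2)).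

Lemma gaussianN tau x : gaussian tau (- x) = gaussian tau x.
Proof. by rewrite /gaussian sqrrN. Qed.

Lemma gaussian_ge0 tau x : 0 <= gaussian tau x.
Proof. exact: expR_ge0. Qed.

Lemma continuous_gaussian tau : continuous (gaussian tau).
Proof.
move=> x; have d2 : is_derive x (1:R) (fun u : R => - (tau * u ^+ 2)) (- (tau * (x * 1 + 1 * x))).
  exact: is_deriveNf (is_deriveZf tau (is_deriveMf (is_derive_idf x) (is_derive_idf x))).
exact: derive_continuous (is_derive1_comp (f := expR) (is_derive_expR _) d2).
Qed.

Lemma measurable_gaussian tau (D : set R) : measurable_fun D (gaussian tau).
Proof.
by apply: measurable_funTS; apply: continuous_measurable_fun; exact: continuous_gaussian.
Qed.

Lemma integrable_affineT (k b : R) f : 0 < k -> mu.-integrable [set: R] (EFin \o f) ->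
  mu.-integrable [set: R] (EFin \o (fun x => f (k * x + b))) /\
  \int[mu]_(x in [set: R]) f x = k * \int[mu]_(x in [set: R]) f (k * x + b).
Proof.
move=> k0 fi; have [] := @integrable_affine R k b k0 _ _ measurableT fi.
by rewrite preimage_setT.
Qed.

Lemma gaussian_fourier tau b : 0 < tau ->
  mu.-integrable [set: R] (EFin \o (fun u => gaussian tau u * cos (b * u))) /\
  \int[mu]_(u in [set: R]) (gaussian tau u * cos (b * u)) =
  Num.sqrt (pi / tau) * expR (- (b ^+ 2 / (4 * tau))).
Proof.
move=> tau0; set k := Num.sqrt tau.
have k0 : 0 < k by rewrite sqrtr_gt0.
have k2 : k ^+ 2 = tau by rewrite sqr_sqrtr// ltW.
have [i1 e1] := integrable_affineT 0 k0 (integrable_gauss_cos (b / k)).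
have e u : gauss_fun (k * u + 0) * cos (b / k * (k * u + 0)) = gaussian tau u * cos (b * u).
  rewrite addr0 mulrA divfK ?gt_eqF// /gauss_fun /gaussian -k2.
  by congr (expR _ * _); ring.
split; first by apply: eq_integrable i1 => // u _ /=; rewrite e.
move: e1; rewrite gauss_fourier => e1.
apply: (mulfI (lt0r_neq0 k0)).
rewrite [LHS](_ : _ = k * \int[mu]_(x in [set: R])
     (gauss_fun (k * x + 0) * cos (b / k * (k * x + 0)))); last first.
  by congr (_ * _); apply: eq_Rintegral => u _; rewrite e.
rewrite -e1 mulrA; congr (_ * expR (- _)).
  rewrite sqrtrM ?pi_ge0// sqrtrV ?ltW// mulrCA divff ?mulr1// gt_eqF//.
by rewrite -k2; field; rewrite gt_eqF.
Qed.

Lemma integrable_gaussian_cosB tau b t : 0 < tau ->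
  mu.-integrable [set: R] (EFin \o (fun u => gaussian tau u * cos (b * (u - t)))).
Proof.
move=> tau0; apply: le_integrable (gaussian_fourier 0 tau0).1 => //.
  apply/measurable_EFinP; apply: measurable_funM; first exact: measurable_gaussian.
  apply: (@measurableT_comp _ _ _ _ _ _ (@cos R)).
    by apply: continuous_measurable_fun; exact: continuous_cos.
  by apply: measurable_funM => //; apply: measurable_funB.
move=> u _ /=; rewrite lee_fin mul0r cos0 mulr1 normrM ler_piMr//.
exact: cos_max.
Qed.

Lemma gaussian_fourier_shift tau b t : 0 < tau ->
  let f u := gaussian tau (t + u) * cos (b * u) in
  mu.-integrable [set: R] (EFin \o f) /\
  \int[mu]_(u in [set: R]) f u =
    \int[mu]_(u in [set: R]) (gaussian tau u * cos (b * (u - t))).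
Proof.
move=> tau0 f.
pose F u : R := gaussian tau u * cos (b * (u - t)).
have iF : mu.-integrable [set: R] (EFin \o F) := integrable_gaussian_cosB b t tau0.
have [i1 e1] := integrable_affineT t ltr01 iF.
have e u : F (1 * u + t) = f u by rewrite /F /f mul1r addrK addrC.
split; first by apply: eq_integrable i1 => // u _ /=; rewrite e.
by rewrite -/(F _) e1 mul1r; apply: eq_Rintegral => u _; rewrite e.
Qed.

(** Adding the coefficients at [t] and [- t] leaves only cosines, so that the
    sine transform of the Gaussian never enters. *)
Lemma gaussian_fourier_even tau (n : nat) t : 0 < tau ->
  \int[mu]_(u in [set: R]) (gaussian tau (t + u) * cos (2 * pi * n%:R * u)) +
  \int[mu]_(u in [set: R]) (gaussian tau (- t + u) * cos (2 * pi * n%:R * u)) =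
  2 * cos (2 * pi * (n%:R * t)) * (Num.sqrt (pi / tau) * expR (- (pi ^+ 2 * n%:R ^+ 2 / tau))).
Proof.
move=> tau0; set b := 2 * pi * n%:R.
have [i0 e0] := gaussian_fourier b tau0.
rewrite (gaussian_fourier_shift b t tau0).2 (gaussian_fourier_shift b (- t) tau0).2.
have it := integrable_gaussian_cosB b t tau0.
have iN := integrable_gaussian_cosB b (- t) tau0.
rewrite -RintegralD//.
transitivity (\int[mu]_(u in [set: R]) (2 * cos (b * t) * (gaussian tau u * cos (b * u)))).
  by apply: eq_Rintegral => u _; rewrite opprK mulrBr mulrDr cosB cosD; ring.
rewrite RintegralZl// e0; congr (2 * cos _ * (_ * expR (- _))).
  by rewrite /b; ring.
by rewrite /b; field; rewrite gt_eqF.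
Qed.

End Unfolding.

Section Reindexing.
Variable R : realType.

Lemma rsum_reindex (T T' : choiceType) (P : set T) (Q : set T') (e : T -> T')
    (f : T' -> R) : set_bij P Q e ->
  (rsummable Q f <-> rsummable P (f \o e)) /\ rsum Q f = rsum P (f \o e).
Proof.
move=> be; split; first by rewrite !rsummableE (reindex_esum _ _ _ _ be).
by rewrite /rsum !(reindex_esum _ _ _ _ be).
Qed.

Lemma set_bij_opp_int : set_bij [set: int] [set: int] -%R.
Proof. by split. Qed.

Lemma set_bij_succn : set_bij [set: nat] [set n : nat | (0 < n)%N] S.
Proof.
split=> //; first by move=> x y _ _ [].
by move=> [|n]// _; exists n.
Qed.

Lemma rsummable_Posz (f : int -> R) : rsummable [set: int] f ->
  rsummable [set: nat] (fun n : nat => f n).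
Proof.
rewrite !rsummableE esum_int => [|k]; last by rewrite lee_fin.
by apply: le_lt_trans; rewrite leeDl// esum_ge0// => n _; rewrite lee_fin.
Qed.

Lemma subset_rsummable (T : choiceType) (D E : set T) (f : T -> R) : D `<=` E ->
  rsummable E f -> rsummable D f.
Proof.
move=> DE; rewrite !rsummableE; apply: le_lt_trans.
rewrite esum_mkcond [leRHS]esum_mkcond; apply: le_esum => i _.
case: ifPn => [/set_mem/DE/mem_set ->//|_].
by case: ifPn; rewrite lee_fin.
Qed.

Lemma rsummable_gauss_nat (D : set nat) (x : R) : 0 < x ->
  rsummable D (fun n : nat => expR (- (x * n%:R ^+ 2))).
Proof.
move=> x0; have := rsummable_Posz (rsummable_gauss_shift 0 x0).
move=> /(@subset_rsummable _ D); move=> /(_ (fun _ _ => Logic.I)).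
by apply: eq_rsummable => n _; rewrite add0r.
Qed.

Lemma cvg_rsum_nat (f : nat -> R) : rsummable [set: nat] f ->
  \sum_(k < N) f k @[N --> \oo] --> rsum [set: nat] f.
Proof.
have ge0 (g : nat -> R) : (forall n, 0 <= g n) -> rsummable [set: nat] g ->
    \sum_(k < N) g k @[N --> \oo] --> fine (\esum_(n in [set: nat]) (g n)%:E)%E.
  move=> g0 sg; have fg := rsummable_fin sg (fun n _ => g0 n).
  have : cvg ((fun N : nat => \sum_(0 <= k < N) (g k)%:E)%E @ \oo).
    by apply: is_cvg_nneseries => n _ _; rewrite lee_fin.
  rewrite /= nneseries_esumT; last by move=> n; rewrite lee_fin.
  rewrite -[X in _ --> X -> _](fineK fg) => /fine_cvg; apply: cvg_trans.
  by apply: near_eq_cvg; apply: nearW => N; rewrite /= sumEFin big_mkord.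
move=> sf; rewrite (rsumE sf).
rewrite (_ : (fun N : nat => _) = (fun N => \sum_(k < N) (f k + `|f k|)) \- (fun N => \sum_(k < N) `|f k|)); last first.
  by apply/funext => N /=; rewrite -sumrB; apply: eq_bigr => k _; rewrite addrK.
have sn := rsummable_norm sf.
apply: cvgB; apply: ge0 => //.
- by move=> n; rewrite addrC -[f n]opprK subr_ge0 normrN ler_norm.
- exact: rsummableD.
Qed.

End Reindexing.

Section Chernoff.
Variable R : realType.
Local Notation mu := (@lebesgue_measure R).
Local Notation I := (@unit_itv R).
Implicit Types (x t u tau : R).

Lemma integrable_unit_itv (f : R -> R) (M : R) : measurable_fun I f ->
  (forall u, I u -> `|f u| <= M) -> mu.-integrable I (EFin \o f).
Proof.
move=> mf fM.
have : mu.-integrable I (EFin \o (fun _ : R => M)).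
  apply: (@measurable_bounded_integrable _ _ _ mu) => //.
  - exact: measurable_unit_itv.
  - by apply: (@le_lt_trans _ _ 1%E); [rewrite -(@lebesgue_measure_unit_itv R)|exact: ltry].
  - by exists `|M|; split; [exact: num_real|move=> x Mx u _ /=; exact: ltW].
apply: le_integrable.
- exact: measurable_unit_itv.
- exact/measurable_EFinP.
by move=> u Iu /=; rewrite lee_fin (le_trans (fM _ Iu))// ler_norm.
Qed.

Lemma norm_integral_unit_itv (f : R -> R) (M : R) : measurable_fun I f ->
  (forall u, I u -> `|f u| <= M) -> `|\int[mu]_(u in I) f u| <= M.
Proof.
move=> mf fM; have fi := integrable_unit_itv mf fM.
have nf : mu.-integrable I (EFin \o (fun u => `|f u|)) by exact: (integrable_norm fi).
have Mi : mu.-integrable I (EFin \o (fun _ : R => M)).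
  apply: (@integrable_unit_itv _ `|M|) => //.
apply: (@le_trans _ _ (\int[mu]_(u in I) `|f u|)).
  apply: le_normr_Rintegral => //; exact: measurable_unit_itv.
rewrite -[leRHS](integral_unit_itv_cst M).
apply: le_Rintegral => //; exact: measurable_unit_itv.
Qed.

Lemma Rintegral_lin3 (A : set R) (a b c : R) (f g k : R -> R) : measurable A ->
  mu.-integrable A (EFin \o f) -> mu.-integrable A (EFin \o g) ->
  mu.-integrable A (EFin \o k) ->
  \int[mu]_(u in A) (a * f u + b * g u + c * k u) =
  a * \int[mu]_(u in A) f u + b * \int[mu]_(u in A) g u + c * \int[mu]_(u in A) k u.
Proof.
move=> mA fi gi ki.
have fi' := integrable_mulrl mA a fi; have gi' := integrable_mulrl mA b gi.
have ki' := integrable_mulrl mA c ki; have fg := integrable_addr mA fi' gi'.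
by rewrite -!RintegralZl// -!RintegralD.
Qed.

(** Chernoff's argument: after division by [sin (pi u) ^+ 2], which the
    quadratic vanishing at the origin allows, the Fourier coefficients become
    second differences of a bounded sequence [q], so that the symmetric partial
    sums at the origin are [(q N - q N.+1) / 2], whose means tend to zero. *)
Lemma fourier_sum_at0 (Psi : R -> R) (C l : R) : measurable_fun I Psi ->
  (forall u, I u -> `|Psi u| <= C * u ^+ 2) ->
  let h (n : nat) := \int[mu]_(u in I) (Psi u * cos (2 * pi * n%:R * u)) in
  \sum_(k < N) h k.+1 @[N --> \oo] --> l -> h 0%N + 2 * l = 0.
Proof.
move=> mPsi Psi_le h hl.
pose s u : R := sin (pi * u) ^+ 2.
have ms : measurable_fun I s.
  apply: measurable_funX; apply: (@measurableT_comp _ _ _ _ _ _ (@sin R)).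
    by apply: continuous_measurable_fun; exact: continuous_sin.
  exact: measurable_funM.
pose r u : R := Psi u * (s u)^-1.
have mr : measurable_fun I r.
  apply: measurable_funM => //; apply: measurable_funVge0 => // u.
  exact: sqr_ge0.
have C0 : 0 <= C.
  have I4 : I 4^-1 by rewrite unit_itvE; apply/andP; split; lra.
  have := le_trans (normr_ge0 _) (Psi_le _ I4).
  by rewrite pmulr_lge0.
have us u : I u -> u ^+ 2 <= s u.
  rewrite unit_itvE => /andP[u1 u2]; apply: sqr_le_sin_sqr.
  by rewrite ler_norml u1 ltW.
have Psi_r u : I u -> Psi u = r u * s u.
  move=> Iu; have [s0|s0] := eqVneq (s u) 0; last by rewrite /r divfK.
  have := Psi_le _ Iu; rewrite s0 mulr0.
  have : u ^+ 2 <= 0 by rewrite -s0 us.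
  move=> u2; have -> : u ^+ 2 = 0 by apply: le_anti; rewrite u2 sqr_ge0.
  by rewrite mulr0 normr_le0 => /eqP.
have rC u : I u -> `|r u| <= C.
  move=> Iu; have su : 0 <= s u by exact: sqr_ge0.
  have [s0|s0] := eqVneq (s u) 0; first by rewrite /r s0 invr0 mulr0 normr0.
  rewrite /r normrM normfV (ger0_norm su) ler_pdivrMr; last by rewrite lt0r s0.
  by apply: le_trans (Psi_le _ Iu) _; rewrite ler_wpM2l ?us.
pose q (n : nat) : R := \int[mu]_(u in I) (r u * cos (2 * pi * n%:R * u)).
have iq n : mu.-integrable I (EFin \o (fun u => r u * cos (2 * pi * n%:R * u))).
  apply: (@integrable_unit_itv _ C).
    by apply: measurable_funM => //; exact: measurable_cosM.
  move=> u Iu; rewrite normrM; apply: le_trans (rC _ Iu).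
  by rewrite ler_piMr// cos_max.
have q_le n : `|q n| <= C.
  apply: norm_integral_unit_itv.
    by apply: measurable_funM => //; exact: measurable_cosM.
  move=> u Iu; rewrite normrM; apply: le_trans (rC _ Iu).
  by rewrite ler_piMr// cos_max.
have s_cos u : s u = 2^-1 - 2^-1 * cos (2 * pi * u).
  rewrite -mulrA mulr_natl cos_mulr2n cos2sin2 /s; lra.
have h0 : h 0%N = (q 0%N - q 1%N) / 2.
  have -> : (q 0%N - q 1%N) / 2 = 2^-1 * q 0%N + (- 2^-1) * q 1%N + 0 * q 0%N by field.
  rewrite -Rintegral_lin3//; last exact: measurable_unit_itv.
  apply: eq_Rintegral => u /set_mem Iu.
  by rewrite (Psi_r _ Iu) s_cos mulr1 mulr0 mul0r cos0; ring.
have hS n : h n.+1 = 2^-1 * q n.+1 + (- 4^-1) * q n.+2 + (- 4^-1) * q n.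
  rewrite -Rintegral_lin3//; last exact: measurable_unit_itv.
  apply: eq_Rintegral => u /set_mem Iu.
  rewrite (Psi_r _ Iu) s_cos.
  have -> : 2 * pi * n.+2%:R * u = 2 * pi * n.+1%:R * u + 2 * pi * u.
    by rewrite -[n.+2%:R]natr1; ring.
  have -> : 2 * pi * n%:R * u = 2 * pi * n.+1%:R * u - 2 * pi * u.
    by rewrite -[n.+1%:R]natr1; ring.
  by rewrite cosD cosB; field.
pose S N := h 0%N + 2 * \sum_(k < N) h k.+1.
have SE N : S N = (q N - q N.+1) / 2.
  rewrite /S; elim: N => [|N IH]; first by rewrite big_ord0 mulr0 addr0.
  by rewrite big_ord_recr/= mulrDr addrA IH hS; field.
have Sl : S @ \oo --> h 0%N + 2 * l.
  by apply: cvgD; [exact: cvg_cst|apply: cvgM => //; exact: cvg_cst].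
have := cesaro Sl => /cvg_unique; apply => //.
have -> : arithmetic_mean S = (fun n => n.+1%:R^-1 * ((q 0%N - q n.+1) / 2)).
  apply/funext => n; rewrite /arithmetic_mean /=; congr (_ * _).
  rewrite seriesEnat /= big_mkord; elim: n => [|n IH].
    by rewrite big_ord_recr big_ord0/= add0r SE.
  by rewrite big_ord_recr/= IH SE; field.
apply: (@squeeze_cvgr _ _ _ _ (fun n => - (C * harmonic n)) (fun n => C * harmonic n)).
- apply: nearW => n; rewrite -ler_norml normrM mulrC /harmonic /=.
  apply: ler_pM => //; last by rewrite normfV ger0_norm.
  rewrite normrM normfV (ger0_norm (ler0n _ 2)) ler_pdivrMr// mulr_natr.
  by apply: le_trans (ler_normB _ _) _; rewrite mulr2n lerD.
- rewrite -oppr0; apply: cvgN; rewrite -[X in _ --> X](mulr0 C).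
  by apply: cvgM; [exact: cvg_cst|exact: cvg_harmonic].
- rewrite -[X in _ --> X](mulr0 C).
  by apply: cvgM; [exact: cvg_cst|exact: cvg_harmonic].
Qed.

End Chernoff.

Section GaussianPoisson.
Variable R : realType.
Local Notation mu := (@lebesgue_measure R).
Local Notation I := (@unit_itv R).
Implicit Types (x t u : R).

(** The middle term is [expR `|x| * (1 - expR (- `|x|)) ^+ 2]. *)
Lemma expR_second_difference (x : R) :
  0 <= expR x + expR (- x) - 2 <= x ^+ 2 * expR `|x|.
Proof.
wlog x0 : x / 0 <= x => [H|].
  have [/H//|/ltW xN] := leP 0 x.
  have := H (- x); rewrite oppr_ge0 opprK sqrrN normrN [expR (- x) + _]addrC; exact.
have xx : expR x * expR (- x) = 1 by rewrite -expRD subrr expR0.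
have e : expR x + expR (- x) - 2 = expR x * (1 - expR (- x)) ^+ 2.
  have -> : expR x * (1 - expR (- x)) ^+ 2 =
     expR x - 2 * (expR x * expR (- x)) + (expR x * expR (- x)) * expR (- x) by ring.
  by rewrite xx; ring.
rewrite e mulr_ge0 ?expR_ge0 ?sqr_ge0//= ger0_norm// mulrC ler_wpM2r ?expR_ge0//.
have e1 : 0 <= 1 - expR (- x) by rewrite subr_ge0 -expR0 ler_expR oppr_le0.
by rewrite ler_pXn2r ?nnegrE//; have := expR_ge1Dx (- x); lra.
Qed.

Section Periodization.
Variables (tau t : R).
Hypothesis tau0 : 0 < tau.
Local Notation g := (gaussian tau).

Let psi (a : int) u := g (t + a%:~R + u) + g (t + a%:~R - u) - 2 * g (t + a%:~R).
Let C := 32 * tau * expR (2 * tau) + 2 * tau.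
Let e (a : int) : R := expR (- (tau / 2 * (t + a%:~R) ^+ 2)).

Let C0 : 0 <= C.
Proof. by rewrite /C addr_ge0// ?mulr_ge0 ?expR_ge0 ?(ltW tau0). Qed.

(** With [y = 2 tau x u] and [E = exp (- tau u^2)], the second difference is
    [g x] times [E (2 cosh y - 2) - 2 (1 - E)]. Half of the Gaussian decay of
    [g x] absorbs both the factor [x^2] hidden in [y^2] and the growth of
    [exp |y|], since [|x| <= x^2 / 8 + 2]. *)
Let psi_le a u : I u -> `|psi a u| <= C * u ^+ 2 * e a.
Proof.
rewrite unit_itvE => /andP[u1 u2]; have u3 : `|u| <= 2^-1 by rewrite ler_norml u1 ltW.
rewrite /psi /e; set x := t + a%:~R; clearbody x.
pose y := 2 * tau * x * u.
pose E := expR (- (tau * u ^+ 2)).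
have -> : g (x + u) + g (x - u) - 2 * g x =
    g x * (E * (expR y + expR (- y) - 2) - 2 * (1 - E)).
  have -> : g (x + u) = g x * (E * expR (- y)).
    by rewrite /gaussian /E /y -!expRD; congr expR; ring.
  have -> : g (x - u) = g x * (E * expR y).
    by rewrite /gaussian /E /y -!expRD; congr expR; ring.
  ring.
have tu : 0 <= tau * u ^+ 2 by rewrite mulr_ge0 ?sqr_ge0 ?(ltW tau0).
have E0 : 0 <= E by exact: expR_ge0.
have E1 : E <= 1 by rewrite /E -expR0 ler_expR oppr_le0.
have E2 : 1 - E <= tau * u ^+ 2.
  by have := expR_ge1Dx (- (tau * u ^+ 2)); rewrite -/E; lra.
have /andP[] := expR_second_difference y.
set c := _ - 2 => c0 cy.
have yx : `|y| <= tau * (x ^+ 2 / 8 + 2).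
  rewrite /y !normrM (ger0_norm (ltW tau0)) (ger0_norm (ler0n _ 2)).
  have h1 : `|x| <= x ^+ 2 / 8 + 2.
    have := sqr_ge0 (`|x| - 4); rewrite -[x ^+ 2](real_normK (num_real x)); lra.
  apply: (@le_trans _ _ (2 * tau * `|x| * 2^-1)).
    by rewrite ler_wpM2l// mulr_ge0// mulr_ge0// ltW.
  by rewrite -!mulrA mulrCA ler_wpM2l ?(ltW tau0)//; lra.
have y2 : y ^+ 2 <= 32 * tau * expR (tau * (x ^+ 2 / 8)) * u ^+ 2.
  have -> : y ^+ 2 = 4 * tau * (tau * x ^+ 2) * u ^+ 2 by rewrite /y; ring.
  rewrite ler_wpM2r ?sqr_ge0//.
  have := expR_ge1Dx (tau * (x ^+ 2 / 8)); set z := expR _ => hz.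
  have -> : 32 * tau * z = 4 * tau * (8 * z) by ring.
  rewrite ler_wpM2l ?mulr_ge0 ?(ltW tau0)//; lra.
have cle : c <= 32 * tau * expR (2 * tau) * expR (tau * x ^+ 2 / 4) * u ^+ 2.
  apply: (le_trans cy).
  apply: (@le_trans _ _ (32 * tau * expR (tau * (x ^+ 2 / 8)) * u ^+ 2 * expR (tau * (x ^+ 2 / 8 + 2)))).
    by apply: ler_pM => //; rewrite ?sqr_ge0 ?expR_ge0 ?ler_expR.
  rewrite le_eqVlt; apply/orP; left; apply/eqP.
  have -> : expR (tau * x ^+ 2 / 4) = expR (tau * (x ^+ 2 / 8)) * expR (tau * (x ^+ 2 / 8)).
    by rewrite -expRD; congr expR; field.
  have -> : expR (tau * (x ^+ 2 / 8 + 2)) = expR (tau * (x ^+ 2 / 8)) * expR (2 * tau).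
    by rewrite -expRD; congr expR; ring.
  ring.
rewrite normrM (ger0_norm (gaussian_ge0 _ _)).
have -> : g x = expR (- (tau / 2 * x ^+ 2)) * expR (- (tau / 2 * x ^+ 2)).
  by rewrite /gaussian -expRD; congr expR; field.
set G := expR _.
rewrite -[leLHS]mulrA [leLHS]mulrC; apply: ler_wpM2r; first exact: expR_ge0.
have G0 : 0 <= G by exact: expR_ge0.
apply: (@le_trans _ _ (G * (c + 2 * (tau * u ^+ 2)))).
  rewrite ler_wpM2l//; apply: le_trans (ler_normB _ _) _.
  rewrite (ger0_norm (mulr_ge0 E0 c0)) ger0_norm; last by rewrite mulr_ge0 ?subr_ge0.
  by apply: lerD; [rewrite ler_piMl|rewrite ler_wpM2l].
have Gx : G * expR (tau * x ^+ 2 / 4) <= 1.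
  rewrite /G -expRD -[leRHS]expR0 ler_expR.
  have := mulr_ge0 (ltW tau0) (sqr_ge0 x); lra.
have G1 : G <= 1.
  by rewrite /G -[leRHS]expR0 ler_expR oppr_le0 mulr_ge0 ?sqr_ge0// divr_ge0 ?(ltW tau0).
have -> : C * u ^+ 2 = 32 * tau * expR (2 * tau) * u ^+ 2 + 2 * (tau * u ^+ 2).
  by rewrite /C; ring.
rewrite mulrDr; apply: lerD; last by rewrite ler_piMl// mulr_ge0.
apply: (@le_trans _ _ (G * (32 * tau * expR (2 * tau) * expR (tau * x ^+ 2 / 4) * u ^+ 2))).
  by rewrite ler_wpM2l.
have -> : G * (32 * tau * expR (2 * tau) * expR (tau * x ^+ 2 / 4) * u ^+ 2) =
  (G * expR (tau * x ^+ 2 / 4)) * (32 * tau * expR (2 * tau) * u ^+ 2) by ring.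
by rewrite ler_piMl// mulr_ge0 ?sqr_ge0// mulr_ge0 ?expR_ge0// mulr_ge0// ltW.
Qed.

Let F := rsum [set: int] (fun a : int => g (t + a%:~R)).

Let sum_e : rsummable [set: int] e.
Proof. by apply: rsummable_gauss_shift; rewrite divr_gt0. Qed.

Let e0 a : 0 <= e a. Proof. exact: expR_ge0. Qed.

Let mpsi a : measurable_fun I (psi a).
Proof.
apply: measurable_funTS; apply: continuous_measurable_fun => u.
apply: cvgB; last exact: cvg_cst.
apply: cvgD; apply: continuous_comp; try exact: continuous_gaussian.
  by apply: cvgD; [exact: cvg_cst|exact: cvg_id].
by apply: cvgB; [exact: cvg_cst|exact: cvg_id].
Qed.

Let psi_le1 a u : I u -> `|psi a u| <= C * e a.
Proof.
move=> Iu; apply: le_trans (psi_le a Iu) _; rewrite ler_wpM2r// ler_piMr//.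
move: Iu; rewrite unit_itvE => /andP[u1 u2].
rewrite -(real_normK (num_real u)) expr_le1//.
by rewrite (@le_trans _ _ 2^-1)// ?ler_norml ?u1 ?(ltW u2)//; lra.
Qed.

Let sum_psi u : I u -> rsummable [set: int] (psi ^~ u).
Proof.
move=> Iu; apply: le_rsummable (rsummableZ C sum_e) => a _.
exact: psi_le1.
Qed.

Let Psi u := rsum [set: int] (psi ^~ u).

Let Psi_le u : I u -> `|Psi u| <= C * rsum [set: int] e * u ^+ 2.
Proof.
move=> Iu; rewrite mulrAC -rsumZ.
apply: norm_rsum_le => [a _|]; first exact: psi_le.
exact: rsummableZ.
Qed.

Let psi_cos (n : nat) :
  [/\ mu.-integrable I (EFin \o (fun u => Psi u * cos (2 * pi * n%:R * u))),
      rsummable [set: int] (fun a => \int[mu]_(u in I) (psi a u * cos (2 * pi * n%:R * u))) &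
      rsum [set: int] (fun a => \int[mu]_(u in I) (psi a u * cos (2 * pi * n%:R * u))) =
      \int[mu]_(u in I) (Psi u * cos (2 * pi * n%:R * u))].
Proof.
pose f (a : int) u : R := cos (2 * pi * n%:R * u) * psi a u.
have le a u : I u -> `|f a u| <= C * e a.
  move=> Iu; rewrite /f normrM; apply: le_trans (psi_le1 a Iu).
  by rewrite ler_piMl// cos_max.
have mf a : measurable_fun I (f a).
  by apply: measurable_funM => //; exact: measurable_cosM.
have sf u : I u -> rsummable [set: int] (f ^~ u).
  by move=> Iu; apply: le_rsummable (rsummableZ C sum_e) => a _; exact: le.
have If : (\esum_(a in [set: int]) \int[mu]_(u in I) `|f a u|%:E < +oo)%E.
  have sC := rsummableZ C sum_e.
  apply: le_lt_trans sC; apply: le_esum => a _ /=.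
  have Ce : 0 <= C * e a by rewrite mulr_ge0.
  rewrite (ger0_norm Ce) -[in leRHS](integral_unit_itv_cst (C * e a)) -integral_EFinE; last first.
    by apply: (@integrable_unit_itv _ _ (C * e a)) => // u _; rewrite ger0_norm.
    exact: measurable_unit_itv.
  apply: ge0_le_integral => //; first exact: measurable_unit_itv.
  - by apply/measurable_EFinP; exact: measurableT_comp (mf a).
  - by move=> u Iu; rewrite lee_fin le.
have [h1 h2 h3] := @rsum_Rintegral R _ _ _ mu I (@measurable_unit_itv R) [set: int] f (fun a _ => mf a) sf If.
have fE a u : f a u = psi a u * cos (2 * pi * n%:R * u) by rewrite /f mulrC.
have FE u : rsum [set: int] (f ^~ u) = Psi u * cos (2 * pi * n%:R * u).
  by rewrite /f rsumZ mulrC.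
have iE a : \int[mu]_(u in I) f a u = \int[mu]_(u in I) (psi a u * cos (2 * pi * n%:R * u)).
  by apply: eq_Rintegral => u _; rewrite fE.
split.
- rewrite (_ : (fun u => _) = (fun u => rsum [set: int] (f ^~ u)))//.
  by apply/funext => u; rewrite FE.
- by apply: eq_rsummable h2 => a _; exact: iE.
- rewrite -(eq_rsum (fun a _ => iE a)) h3.
  by apply: eq_Rintegral => u _; rewrite FE.
Qed.

(** The integer inside the cosine is free by periodicity; it prepares the
    unfolding of the sum over [a] into an integral over the line. *)
Let psi_cos_split (n : nat) (a : int) :
  \int[mu]_(u in I) (psi a u * cos (2 * pi * n%:R * u)) =
  \int[mu]_(u in I) (g (t + (a%:~R + u)) * cos (2 * pi * n%:R * (a%:~R + u))) +
  \int[mu]_(u in I) (g (- t + ((- a)%:~R + u)) * cos (2 * pi * n%:R * ((- a)%:~R + u))) +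
  - (2 * (n == 0)%:R) * g (t + a%:~R).
Proof.
have cosE (b : int) u : cos (2 * pi * n%:R * (b%:~R + u)) = cos (2 * pi * n%:R * u).
  rewrite -[RHS](cosD2piM _ (n%:Z * b)); congr cos.
  by rewrite intrM; ring.
set f1 := (X in _ = \int[mu]_(u in I) X u + _ + _).
set f2 := (X in _ = _ + \int[mu]_(u in I) X u + _).
pose f3 u : R := cos (2 * pi * n%:R * u).
have mc := @measurable_cosM R I (2 * pi * n%:R).
have g1 x : gaussian tau x <= 1.
  by rewrite /gaussian -[leRHS]expR0 ler_expR oppr_le0 mulr_ge0 ?sqr_ge0 ?(ltW tau0).
have ig (k : R -> R) : continuous k -> mu.-integrable I (EFin \o (fun u => g (k u) * cos (2 * pi * n%:R * u))).
  move=> ck; apply: (@integrable_unit_itv _ _ 1).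
    apply: measurable_funM => //; apply: measurable_funTS.
    apply: continuous_measurable_fun => u.
    by apply: continuous_comp; [exact: ck|exact: continuous_gaussian].
  move=> u _; rewrite normrM (ger0_norm (gaussian_ge0 _ _)).
  by rewrite mulr_ile1 ?gaussian_ge0// cos_max.
have i1 : mu.-integrable I (EFin \o f1).
  rewrite (_ : f1 = (fun u => g (t + (a%:~R + u)) * cos (2 * pi * n%:R * u))).
    by apply: ig => u; apply: cvgD; [exact: cvg_cst|apply: cvgD; [exact: cvg_cst|exact: cvg_id]].
  by apply/funext => u; rewrite /f1 cosE.
have i2 : mu.-integrable I (EFin \o f2).
  rewrite (_ : f2 = (fun u => g (- t + ((- a)%:~R + u)) * cos (2 * pi * n%:R * u))).
    by apply: ig => u; apply: cvgD; [exact: cvg_cst|apply: cvgD; [exact: cvg_cst|exact: cvg_id]].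
  by apply/funext => u; rewrite /f2 cosE.
have i3 : mu.-integrable I (EFin \o f3).
  by apply: (@integrable_unit_itv _ _ 1) => // u _; exact: cos_max.
transitivity (1 * \int[mu]_(u in I) f1 u + 1 * \int[mu]_(u in I) f2 u +
   (- 2 * g (t + a%:~R)) * \int[mu]_(u in I) f3 u); last first.
  by rewrite integral_unit_itv_cos !mul1r; congr (_ + _); ring.
rewrite -Rintegral_lin3//; last exact: measurable_unit_itv.
apply: eq_Rintegral => u _; rewrite /f1 /f2 /f3 !cosE /psi.
have -> : - t + ((- a)%:~R + u) = - (t + a%:~R - u) by rewrite mulrNz; ring.
by rewrite gaussianN addrA; ring.
Qed.

Let coef (n : nat) : R := Num.sqrt (pi / tau) *
  (expR (- (pi ^+ 2 * n%:R ^+ 2 / tau)) * cos (2 * pi * (n%:R * t))).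

Let Psi_coef (n : nat) :
  \int[mu]_(u in I) (Psi u * cos (2 * pi * n%:R * u)) = 2 * coef n - 2 * (n == 0)%:R * F.
Proof.
have [_ _ <-] := psi_cos n.
rewrite (eq_rsum (fun a _ => psi_cos_split n a)).
have i1 := (gaussian_fourier_shift (2 * pi * n%:R) t tau0).1.
have i2 := (gaussian_fourier_shift (2 * pi * n%:R) (- t) tau0).1.
have [s1 e1] := integral_unfold i1; have [s2 e2] := integral_unfold i2.
pose h2 (k : int) := \int[mu]_(u in I) (g (- t + (k%:~R + u)) * cos (2 * pi * n%:R * (k%:~R + u))).
have [rb rb2] := rsum_reindex h2 set_bij_opp_int.
have s2' : rsummable [set: int] (h2 \o -%R) by apply/rb.
have s3 : rsummable [set: int] (fun a => - (2 * (n == 0)%:R) * g (t + a%:~R)).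
  by apply: rsummableZ; exact: rsummable_gauss_shift.
rewrite (rsumD (rsummableD s1 s2') s3) rsumZ -/F.
have := rsumD s1 s2'; rewrite -rb2 e1 [rsum _ h2]e2 gaussian_fourier_even// => h12.
transitivity (2 * coef n + - (2 * (n == 0)%:R) * F); last by ring.
congr (_ + _); apply: etrans h12 _; rewrite /coef; ring.
Qed.

Let sum_coef : rsummable [set: nat] (fun n => coef n.+1).
Proof.
apply: rsummableZ.
pose p := pi ^+ 2 / tau; have p0 : 0 < p by rewrite divr_gt0// exprn_gt0// pi_gt0.
have := rsummable_Posz (rsummable_gauss_shift 1 p0).
apply: le_rsummable => n _; rewrite normrM ger0_norm ?expR_ge0//.
rewrite (_ : pi ^+ 2 * n.+1%:R ^+ 2 / tau = p * (1 + n%:~R) ^+ 2); last first.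
  by rewrite /p -natr1 -[n%:~R]/(n%:R); field; rewrite gt_eqF.
by rewrite ler_piMr ?expR_ge0// cos_max.
Qed.

(** Poisson summation for the Gaussian: the even function [Psi] that measures
    the deviation of the periodization from its value at [t] vanishes to second
    order, so the sum of its Fourier coefficients is zero. *)
Lemma gaussian_poisson :
  rsum [set: int] (fun a : int => g (t + a%:~R)) =
  Num.sqrt (pi / tau) * (1 + rsum [set n : nat | (0 < n)%N] (fun n =>
    expR (- (pi ^+ 2 * n%:R ^+ 2 / tau)) * (2 * cos (2 * pi * (n%:R * t))))).
Proof.
have mPsi : measurable_fun I Psi.
  have [i0 _ _] := psi_cos 0%N.
  apply: (@eq_measurable_fun _ _ _ _ I (fun u => Psi u * cos (2 * pi * 0%:R * u))).
    by move=> u _; rewrite mulr0 mul0r cos0 mulr1.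
  by apply/measurable_EFinP; exact: measurable_int i0.
have cv : \sum_(k < N) \int[mu]_(u in I) (Psi u * cos (2 * pi * k.+1%:R * u)) @[N --> \oo] -->
    2 * rsum [set: nat] (fun n => coef n.+1).
  rewrite -rsumZ.
  have := cvg_rsum_nat (rsummableZ 2 sum_coef); apply: cvg_trans.
  apply: near_eq_cvg; apply: nearW => N; apply: eq_bigr => k _.
  by rewrite Psi_coef mulr0 mul0r subr0.
have := fourier_sum_at0 mPsi Psi_le cv.
rewrite Psi_coef mulr1 -/F /coef rsumZ.
set S := rsum _ _.
have -> : rsum [set n : nat | (0 < n)%N] (fun n =>
    expR (- (pi ^+ 2 * n%:R ^+ 2 / tau)) * (2 * cos (2 * pi * (n%:R * t)))) = 2 * S.
  rewrite (rsum_reindex _ set_bij_succn).2 /S -rsumZ; apply: eq_rsum => n _ /=.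
  by rewrite mulrCA.
rewrite expr0n/= mulr0 !mul0r oppr0 expR0 mulr0 cos0.
by move=> h; rewrite -/F; lra.
Qed.

End Periodization.
End GaussianPoisson.

(** * The lattice sum on a line *)

Section LatticeSums.
Variable R : realType.
Local Notation mu := (@lebesgue_measure R).
Local Notation pos := (`]0, +oo[%classic : set R).
Implicit Types (x y t h p tau : R).

Lemma powRN_le_scale p k x y : 0 <= p -> 0 < k -> 0 < x -> x <= k * y ->
  y `^ (- p) <= k `^ p * x `^ (- p).
Proof.
move=> p0 k0 x0 xy.
have -> : k `^ p * x `^ (- p) = (k^-1 * x) `^ (- p).
  rewrite powRM ?invr_ge0 ?ltW//; congr (_ * _).
  by rewrite -[k^-1]powR_inv1 ?ltW// -powRrM mulN1r opprK.
apply: powR_antimono => //; first by rewrite mulr_gt0 ?invr_gt0.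
by rewrite mulrC ler_pdivrMr// mulrC.
Qed.

(** It combines [a^2 <= 2 (t + a)^2 + 2 t^2] with [t^2 <= (M / e)^2 h^2]. *)
Lemma lattice_ge (e M H h t a : R) : 0 < e -> 0 <= H -> e * H <= h -> `|t| <= M * H ->
  H ^+ 2 + a ^+ 2 <= ((1 + 2 * M ^+ 2) / e ^+ 2 + 2) * (h ^+ 2 + (t + a) ^+ 2).
Proof.
move=> e0 H0 eh tM.
have h2 : e ^+ 2 * H ^+ 2 <= h ^+ 2.
  by rewrite -exprMn ler_pXn2r// nnegrE ?(le_trans _ eh)// mulr_ge0// ltW.
have t2 : t ^+ 2 <= M ^+ 2 * H ^+ 2.
  rewrite -exprMn -(real_normK (num_real t)) ler_pXn2r// nnegrE//.
  exact: le_trans tM.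
have e2 : 0 < e ^+ 2 by rewrite exprn_gt0.
have k0 : 0 <= (1 + 2 * M ^+ 2) / e ^+ 2.
  by rewrite divr_ge0 ?(ltW e2)// addr_ge0// mulr_ge0// sqr_ge0.
have h3 : (1 + 2 * M ^+ 2) * H ^+ 2 <= (1 + 2 * M ^+ 2) / e ^+ 2 * h ^+ 2.
  rewrite -mulrA ler_wpM2l//; first by rewrite addr_ge0// mulr_ge0// sqr_ge0.
  by rewrite mulrC ler_pdivlMr// mulrC.
have key (T ta MH HH hh aa kh ka : R) : T <= MH -> HH + 2 * MH <= kh -> 0 <= hh ->
    0 <= ka -> 0 <= 4 * T + 4 * ta + aa ->
    HH + aa <= (kh + 2 * hh) + (ka + 2 * (T + 2 * ta + aa)).
  by clear; lra.
have h4 : 0 <= 4 * t ^+ 2 + 4 * (t * a) + a ^+ 2.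
  by have := sqr_ge0 (2 * t + a); congr (_ <= _); ring.
have h5 := mulr_ge0 k0 (sqr_ge0 (t + a)).
have h6 : H ^+ 2 + 2 * (M ^+ 2 * H ^+ 2) <= (1 + 2 * M ^+ 2) / e ^+ 2 * h ^+ 2.
  by apply: le_trans h3; rewrite le_eqVlt; apply/orP; left; apply/eqP; ring.
have := key _ _ _ _ _ _ _ _ t2 h6 (sqr_ge0 h) h5 h4.
move/le_trans; apply; rewrite le_eqVlt; apply/orP; left; apply/eqP; ring.
Qed.

Lemma rsummable_lattice h t p : 0 < h -> 2^-1 < p ->
  rsummable [set: int] (fun a : int => (h ^+ 2 + (t + a%:~R) ^+ 2) `^ (- p)).
Proof.
move=> h0 p1; have p0 : 0 <= p by lra.
pose M := `|t| / h; pose m := Num.min 1 (h ^+ 2).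
have m0 : 0 < m by rewrite lt_min ltr01 exprn_gt0.
pose k := ((1 + 2 * M ^+ 2) / 1 ^+ 2 + 2) / m.
have k0 : 0 < k.
  by rewrite divr_gt0// ltr_wpDl// expr1n divr1 addr_ge0// mulr_ge0// sqr_ge0.
apply: le_rsummable (rsummableZ (k `^ p) (rsummable_int p1)) => a _.
rewrite ger0_norm ?powR_ge0//; apply: powRN_le_scale => //.
  by rewrite ltr_pwDl// sqr_ge0.
rewrite /k mulrAC ler_pdivlMr//.
apply: (@le_trans _ _ (h ^+ 2 + a%:~R ^+ 2)).
  rewrite mulrDl mul1r lerD//; first by rewrite ge_min lexx orbT.
  by rewrite ler_piMr ?sqr_ge0// ge_min lexx.
by apply: lattice_ge; rewrite ?mul1r ?(ltW h0)// divfK// gt_eqF.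
Qed.

Lemma Rintegral_gamma p x : 0 < p -> 0 < x ->
  \int[mu]_(t in pos) (t `^ (p - 1) * expR (- (x * t))) =
  x `^ (- p) * complex.Re (Gamma p%:C).
Proof.
move=> p0 x0; have pp : 0 < complex.Re p%:C by [].
have := congr1 (@complex.Re R) (cintegral_gamma_kernel pp x0).
rewrite -[- p%:C](rmorphN (real_complex R)) cpow_real// ReZ => <-.
apply: eq_Rintegral => t /set_mem; rewrite posE => t0.
by rewrite /gamma_kernel -[p%:C - 1](rmorphB (real_complex R)) cpow_real// -rmorphM.
Qed.

Lemma Gamma_real_ge0 p : 0 < p -> 0 <= complex.Re (Gamma p%:C).
Proof.
move=> p0; have := Rintegral_gamma p0 ltr01; rewrite powR1 mul1r => <-.
by apply: Rintegral_ge0 => t _; rewrite mulr_ge0 ?powR_ge0 ?expR_ge0.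
Qed.

(** Tonelli in the Gaussian parametrization of the lattice sum. *)
Lemma integral_gaussian_sum h t p : 0 < h -> 2^-1 < p ->
  let f tau := (tau `^ (p - 1) * expR (- (h ^+ 2 * tau)) *
     rsum [set: int] (fun a : int => gaussian tau (t + a%:~R)))%:E in
  measurable_fun pos f /\
  ((\int[mu]_(tau in pos) f tau) = (complex.Re (Gamma p%:C))%:E *
     \esum_(a in [set: int]) ((h ^+ 2 + (t + a%:~R) ^+ 2) `^ (- p))%:E)%E.
Proof.
move=> h0 p1 F; have p0 : 0 < p by lra.
pose f (a : int) tau : R := tau `^ (p - 1) * expR (- ((h ^+ 2 + (t + a%:~R) ^+ 2) * tau)).
have hp a : 0 < h ^+ 2 + (t + a%:~R) ^+ 2 by rewrite ltr_pwDl ?sqr_ge0// exprn_gt0.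
have fE a tau : f a tau = tau `^ (p - 1) * expR (- (h ^+ 2 * tau)) * gaussian tau (t + a%:~R).
  by rewrite /f /gaussian -mulrA -expRD; congr (_ * expR _); ring.
have f0 a tau : 0 <= f a tau by rewrite mulr_ge0 ?powR_ge0 ?expR_ge0.
have fi a : mu.-integrable pos (EFin \o f a) by exact: integrable_gamma.
have FE tau : pos tau -> F tau = (\esum_(a in [set: int]) (f a tau)%:E)%E.
  rewrite posE => tau0; rewrite /F -rsumZ rsum_ge0E; last first.
    by move=> a _; rewrite -fE.
  rewrite fineK; first by apply: eq_esum => a _; rewrite fE.
  apply: rsummable_fin => [|a _]; last by rewrite -fE.
  by apply: rsummableZ; exact: rsummable_gauss_shift.
split.
  apply: (@eq_measurable_fun _ _ _ _ pos (fun tau => \esum_(a in [set: int]) (f a tau)%:E)%E).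
    by move=> tau /set_mem ptau; rewrite FE.
  apply: measurable_esum => [a _|a tau _ _]; last by rewrite lee_fin.
  exact: measurable_int (fi a).
transitivity (\int[mu]_(tau in pos) \esum_(a in [set: int]) (f a tau)%:E)%E.
  by apply: eq_integral => tau /set_mem; exact: FE.
rewrite (@integral_esum R _ _ _ mu _ measurable_pos); first last.
- by move=> a x _ _; rewrite lee_fin.
- by move=> a _; exact: measurable_int (fi a).
rewrite -esumZl.
- apply: eq_esum => a _.
  by rewrite (integral_EFinE measurable_pos (fi a)) Rintegral_gamma// -EFinM mulrC.
- exact: Gamma_real_ge0.
- by move=> a _; rewrite lee_fin powR_ge0.
Qed.

End LatticeSums.

Section BesselIntegral.
Variable R : realType.
Local Notation mu := (@lebesgue_measure R).
Local Notation pos := (`]0, +oo[%classic : set R).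
Local Notation Npos := [set n : nat | (0 < n)%N].
Implicit Types (x y t h c p tau : R) (nu s : R[i]).

Definition bessel_kernel nu h c tau : R[i] :=
  cpow tau (nu - 1) * (expR (- (h ^+ 2 * tau + c ^+ 2 / tau)))%:C.

Lemma normc_bessel_kernel nu h c tau : 0 < tau ->
  Normc.normc (bessel_kernel nu h c tau) =
  tau `^ (complex.Re nu - 1) * expR (- (h ^+ 2 * tau)) * expR (- (c ^+ 2 / tau)).
Proof.
move=> tau0; rewrite /bessel_kernel Normc.normcM normc_cpow// normc_real.
by rewrite ger0_norm ?expR_ge0// ReD ReN Re1 -mulrA -expRD opprD.
Qed.

Lemma measurable_pos_inv : measurable_fun pos (fun tau : R => tau^-1).
Proof.
apply: (@eq_measurable_fun _ _ _ _ pos (fun tau => tau `^ (-1))).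
  by move=> tau /set_mem; rewrite posE => tau0; rewrite powR_inv1// ltW.
exact: measurable_funS (measurable_powR _).
Qed.

Lemma measurable_bessel_exp h c :
  measurable_fun pos (fun tau => expR (- (h ^+ 2 * tau + c ^+ 2 / tau))).
Proof.
apply: measurableT_comp; first exact: measurable_expR.
apply: measurableT_comp; first exact: oppr_measurable.
apply: measurable_funD; apply: measurable_funM => //.
exact: measurable_pos_inv.
Qed.

Lemma cmeasurable_bessel_kernel nu h c : cmeasurable pos (bessel_kernel nu h c).
Proof. exact: (cmeasurable_cpow _ (measurable_bessel_exp h c)). Qed.

Lemma cintegrable_bessel_kernel nu h c : 0 < complex.Re nu -> 0 < h ->
  cintegrable pos (bessel_kernel nu h c).
Proof.
move=> nu0 h0; have h2 : 0 < h ^+ 2 by rewrite exprn_gt0.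
apply: (le_cintegrable measurable_pos) (integrable_gamma nu0 h2).
  exact: cmeasurable_bessel_kernel.
move=> tau; rewrite posE => tau0; rewrite normc_bessel_kernel//.
rewrite ler_piMr ?mulr_ge0 ?powR_ge0 ?expR_ge0//.
by rewrite -[leRHS]expR0 ler_expR oppr_le0 divr_ge0 ?sqr_ge0// ltW.
Qed.

(** Rescaling [tau] by [c / h] makes the exponent symmetric under inversion, as
    in the definition of [besselK]. *)
Lemma cintegral_bessel_kernel nu h c : 0 < complex.Re nu -> 0 < h -> 0 < c ->
  cintegral pos (bessel_kernel nu h c) = cpow (c / h) nu * (2 * besselK nu (2 * c * h)).
Proof.
move=> nu0 h0 c0; have ch : 0 < c / h by rewrite divr_gt0.
rewrite (cintegral_scale ch (cintegrable_bessel_kernel c nu0 h0)).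
rewrite /besselK [2 * (2^-1 * _)]mulrA mulfV ?mul1r; last by rewrite pnatr_eq0.
rewrite -[(c / h)%:C](_ : cpow (c / h) 1 = _); last by rewrite (cpow_real 1 ch) powRr1 ?ltW.
pose k : R := Num.sqrt (c * h).
have k2 : k ^+ 2 = c * h by rewrite sqr_sqrtr//; exact: ltW (mulr_gt0 c0 h0).
have k0 : 0 < k by rewrite sqrtr_gt0 mulr_gt0.
rewrite [X in _ = _ * X](eq_cintegral (g := bessel_kernel nu k k)); last first.
  move=> t _; rewrite /bessel_kernel k2; congr (_ * _%:C); congr expR.
  by move: t^-1 => t1; field.
have JE t : pos t -> bessel_kernel nu h c (c / h * t) = cpow (c / h) (nu - 1) * bessel_kernel nu k k t.
  rewrite posE => t0; rewrite /bessel_kernel k2 cpowM// -mulrA; congr (_ * (_ * _%:C)); congr expR.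
  by field; rewrite !gt_eqF.
rewrite (eq_cintegral JE) (cintegralZ measurable_pos _ (cintegrable_bessel_kernel k nu0 k0)) mulrA -cpowD.
by congr (cpow _ _ * _); ring.
Qed.

(** At [t = 0] all the terms of the transformed sum are
    nonnegative, so the Poisson formula bounds the sum of their integrals. This is
    the absolute convergence that allows integrating the sum over the
    frequencies term by term. *)
Lemma esum_bessel_kernel_le nu h p : complex.Re nu = p - 2^-1 -> 2^-1 < p -> 0 < h ->
  (\esum_(n in Npos) \int[mu]_(tau in pos) (Normc.normc (bessel_kernel nu h (pi * n%:R) tau))%:E <=
  (complex.Re (Gamma p%:C))%:E *
     \esum_(a in [set: int]) ((h ^+ 2 + a%:~R ^+ 2) `^ (- p))%:E)%E.
Proof.
move=> nup p1 h0.
have <- : (\esum_(a in [set: int]) ((h ^+ 2 + (0 + a%:~R) ^+ 2) `^ (- p))%:E =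
   \esum_(a in [set: int]) ((h ^+ 2 + a%:~R ^+ 2) `^ (- p))%:E)%E.
  by apply: eq_esum => a _; rewrite add0r.
have [mG eG] := integral_gaussian_sum 0 h0 p1.
have mb n : measurable_fun pos (fun tau => (Normc.normc (bessel_kernel nu h (pi * n%:R) tau))%:E).
  by apply/measurable_EFinP; exact: measurable_normc (cmeasurable_bessel_kernel _ _ _).
rewrite -eG -(@integral_esum R _ _ _ mu _ measurable_pos); first last.
- by move=> n tau _ _; rewrite lee_fin normc_ge0.
- by move=> n _; exact: mb.
apply: ge0_le_integral => //.
- by move=> tau _; apply: esum_ge0 => n _; rewrite lee_fin normc_ge0.
- by apply: measurable_esum => [n _|n tau _ _]; [exact: mb|rewrite lee_fin normc_ge0].
move=> tau; rewrite posE => tau0.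
pose E (n : nat) : R := expR (- (pi ^+ 2 * n%:R ^+ 2 / tau)).
pose w : R := tau `^ (p - 2^-1 - 1) * expR (- (h ^+ 2 * tau)).
have w0 : 0 <= w by rewrite mulr_ge0 ?powR_ge0 ?expR_ge0.
have sE : rsummable Npos E.
  have x0 : 0 < pi ^+ 2 / tau by rewrite divr_gt0// exprn_gt0// pi_gt0.
  apply: eq_rsummable (rsummable_gauss_nat Npos x0) => n _.
  by rewrite /E; congr expR; ring.
rewrite (_ : esum _ _ = (w * rsum Npos E)%:E); last first.
  rewrite (rsum_ge0E (f := E)) => [|n _]; last exact: expR_ge0.
  rewrite EFinM fineK; last by apply: rsummable_fin => // n _; exact: expR_ge0.
  rewrite -esumZl//; last by move=> n _; rewrite lee_fin expR_ge0.
  apply: eq_esum => n _; rewrite -EFinM normc_bessel_kernel// nup.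
  by rewrite exprMn.
rewrite lee_fin (gaussian_poisson 0 tau0).
have -> : rsum Npos (fun n => expR (- (pi ^+ 2 * n%:R ^+ 2 / tau)) * (2 * cos (2 * pi * (n%:R * 0)))) = 2 * rsum Npos E.
  by rewrite -rsumZ; apply: eq_rsum => n _; rewrite !mulr0 cos0 mulr1 mulrC.
have -> : tau `^ (p - 1) = tau `^ (p - 2^-1 - 1) * tau `^ 2^-1.
  rewrite -powRD; last by rewrite (gt_eqF tau0) implybT.
  by congr (_ `^ _); field.
have -> : Num.sqrt (pi / tau) = Num.sqrt pi * tau `^ (- 2^-1).
  by rewrite sqrtrM ?pi_ge0// sqrtrV ?ltW// powRN powR12_sqrt// ltW.
set S := rsum Npos E.
have S0 : 0 <= S by rewrite /S rsum_ge0E ?fine_ge0 ?esum_ge0// => n _; rewrite ?lee_fin expR_ge0.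
have -> : tau `^ (p - 2^-1 - 1) * tau `^ 2^-1 * expR (- (h ^+ 2 * tau)) *
    (Num.sqrt pi * tau `^ (- 2^-1) * (1 + 2 * S)) =
    w * (Num.sqrt pi * (1 + 2 * S)) * (tau `^ 2^-1 * tau `^ (- 2^-1)).
  by rewrite /w; ring.
rewrite powRN mulfV ?mulr1; last by rewrite gt_eqF// powR_gt0.
rewrite ler_wpM2l//; apply: (@le_trans _ _ (1 + 2 * S)); first lra.
rewrite ler_peMl//; first by rewrite addr_ge0// mulr_ge0.
by rewrite -[leLHS]sqrtr1 ler_sqrt ?pi_ge0// (le_trans _ (pi_ge2 _))// ler1n.
Qed.

End BesselIntegral.

Section LatticeFourier.
Variable R : realType.
Local Notation mu := (@lebesgue_measure R).
Local Notation pos := (`]0, +oo[%classic : set R).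
Local Notation Npos := [set n : nat | (0 < n)%N].
Implicit Types (x y t tau : R).

Lemma csum_real (T : choiceType) (D : set T) (f : T -> R) :
  csum D (fun i => (f i)%:C) = (rsum D f)%:C.
Proof.
rewrite /csum /=; congr (_ +i* _).
rewrite -[RHS](mul0r (rsum D f)) -rsumZ; apply: eq_rsum => i _.
by rewrite mul0r.
Qed.

Variables (h t : R) (s : R[i]).
Hypotheses (h0 : 0 < h) (s1 : 2^-1 < complex.Re s).
Local Notation nu := (s - 2^-1).
Local Notation p := (complex.Re s).

Let x (a : int) : R := h ^+ 2 + (t + a%:~R) ^+ 2.

Let x0 a : 0 < x a.
Proof. by rewrite /x ltr_pwDl ?sqr_ge0// exprn_gt0. Qed.

Let p0 : 0 < p. Proof. by have : 0 < 2^-1 :> R by []; move: s1; lra. Qed.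

Let nuE : complex.Re nu = p - 2^-1.
Proof.
rewrite ReD ReN; congr (_ - _).
by rewrite -(rmorph_nat (real_complex R)) -fmorphV.
Qed.

Let nu0 : 0 < complex.Re nu.
Proof. by rewrite nuE subr_gt0. Qed.

Definition lattice_term (a : int) : R[i] := cpow (h ^+ 2 + (t + a%:~R) ^+ 2) (- s).

(** [psi0_fourier_term] depends on [z] and [l] only through the height [h] and
    the trace [t]. *)
Definition bessel_term (n : nat) : R[i] :=
  cpow (n%:R / h) nu * besselK nu (2 * pi * n%:R * h) *
  (e2pi (n%:R * t)%:C + e2pi (- (n%:R * t)%:C)).

Let B (n : nat) := bessel_kernel nu h (pi * n%:R).
Let c0 : R[i] := 2^-1 * cpow pi (- nu).
Let wave (n : nat) : R := 2 * cos (2 * pi * (n%:R * t)).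

Lemma csummable_lattice : csummable [set: int] lattice_term.
Proof.
apply: le_csummable (rsummable_lattice t h0 s1) => a _.
by rewrite normc_cpow ?ReN// ltr_pwDl ?sqr_ge0// exprn_gt0.
Qed.

Let iB n : cintegrable pos (B n).
Proof. exact: cintegrable_bessel_kernel. Qed.

Let bessel_termE n : Npos n -> bessel_term n = c0 * ((wave n)%:C * cintegral pos (B n)).
Proof.
move=> /= n0; have n1 : 0 < n%:R :> R by rewrite ltr0n.
have pn : 0 < pi * n%:R :> R by rewrite mulr_gt0// pi_gt0.
rewrite /bessel_term e2piDN -/(wave n) /B cintegral_bessel_kernel//.
rewrite -[pi * _ / h]mulrA cpowM ?pi_gt0 ?divr_gt0//.
have -> : 2 * (pi * n%:R) * h = 2 * pi * n%:R * h by ring.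
rewrite /c0 cpowV.
by field; rewrite cpow_neq0.
Qed.

(** The bound is uniform in [t] and, apart from the lattice sum, in [h]: it
    governs the sum over [Lambda_plus] too. *)
Lemma esum_bessel_term_le :
  (\esum_(n in Npos) (Normc.normc (bessel_term n))%:E <=
   (4 * Normc.normc c0 * complex.Re (Gamma p%:C))%:E *
   \esum_(a in [set: int]) ((h ^+ 2 + a%:~R ^+ 2) `^ (- p))%:E)%E.
Proof.
have c00 : 0 <= 4 * Normc.normc c0 by rewrite mulr_ge0// normc_ge0.
rewrite EFinM -muleA.
apply: (@le_trans _ _ ((4 * Normc.normc c0)%:E *
  \esum_(n in Npos) \int[mu]_(tau in pos) (Normc.normc (B n tau))%:E)%E); last first.
  by apply: lee_wpmul2l; [rewrite lee_fin|exact: esum_bessel_kernel_le].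
rewrite -esumZl//; last by move=> n _; apply: integral_ge0 => tau _; rewrite lee_fin normc_ge0.
apply: le_esum => n Npn; rewrite bessel_termE//; move: (c0) c00 => k k0.
have inB : mu.-integrable pos (EFin \o (fun tau => Normc.normc (B n tau))).
  exact: cintegrable_normc.
rewrite (integral_EFinE measurable_pos inB) -EFinM lee_fin !Normc.normcM normc_real.
have := normc_cintegral_le measurable_pos (iB n) (fun _ _ => lexx _) inB.
set b := Normc.normc _; set I := Rintegral _ _ _ => bI.
have w2 : `|wave n| <= 2.
  by rewrite /wave normrM ger0_norm// ler_piMr// cos_max.
have := ler_pM (normr_ge0 _) (normc_ge0 _) w2 bI.
have -> : 4 * Normc.normc k * I = Normc.normc k * (2 * (2 * I)) by ring.
by move=> h1; rewrite ler_wpM2l ?normc_ge0.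
Qed.

Let Gamma_ge0 : 0 <= complex.Re (Gamma p%:C) := Gamma_real_ge0 p0.

Let fin0 : ((complex.Re (Gamma p%:C))%:E *
   (\esum_(a in [set: int]) ((h ^+ 2 + a%:~R ^+ 2) `^ (- p))%:E) < +oo)%E.
Proof.
have := rsummable_lattice 0 h0 s1; rewrite ge0_rsummable => [sl|a _]; last exact: powR_ge0.
rewrite lte_mul_pinfty//.
by apply: le_lt_trans sl; apply: le_esum => a _; rewrite add0r.
Qed.

Lemma csummable_bessel : csummable Npos bessel_term.
Proof.
rewrite csummableE ge0_rsummable => [|n _]; last exact: normc_ge0.
apply: (le_lt_trans esum_bessel_term_le).
by rewrite EFinM -muleA lte_mul_pinfty// lee_fin mulr_ge0// normc_ge0.
Qed.

Let wB n tau : R[i] := cpow tau (nu - 1) *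
  (wave n * expR (- (h ^+ 2 * tau + (pi * n%:R) ^+ 2 / tau)))%:C.

Let wBE n tau : wB n tau = (wave n)%:C * B n tau.
Proof. by rewrite /wB /B /bessel_kernel rmorphM; ring. Qed.

Let mwB n : cmeasurable pos (wB n).
Proof.
have mw : measurable_fun pos (fun tau => wave n * expR (- (h ^+ 2 * tau + (pi * n%:R) ^+ 2 / tau))).
  by apply: measurable_funM => //; exact: measurable_bessel_exp.
exact: (cmeasurable_cpow _ mw).
Qed.

Let wave_le n : `|wave n| <= 2.
Proof. by rewrite /wave normrM ger0_norm// ler_piMr// cos_max. Qed.

Let normc_wB n tau : Normc.normc (wB n tau) <= 2 * Normc.normc (B n tau).
Proof. by rewrite wBE Normc.normcM normc_real ler_wpM2r ?normc_ge0. Qed.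

Let csum_wB tau : 0 < tau -> csummable Npos (wB ^~ tau).
Proof.
move=> tau0; have q0 : 0 < pi ^+ 2 / tau by rewrite divr_gt0// exprn_gt0// pi_gt0.
pose w := 2 * (tau `^ (complex.Re nu - 1) * expR (- (h ^+ 2 * tau))).
apply: le_csummable (rsummableZ w (rsummable_gauss_nat Npos q0)) => n _.
apply: le_trans (normc_wB _ _) _; rewrite normc_bessel_kernel//.
have -> : pi ^+ 2 / tau * n%:R ^+ 2 = (pi * n%:R) ^+ 2 / tau by ring.
by rewrite /w !mulrA.
Qed.

Let csum_gamma tau : 0 < tau -> csummable [set: int] (fun a => gamma_kernel s (x a) tau).
Proof.
move=> tau0; pose w := tau `^ (p - 1) * expR (- (h ^+ 2 * tau)).
apply: le_csummable (rsummableZ w (rsummable_gauss_shift t tau0)) => a _.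
rewrite normc_gamma_kernel// /w -mulrA -expRD -opprD /x.
by rewrite le_eqVlt; apply/orP; left; apply/eqP; congr (_ * expR (- _)); ring.
Qed.

(** Poisson summation under the integral sign. *)
Let theta tau : pos tau ->
  csum [set: int] (fun a => gamma_kernel s (x a) tau) =
  (Num.sqrt pi)%:C * (gamma_kernel nu (h ^+ 2) tau + csum Npos (wB ^~ tau)).
Proof.
rewrite posE => tau0.
pose E (n : nat) : R := expR (- (pi ^+ 2 * n%:R ^+ 2 / tau)) * wave n.
pose w : R := expR (- (h ^+ 2 * tau)).
have sE : rsummable Npos E.
  have q0 : 0 < pi ^+ 2 / tau by rewrite divr_gt0// exprn_gt0// pi_gt0.
  apply: le_rsummable (rsummableZ 2 (rsummable_gauss_nat Npos q0)) => n _.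
  rewrite /E normrM ger0_norm ?expR_ge0// mulrC [_ / tau]mulrAC.
  by rewrite ler_wpM2r ?expR_ge0.
have creal (T : choiceType) (D : set T) (f : T -> R) : rsummable D f -> csummable D (fun i => (f i)%:C).
  by move=> sf; apply: le_csummable (rsummable_norm sf) => i _; rewrite normc_real.
have e1 a : gamma_kernel s (x a) tau = (cpow tau (s - 1) * w%:C) * (gaussian tau (t + a%:~R))%:C.
  rewrite /gamma_kernel -mulrA -rmorphM; congr (_ * _%:C).
  by rewrite /w /gaussian -expRD; congr expR; rewrite /x; ring.
have e2 n : wB n tau = (cpow tau (nu - 1) * w%:C) * (E n)%:C.
  rewrite /wB -mulrA -rmorphM; congr (_ * _%:C).
  by rewrite opprD expRD exprMn /w /E; ring.
rewrite (eq_csum (fun a _ => e1 a)) (eq_csum (fun n _ => e2 n)) !csumZ; first last.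
- exact/creal/rsummable_gauss_shift.
- exact: creal.
rewrite !csum_real (gaussian_poisson t tau0).
have -> : gamma_kernel nu (h ^+ 2) tau = cpow tau (nu - 1) * w%:C by [].
have -> : Num.sqrt (pi / tau) = Num.sqrt pi * tau `^ (- 2^-1).
  by rewrite sqrtrM ?pi_ge0// sqrtrV ?ltW// powRN powR12_sqrt// ltW.
have -> : cpow tau (nu - 1) = cpow tau (s - 1) * (tau `^ (- 2^-1))%:C.
  rewrite -cpow_real// -cpowD; congr cpow.
  by rewrite rmorphN fmorphV rmorph_nat; ring.
rewrite !rmorphM rmorphD rmorph1 -/(rsum Npos E); ring.
Qed.

Let half : (Num.sqrt pi)%:C = cpow pi 2^-1 :> R[i].
Proof.
have -> : 2^-1 = (2^-1 : R)%:C :> R[i] by rewrite fmorphV rmorph_nat.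
by rewrite cpow_real ?pi_gt0// powR12_sqrt// pi_ge0.
Qed.

Let sum_gamma :
  Gamma s * csum [set: int] lattice_term =
  cintegral pos (fun tau => csum [set: int] (fun a => gamma_kernel s (x a) tau)).
Proof.
rewrite -(csumZ (Gamma s) csummable_lattice).
rewrite (eq_csum (g := fun a => cintegral pos (gamma_kernel s (x a)))); last first.
  by move=> a _; rewrite cintegral_gamma_kernel// mulrC.
have [|||ig ->//] := @csum_cintegral R pos measurable_pos _ [set: int] (fun a => gamma_kernel s (x a)).
- by move=> a _; exact: cmeasurable_gamma_kernel.
- by move=> tau; rewrite posE; exact: csum_gamma.
have := rsummableZ (complex.Re (Gamma p%:C)) (rsummable_lattice t h0 s1).
rewrite ge0_rsummable => [|a _]; last by rewrite mulr_ge0 ?powR_ge0.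
apply: le_lt_trans; apply: le_esum => a _.
rewrite mulrC -(Rintegral_gamma p0 (x0 a)).
rewrite -(integral_EFinE measurable_pos (integrable_gamma p0 (x0 a))).
rewrite le_eqVlt; apply/orP; left; apply/eqP; apply: eq_integral => tau /set_mem.
by rewrite posE => tau0; rewrite normc_gamma_kernel.
Qed.

Let sum_bessel :
  [/\ cintegrable pos (fun tau => csum Npos (wB ^~ tau)) &
      c0 * cintegral pos (fun tau => csum Npos (wB ^~ tau)) = csum Npos bessel_term].
Proof.
have [|||ig e] := @csum_cintegral R pos measurable_pos _ Npos wB.
- by move=> n _; exact: mwB.
- by move=> tau; rewrite posE; exact: csum_wB.
- have : (2%:E * ((complex.Re (Gamma p%:C))%:E *
    \esum_(a in [set: int]) ((h ^+ 2 + a%:~R ^+ 2) `^ (- p))%:E) < +oo)%E.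
    by rewrite lte_mul_pinfty.
  apply: le_lt_trans.
  apply: (@le_trans _ _ (2%:E * \esum_(n in Npos) \int[mu]_(tau in pos) (Normc.normc (B n tau))%:E)%E); last first.
    by apply: lee_wpmul2l => //; exact: esum_bessel_kernel_le.
  rewrite -esumZl//; last by move=> n _; apply: integral_ge0 => tau _; rewrite lee_fin normc_ge0.
  apply: le_esum => n _.
  have mB : measurable_fun pos (fun tau => (Normc.normc (B n tau))%:E).
    by apply/measurable_EFinP; exact: measurable_normc (cmeasurable_bessel_kernel _ _ _).
  rewrite -ge0_integralZl//; last by move=> tau _; rewrite lee_fin normc_ge0.
  apply: ge0_le_integral => //.
  + by move=> tau _; rewrite lee_fin normc_ge0.
  + by apply/measurable_EFinP; exact: measurable_normc (mwB n).
  + exact: emeasurable_funM.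
  + by move=> tau _; rewrite -EFinM lee_fin.
have iw n : cintegral pos (wB n) = (wave n)%:C * cintegral pos (B n).
  by rewrite -(cintegralZ measurable_pos _ (iB n)); apply: eq_cintegral => tau _; exact: wBE.
have eb n : Npos n -> bessel_term n = c0 * cintegral pos (wB n) by move=> Nn; rewrite iw -bessel_termE.
have c0n : c0 != 0 by rewrite mulf_neq0 ?cpow_neq0// invr_eq0 pnatr_eq0.
split=> //; rewrite -e (eq_csum eb) csumZ//.
apply: eq_csummable (csummableZ c0^-1 csummable_bessel) => n Nn.
by rewrite eb// mulKf.
Qed.

(** Multiplied by [Gamma s], this is [theta] integrated over the half-line. *)
Theorem lattice_fourier :
  csum [set: int] lattice_term =
  Beta 2^-1 nu * cpow h (1 - 2 * s) + 2 * cpow pi s / Gamma s * csum Npos bessel_term.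
Proof.
have Gs : Gamma s != 0 by exact: Gamma_neq0.
have h2 : 0 < h ^+ 2 by rewrite exprn_gt0.
have [iw eb] := sum_bessel; have ig := cintegrable_gamma_kernel nu0 h2.
apply: (mulfI Gs); rewrite sum_gamma (eq_cintegral theta).
rewrite (cintegralZ measurable_pos _ (cintegrableD measurable_pos ig iw)).
rewrite cintegralD// cintegral_gamma_kernel// -eb.
rewrite /Beta Gamma_half half cpow_sqr//.
have -> : 2^-1 + nu = s by ring.
have -> : 2 * - nu = 1 - 2 * s by field.
have -> : cpow pi s = cpow pi 2^-1 * cpow pi nu by rewrite -cpowD; congr cpow; ring.
rewrite /c0 cpowV.
by field; rewrite cpow_neq0.
Qed.

End LatticeFourier.

(** * Separation of the solutions of the norm equation *)

Section QuadraticNorm.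
Variables (K : fieldExtType rat) (sigma : {rmorphism K -> K}).
Hypotheses (hK : \dim {:K} = 2%N) (hsigma : is_conjugation sigma).
Implicit Types (x y : K) (r : rat).

Lemma rmorph_rat_alg r : sigma r%:A = r%:A.
Proof. by rewrite alg_num_field fmorph_rat. Qed.

Lemma quadratic_basis x : sigma x != x ->
  forall y, exists u v : rat, y = u%:A + v *: x.
Proof.
move=> sx y.
have nx : x \notin <[1]>%VS.
  by apply/negP => /vlineP[r xr]; move: sx; rewrite xr rmorph_rat_alg eqxx.
have full : (<[1]> + <[x]>)%VS = fullv.
  apply/eqP; rewrite eqEdim subvf/= hK leqNgt; apply/negP => d2.
  have le : (<[1]> <= <[1]> + <[x]>)%VS := addvSl _ _.
  have := dimv_leqif_eq le => -[le2 e].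
  move: le2 e; rewrite dim_vline oner_eq0/= => le2.
  have -> : \dim (<[1]> + <[x]>) = 1%N by apply/eqP; rewrite eqn_leq le2 -ltnS d2.
  rewrite eqxx => /esym/eqP e; move: nx; rewrite e.
  by move=> /negP; apply; apply: (subvP (addvSr _ _)); exact: memv_line.
have : y \in (<[1]> + <[x]>)%VS by rewrite full memvf.
move=> /memv_addP[_ /vlineP[u ->]] [_ /vlineP[v ->]] ->.
by exists u, v.
Qed.

(** The norm of [u + v x] is a polynomial in [u], [v] and the coefficients of
    the quadratic equation of [x]. *)
Lemma qnorm_rat y : exists r, qnorm sigma y = ratr r.
Proof.
have [x sx] := hsigma.
have [b [a xx]] := quadratic_basis sx (x ^+ 2).
have [u [v ->]] := quadratic_basis sx y.
have sZ r z : sigma (r *: z) = r *: sigma z.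
  by rewrite -[r *: z]mulr_algl rmorphM rmorph_rat_alg mulr_algl.
(* [x] and its conjugate are the two roots of the same quadratic equation *)
have tr : sigma x = a%:A - x.
  have sxx : sigma x ^+ 2 = b%:A + a *: sigma x.
    by rewrite -rmorphXn xx rmorphD/= rmorph_rat_alg sZ.
  have : (sigma x - x) * (sigma x + x - a%:A) = 0.
    rewrite mulrBr -subr_sqr sxx xx mulrC mulr_algl scalerBr.
    by rewrite opprD addrACA subrr add0r subrr.
  move=> /eqP; rewrite mulf_eq0 subr_eq0 (negbTE sx)/= subr_eq0 => /eqP <-.
  by rewrite addrK.
exists (u ^+ 2 + u * v * a - v ^+ 2 * b).
rewrite /qnorm rmorphD/= rmorph_rat_alg sZ tr -alg_num_field.
have -> : (u ^+ 2 + u * v * a - v ^+ 2 * b)%:A =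
    u%:A ^+ 2 + u%:A * v%:A * a%:A - v%:A ^+ 2 * b%:A :> K.
  by rewrite -!(in_algE K) !(rmorphD, rmorphN, rmorphM, rmorphXn).
rewrite -[v *: x]mulr_algl -[v *: (_ - _)]mulr_algl.
have -> : b%:A = x ^+ 2 - a%:A * x by rewrite xx mulr_algl addrK.
by ring.
Qed.

(** The monic equation is transported from [K] to the algebraic numbers through
    the rationals. *)
Lemma integral_rat_int r : integralOver (intr : int -> K) (ratr r) ->
  exists n : int, r = n%:~R.
Proof.
move=> [p mp rp].
have rp2 : root (map_poly intr p) r.
  move: rp; rewrite -alg_num_field -(in_algE K) => rp.
  rewrite -(fmorph_root (in_alg K)) -map_poly_comp.
  rewrite (eq_map_poly (g := (intr : int -> K)))// => n /=.
  by rewrite -(in_algE K) rmorph_int.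
have : ratr r \in Aint.
  apply: (@root_monic_Aint (map_poly intr p)).
  - rewrite (_ : map_poly intr p = map_poly ratr (map_poly intr p : {poly rat})); last first.
      by rewrite -map_poly_comp; apply: eq_map_poly => n /=; rewrite rmorph_int.
    by rewrite fmorph_root.
  - exact: monic_map.
  - by apply/polyOverP => i; rewrite coef_map /= intr_int.
move=> /(Cint_rat_Aint (Crat_rat r)) /intrP[n rn]; exists n.
by move: rn; rewrite -(ratr_int algC) => /fmorph_inj.
Qed.

Lemma integral_conj x : ring_of_integers x -> ring_of_integers (sigma x).
Proof.
move=> [p mp rp]; exists p => //.
rewrite (eq_map_poly (g := sigma \o (intr : int -> K))); last first.
  by move=> n /=; rewrite rmorph_int.
by rewrite map_poly_comp fmorph_root.
Qed.

Lemma norm_qnorm_ge1 (R : realType) (iota : {rmorphism K -> R}) x :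
  ring_of_integers x -> x != 0 -> 1 <= `|iota (qnorm sigma x)|.
Proof.
move=> xO x0; have [r nr] := qnorm_rat x.
have [|n rn] := @integral_rat_int r.
  by rewrite -nr; apply: integral_mul => //; exact: integral_conj.
have : qnorm sigma x != 0 by rewrite mulf_neq0// fmorph_eq0.
rewrite nr rn -alg_num_field -(in_algE K) rmorph_int => nz.
have n0 : n != 0 by apply: contraNneq nz => ->.
by rewrite rmorph_int -intr_norm -[1]/(1%:~R) ler_int -gtz0_ge1 normr_gt0.
Qed.

End QuadraticNorm.

Section LambdaPlus.
Variables (R : realType) (K : fieldExtType rat).
Variables (iota : {rmorphism K -> R}) (sigma : {rmorphism K -> K}).
Hypotheses (hK : \dim {:K} = 2%N) (hsigma : is_conjugation sigma).
Variables (D : int) (a : set K) (m : nat).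
Hypotheses (hD : has_discriminant sigma D) (ha : fractional_ideal a).
Implicit Types x l : K.

Local Notation L := (Lambda_plus iota sigma D a m).
Local Notation c := (m%:R * ideal_norm iota sigma a / D%:~R).

Lemma discriminant_ge0 : 0 <= D%:~R :> R.
Proof.
have [w [_ Dw]] := hD.
by rewrite -(rmorph_int iota) Dw rmorphXn/= sqr_ge0.
Qed.

Lemma ring_of_integers_sum n (f : 'I_n -> K) :
  (forall i, ring_of_integers (f i)) -> ring_of_integers (\sum_i f i).
Proof.
move=> fO; apply: big_ind => [||i _]; last exact: fO.
- exact: mxpoly.integral0.
- by move=> x y; exact: integral_add.
Qed.

(** A denominator of [a] times the square root of [D], which lies in [K] as it
    is [conj_det w] up to sign. *)
Lemma scaled_dual_integral : D != 0 -> exists2 b, b != 0 &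
  forall x, ideal_mul a (ideal_inv (different iota D)) x -> ring_of_integers (b * x).
Proof.
move=> D0; have [_ _ _ [e e0 eO]] := ha; have [w [_ Dw]] := hD.
have w0 : conj_det sigma w != 0.
  apply: contraNneq D0 => w0; move: Dw; rewrite w0 expr0n/= => D0.
  have : D%:~R = 0 :> R by rewrite -(rmorph_int iota) D0 rmorph0.
  by move=> /eqP; rewrite intr_eq0.
have [d d0 dsqrt] : exists2 d, d != 0 & iota d = Num.sqrt (D%:~R : R).
  have e2 : Num.sqrt (D%:~R : R) = `|iota (conj_det sigma w)|.
    by rewrite -(rmorph_int iota) Dw rmorphXn sqrtr_sqr.
  have [p|n] := lerP 0 (iota (conj_det sigma w)).
    by exists (conj_det sigma w) => //; rewrite e2 ger0_norm.
  exists (- conj_det sigma w); first by rewrite oppr_eq0.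
  by rewrite e2 rmorphN ltr0_norm.
exists (e * d); first by rewrite mulf_neq0.
move=> _ [n [u [v [ua va ->]]]]; rewrite mulr_sumr; apply: ring_of_integers_sum => i.
have -> : e * d * (u i * v i) = (e * u i) * (v i * d) by ring.
apply: integral_mul; first exact: eO.
apply: va; exists 1; first exact: integral1.
by rewrite dsqrt rmorph1 mulr1.
Qed.

(** An element of [L] forces [D != 0]: otherwise its norm would be a quotient
    by zero, that is 0, although the element is positive. *)
Lemma Lambda_plusP l : L l ->
  [/\ D != 0, 0 < c, 0 < iota l & iota (sigma l) = - (c / iota l)].
Proof.
move=> [_ nl l0].
have e : iota (sigma l) = - (c / iota l).
  apply: (mulfI (lt0r_neq0 l0)); rewrite -rmorphM -/(qnorm sigma l) nl.
  by rewrite mulrN mulrCA divff ?mulr1// gt_eqF.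
have c0 : 0 <= c.
  by rewrite divr_ge0 ?mulr_ge0 ?discriminant_ge0// /ideal_norm normr_ge0.
have cn0 : c != 0.
  apply/eqP => c00; move: e; rewrite c00 mul0r oppr0 => /eqP.
  rewrite !fmorph_eq0 => /eqP ll; move: l0; rewrite ll rmorph0 ltxx//.
split=> //; last by rewrite lt0r cn0.
by apply: contraNneq cn0 => ->; rewrite invr0 mulr0.
Qed.

(** Integers of norm smaller than one vanish, so distinct elements of the
    ideal have differences of norm bounded below; on the hyperbola of fixed
    norm this norm is a multiple of [(p - q) ^+ 2 / (p * q)]. *)
Lemma Lambda_plus_separated : exists2 d : R, 0 < d & forall l1 l2, L l1 -> L l2 ->
  l1 != l2 -> d <= (iota l1 - iota l2) ^+ 2 / (iota l1 * iota l2).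
Proof.
have [L0|/set0P[l0 Ll0]] := eqVneq L set0.
  by exists 1 => // l1 l2; rewrite L0.
have [D0 c0 _ _] := Lambda_plusP Ll0.
have [b b0 bO] := scaled_dual_integral D0.
have qb0 : 0 < `|iota (qnorm sigma b)|.
  by rewrite normr_gt0 fmorph_eq0 mulf_neq0// fmorph_eq0.
exists (c * `|iota (qnorm sigma b)|)^-1; first by rewrite invr_gt0; exact: mulr_gt0.
move=> l1 l2 L1 L2 l12.
have [_ _ p1 s1] := Lambda_plusP L1; have [_ _ p2 s2] := Lambda_plusP L2.
have [I1 _ _] := L1; have [I2 _ _] := L2.
have : ring_of_integers (b * (l1 - l2)).
  by rewrite mulrBr; apply: integral_sub; exact: bO.
move=> /(norm_qnorm_ge1 hK hsigma iota)/(_ _).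
rewrite mulf_neq0 ?subr_eq0// => /(_ isT).
have -> : qnorm sigma (b * (l1 - l2)) = qnorm sigma b * qnorm sigma (l1 - l2).
  by rewrite /qnorm rmorphM; ring.
rewrite rmorphM normrM.
have -> : iota (qnorm sigma (l1 - l2)) = c * ((iota l1 - iota l2) ^+ 2 / (iota l1 * iota l2)).
  rewrite /qnorm rmorphM !rmorphB/= s1 s2.
  move: c (iota l1) (iota l2) p1 p2 => k p q p1 p2.
  by field; rewrite !gt_eqF.
set z := _ / (_ * _) => h; have z0 : 0 <= z by rewrite divr_ge0 ?sqr_ge0// mulr_ge0// ltW.
rewrite -[leLHS]mul1r ler_pdivrMr; last exact: mulr_gt0.
move: h; rewrite (ger0_norm (mulr_ge0 (ltW c0) z0)) => h.
suff -> : z * (c * `|iota (qnorm sigma b)|) = `|iota (qnorm sigma b)| * (c * z) by [].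
by move: c => k; ring.
Qed.

End LambdaPlus.

Section Hyperbola.
Variables (R : realType) (T : choiceType) (L : set T) (f : T -> R) (d c : R).
Hypotheses (d0 : 0 < d) (c0 : 0 < c) (f0 : forall l, L l -> 0 < f l).
Hypothesis fd : forall l1 l2, L l1 -> L l2 -> l1 != l2 ->
  d <= (f l1 - f l2) ^+ 2 / (f l1 * f l2).

Let eta : R := Num.min 1 (d / expR 1).

Let eta0 : 0 < eta.
Proof. by rewrite lt_min ltr01 divr_gt0// expR_gt0. Qed.

(** With [u = ln (f l1) - ln (f l2)] the separation reads
    [d <= 2 cosh u - 2], and the right-hand side is at most [|u| e] when
    [|u| <= 1]. *)
Lemma ln_separated l1 l2 : L l1 -> L l2 -> l1 != l2 -> eta <= `|ln (f l1) - ln (f l2)|.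
Proof.
move=> L1 L2 l12; have := fd L1 L2 l12.
have p1 := f0 L1; have p2 := f0 L2; set u := ln (f l1) - ln (f l2).
have -> : (f l1 - f l2) ^+ 2 / (f l1 * f l2) = expR u + expR (- u) - 2.
  rewrite /u opprB !expRD !expRN !lnK ?posrE//.
  by field; rewrite !gt_eqF.
have /andP[_ h] := expR_second_difference u => /le_trans/(_ h) du.
rewrite leNgt; apply/negP; rewrite lt_min => /andP[u1 ud].
move: ud; rewrite ltr_pdivlMr ?expR_gt0// ltNge => /negP; apply.
apply: (le_trans du); rewrite -(real_normK (num_real u)) expr2 -mulrA ler_wpM2l//.
apply: (@le_trans _ _ (1 * expR 1)); last by rewrite mul1r.
by apply: ler_pM; rewrite ?expR_ge0// ?ler_expR ltW.
Qed.

Let k (l : T) : int := Num.floor (ln (f l) / eta).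

Let k_inj : {in L &, injective k}.
Proof.
move=> l1 l2 /set_mem L1 /set_mem L2 k12; apply/eqP/negPn/negP => l12.
have := ln_separated L1 L2 l12; apply/negP; rewrite -ltNge.
have := floor_itv (ln (f l1) / eta); have := floor_itv (ln (f l2) / eta).
rewrite -/(k l1) -/(k l2) k12 !intrD => /andP[h1 h2] /andP[h3 h4].
rewrite -[X in _ < X]mul1r -ltr_pdivrMr// -[X in _ / X](gtr0_norm eta0) -normrV ?unitfE ?gt_eqF//.
rewrite -normrM mulrBl ltr_norml; apply/andP; split; lra.
Qed.

(** The logarithms of the abscissae of the points of [L] on the hyperbola are
    separated, hence the sizes of these points grow exponentially. *)
Lemma rsummable_hyperbola e : 0 < e -> rsummable L (fun l => (f l + c / f l) `^ (- e)).
Proof.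
move=> e0; pose b := Num.min 1 c; pose z := e * eta; pose w := Num.min 1 (z ^+ 2).
have z0 : 0 < z by rewrite mulr_gt0.
have b0 : 0 < b by rewrite lt_min ltr01.
have w0 : 0 < w by rewrite lt_min ltr01 exprn_gt0.
pose g (n : int) : R := (b `^ (- e) * expR z / w) * (1 + n%:~R ^+ 2) `^ (- 1).
have g0 n : 0 <= g n.
  by rewrite mulr_ge0 ?powR_ge0// divr_ge0 ?(ltW w0)// mulr_ge0 ?powR_ge0 ?expR_ge0.
have sg : rsummable [set: int] g.
  by apply: rsummableZ; apply: rsummable_int; rewrite invf_lt1// ltr1n.
apply: (@le_rsummable _ _ _ _ (g \o k)); last first.
  rewrite ge0_rsummable => [|l _]; last exact: g0.
  have -> : (\esum_(l in L) (g (k l))%:E = \esum_(n in k @` L) (g n)%:E)%E.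
    rewrite esum_image//; exact: k_inj.
  have := subset_rsummable (@subsetT _ (k @` L)) sg.
  by rewrite ge0_rsummable.
move=> l Ll; rewrite ger0_norm ?powR_ge0//=.
have p := f0 Ll; set y := ln (f l).
have fE : f l = expR y by rewrite lnK.
have Hy : b * expR `|y| <= f l + c / f l.
  have cf : c / f l = c * expR (- y) by rewrite fE expRN.
  have b1 : b <= 1 by rewrite ge_min lexx.
  have bc : b <= c by rewrite ge_min lexx orbT.
  have [y0|y0] := lerP 0 y.
    apply: (@le_trans _ _ (f l)); first by rewrite (ger0_norm y0) fE ler_piMl ?expR_ge0.
    by rewrite lerDl divr_ge0// ltW.
  apply: (@le_trans _ _ (c / f l)); last by rewrite lerDr ltW.
  by rewrite (ltr0_norm y0) cf; apply: ler_wpM2r => //; exact: expR_ge0.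
have Hk : `|(k l)%:~R| - 1 <= `|y| / eta.
  have := floor_itv (y / eta); rewrite -/(k l) intrD => /andP[h1 h2].
  rewrite -[X in _ / X](gtr0_norm eta0) -normrV ?unitfE ?gt_eqF// -normrM.
  rewrite lerBlDr ler_norml; have := ler_norm (y / eta); have := ler_norm (- (y / eta)).
  by rewrite normrN => h3 h4; apply/andP; split; lra.
apply: (@le_trans _ _ ((b * expR `|y|) `^ (- e))).
  by apply: powR_antimono => //; [exact: ltW|rewrite mulr_gt0 ?expR_gt0].
rewrite powRM ?(ltW b0) ?expR_ge0// /g -!mulrA ler_wpM2l ?powR_ge0//.
have k2 : 0 < 1 + (k l)%:~R ^+ 2 :> R by rewrite ltr_pwDl ?sqr_ge0.
rewrite powR_inv1 ?(ltW k2)// -invfM.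
apply: (@le_trans _ _ (expR z * expR (- (z * `|(k l)%:~R|)))).
  rewrite -expRM -expRD ler_expR.
  have -> : `|y| * - e = - (z * (`|y| / eta)) by rewrite /z; field; rewrite gt_eqF.
  by rewrite -{2}[z]mulr1 -mulrBr -mulrN ler_wpM2l ?(ltW z0)//; lra.
rewrite ler_wpM2l ?expR_ge0// expRN lef_pV2 ?posrE ?expR_gt0 ?mulr_gt0//.
set q : R := (k l)%:~R.
have zq : 0 <= z * `|q| by rewrite mulr_ge0// ltW.
apply: (@le_trans _ _ (1 + (z * `|q|) ^+ 2)).
  rewrite exprMn real_normK ?num_real// mulrDr mulr1.
  by apply: lerD; [rewrite ge_min lexx|rewrite ler_wpM2r ?sqr_ge0// ge_min lexx orbT].
have := sqr_le_expR (z * `|q|).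
have : expR (- (z * `|q|)) <= 1 by rewrite -[leRHS]expR0 ler_expR oppr_le0.
lra.
Qed.

End Hyperbola.

Section HyperbolaLattice.
Variables (R : realType) (T : choiceType) (L : set T) (f : T -> R) (d c : R).
Hypotheses (d0 : 0 < d) (c0 : 0 < c) (f0 : forall l, L l -> 0 < f l).
Hypothesis fd : forall l1 l2, L l1 -> L l2 -> l1 != l2 ->
  d <= (f l1 - f l2) ^+ 2 / (f l1 * f l2).
Let H l := f l + c / f l.

(** A summable majorant, uniform on compact sets, of the double series: part of
    the exponent is spent on the sum over [L], the rest, still larger than
    [1 / 2], on the sum over the integers. *)
Lemma esum_hyperbola_lattice p : 2^-1 < p ->
  (\esum_(l in L) \esum_(a in [set: int]) ((H l ^+ 2 + a%:~R ^+ 2) `^ (- p))%:E < +oo)%E.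
Proof.
move=> p1; pose e := (p - 2^-1) / 2; pose q := p - e.
have e0 : 0 < e by rewrite divr_gt0// subr_gt0.
have q1 : 2^-1 < q by rewrite /q /e; lra.
have q0 : 0 <= q by lra.
pose b := Num.min 1 c; pose w := Num.min 1 (b ^+ 2).
have b0 : 0 < b by rewrite lt_min ltr01.
have w0 : 0 < w by rewrite lt_min ltr01 exprn_gt0.
have Hb l : L l -> b <= H l.
  move=> Ll; have fl := f0 Ll; rewrite /H /b.
  have cf : 0 < c / f l by rewrite divr_gt0.
  have [f1|f1] := lerP 1 (f l).
    by apply: (@le_trans _ _ 1); [rewrite ge_min lexx|rewrite (le_trans f1)// lerDl ltW].
  apply: (@le_trans _ _ (c / f l)); last by rewrite lerDr ltW.
  apply: (@le_trans _ _ c); first by rewrite ge_min lexx orbT.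
  by rewrite ler_pdivlMr// ler_piMr// ltW.
pose g (a : int) : R := w^-1 `^ q * (1 + a%:~R ^+ 2) `^ (- q).
have g0 a : 0 <= g a by rewrite mulr_ge0 ?powR_ge0.
have sg : (\esum_(a in [set: int]) (g a)%:E < +oo)%E.
  have := rsummableZ (w^-1 `^ q) (rsummable_int q1).
  by rewrite ge0_rsummable// => a _; exact: g0.
have e2 : 0 < 2 * e by rewrite mulr_gt0.
have sH : (\esum_(l in L) (H l `^ (- (2 * e)))%:E < +oo)%E.
  have := rsummable_hyperbola d0 c0 f0 fd e2.
  by rewrite ge0_rsummable// => l _; exact: powR_ge0.
have le l (a : int) : L l ->
    (((H l ^+ 2 + a%:~R ^+ 2) `^ (- p))%:E <= (H l `^ (- (2 * e)))%:E * (g a)%:E)%E.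
  move=> Ll; have HH := lt_le_trans b0 (Hb _ Ll).
  have H2 : 0 < H l ^+ 2 by rewrite exprn_gt0.
  have H3 : 0 < H l ^+ 2 + a%:~R ^+ 2 by rewrite ltr_pwDl// sqr_ge0.
  rewrite -EFinM lee_fin.
  have -> : - p = - e + - q by rewrite /q; ring.
  rewrite powRD; last by rewrite (gt_eqF H3) implybT.
  apply: ler_pM; rewrite ?powR_ge0//.
    have -> : H l `^ (- (2 * e)) = (H l ^+ 2) `^ (- e).
      by rewrite -powR_mulrn ?(ltW HH)// -powRrM; congr (_ `^ _); ring.
    by apply: powR_antimono => //; [exact: ltW|rewrite lerDl sqr_ge0].
  apply: powRN_le_scale => //; first by rewrite invr_gt0.
    by rewrite ltr_pwDl// sqr_ge0.
  rewrite mulrC ler_pdivlMr// mulrDl mul1r; apply: lerD.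
    rewrite ge_min; apply/orP; right.
    by rewrite ler_pXn2r// ?nnegrE ?(ltW b0) ?(ltW HH)// Hb.
  by rewrite ler_piMr ?sqr_ge0// ge_min lexx.
apply: (@le_lt_trans _ _ (\esum_(l in L) ((\esum_(a in [set: int]) (g a)%:E) * (H l `^ (- (2 * e)))%:E))%E).
  apply: le_esum => l Ll; rewrite muleC -esumZl ?powR_ge0//; last by move=> a _; rewrite lee_fin.
  by apply: le_esum => a _; exact: le.
have sgf : (\esum_(a in [set: int]) (g a)%:E)%E \is a fin_num.
  by rewrite ge0_fin_numE// esum_ge0// => a _; rewrite lee_fin.
rewrite -(fineK sgf) esumZl.
- rewrite lte_mul_pinfty// lee_fin fine_ge0// esum_ge0// => a _.
  by rewrite lee_fin.
- by rewrite fine_ge0// esum_ge0// => a _; rewrite lee_fin.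
- by move=> l _; rewrite lee_fin powR_ge0.
Qed.

End HyperbolaLattice.

(** * Normal convergence and the Fourier expansion *)

Section ComplexTopology.
Variable R : realType.
Lemma Re_Im_continuous : continuous (@complex.Re R : R[i]^o -> R^o) /\ continuous (@complex.Im R : R[i]^o -> R^o).
Proof.
have h (f : R[i]^o -> R^o) : (forall x y, f (x - y) = f x - f y) ->
    (forall x, `|f x| <= Normc.normc x) -> continuous f.
  move=> fB fn x; apply/(@cvgrPdist_lt R R^o (R[i]^o) (nbhs x) (nbhs_filter x)) => e e0.
  have e1 : 0 < e%:C :> R[i] by rewrite ltcR.
  near=> y; rewrite -fB; apply: (le_lt_trans (fn _)).
  have : `|x - y| < e%:C.
    near: y; apply/(@nbhs_ballP R[i] (R[i]^o)); exists e%:C => // y; rewrite /ball/=.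
  by rewrite /Num.norm /= ltcR.
split; apply: h; [by move=> x y; rewrite ReD ReN|exact: le_Re_normc|
  by move=> x y; rewrite ImD ImN|exact: le_Im_normc].
Unshelve. all: by end_near. Qed.

Lemma compact_lb (X : topologicalType) (C : set X) (g : X -> R^o) (b : R) :
  compact C -> continuous g -> (forall x, C x -> b < g x) ->
  exists2 e, b < e & forall x, C x -> e <= g x.
Proof.
move=> cC cg gb; have [->|/set0P C0] := eqVneq C set0.
  by exists (b + 1) => //; rewrite ltrDl.
have [x Cx xm] := compact_EVT_min C0 cC (continuous_subspaceT cg).
exists (g x); first exact/gb/set_mem.
by move=> y Cy; apply: xm; exact/mem_set.
Qed.

Lemma compact_ub (X : topologicalType) (C : set X) (g : X -> R^o) :
  compact C -> continuous g -> exists2 M, 0 < M & forall x, C x -> `|g x| <= M.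
Proof.
move=> cC cg; have [->|/set0P C0] := eqVneq C set0; first by exists 1.
have cn : continuous (fun x => `|g x| : R^o).
  by move=> x; apply: cvg_norm; exact: cg.
have [x Cx xm] := compact_EVT_max C0 cC (continuous_subspaceT cn).
exists (`|g x| + 1); first by rewrite ltr_wpDl.
by move=> y Cy; apply: (@le_trans _ _ `|g x|); [apply: xm; exact/mem_set|rewrite lerDl].
Qed.

Lemma compact_domain_bounds (C : set (R[i]^o * R[i]^o * R[i]^o)) : compact C ->
  C `<=` [set x | upper_half_plane2 x.1 /\ 2^-1 < complex.Re x.2] ->
  exists e M p : R, [/\ 0 < e, 0 < M, 2^-1 < p & forall x, C x ->
   [/\ e <= complex.Im x.1.1 <= M, e <= complex.Im x.1.2 <= M,
       `|complex.Re x.1.1| <= M, `|complex.Re x.1.2| <= M & p <= complex.Re x.2]].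
Proof.
move=> cC CU; have [cRe cIm] := Re_Im_continuous.
have c11 : continuous (fun x : R[i]^o * R[i]^o * R[i]^o => x.1.1).
  by move=> x; apply: (@continuous_comp _ _ _ fst fst); exact: cvg_fst.
have c12 : continuous (fun x : R[i]^o * R[i]^o * R[i]^o => x.1.2).
  by move=> x; apply: (@continuous_comp _ _ _ fst snd); [exact: cvg_fst|exact: cvg_snd].
have c2 : continuous (fun x : R[i]^o * R[i]^o * R[i]^o => x.2) by move=> x; exact: cvg_snd.
have comp (k : R[i]^o * R[i]^o * R[i]^o -> R[i]^o) (g : R[i]^o -> R^o) :
    continuous k -> continuous g -> continuous (fun x => g (k x)).
  by move=> ck cg x; apply: continuous_comp; [exact: ck|exact: cg].
have [e1 e10 h1] := compact_lb cC (comp _ _ c11 cIm) (fun x Cx => (CU x Cx).1.1).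
have [e2 e20 h2] := compact_lb cC (comp _ _ c12 cIm) (fun x Cx => (CU x Cx).1.2).
have [p p1 h3] := compact_lb cC (comp _ _ c2 cRe) (fun x Cx => (CU x Cx).2).
have [M1 M10 k1] := compact_ub cC (comp _ _ c11 cIm).
have [M2 M20 k2] := compact_ub cC (comp _ _ c12 cIm).
have [M3 M30 k3] := compact_ub cC (comp _ _ c11 cRe).
have [M4 M40 k4] := compact_ub cC (comp _ _ c12 cRe).
exists (Num.min e1 e2), (M1 + M2 + M3 + M4), p; split => //.
- by rewrite lt_min e10.
- by rewrite !addr_gt0.
move=> x Cx.
have := h1 _ Cx; have := h2 _ Cx; have := k1 _ Cx; have := k2 _ Cx; have := k3 _ Cx; have := k4 _ Cx.
have := h3 _ Cx; move=> /= q3 r4 r3 r2 r1 q2 q1.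
have m1 : Num.min e1 e2 <= e1 by rewrite ge_min lexx.
have m2 : Num.min e1 e2 <= e2 by rewrite ge_min lexx orbT.
have := ler_norm (complex.Im x.1.1); have := ler_norm (complex.Im x.1.2).
by split; try (apply/andP; split); lra.
Qed.

End ComplexTopology.

Section PsiSeries.
Variables (R : realType) (K : fieldExtType rat).
Variables (iota : {rmorphism K -> R}) (sigma : {rmorphism K -> K}).
Hypotheses (hK : \dim {:K} = 2%N) (hsigma : is_conjugation sigma).
Variables (D : int) (a : set K) (m : nat).
Hypotheses (hD : has_discriminant sigma D) (ha : fractional_ideal a).
Implicit Types (l : K) (z : R[i] * R[i]) (s : R[i]).

Local Notation L := (Lambda_plus iota sigma D a m).
Local Notation c := (m%:R * ideal_norm iota sigma a / D%:~R).
Local Notation scale := (psi_scale iota sigma D a m).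
Local Notation height := (psi_height iota sigma).
Local Notation trace := (psi_trace iota sigma).
Local Notation Npos := [set n : nat | (0 < n)%N].
Local Notation size l := (iota l + c / iota l).

Lemma psi_scaleE z : scale z = 4 * (complex.Im z.1 * complex.Im z.2) * c.
Proof. by rewrite /psi_scale !mulrA. Qed.

Lemma psi_heightE z l : L l ->
  height z l = iota l * complex.Im z.1 + c / iota l * complex.Im z.2.
Proof.
by move=> Ll; have [_ _ _ sl] := Lambda_plusP hD Ll; rewrite /psi_height sl mulNr opprK.
Qed.

Lemma psi_height_ge z l e : L l -> e <= complex.Im z.1 -> e <= complex.Im z.2 ->
  e * size l <= height z l.
Proof.
move=> Ll y1 y2; have [_ c0 l0 _] := Lambda_plusP hD Ll.
rewrite psi_heightE// mulrDr mulrC [e * (_ / _)]mulrC.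
have cl : 0 <= c / iota l := divr_ge0 (ltW c0) (ltW l0).
by apply: lerD; apply: ler_wpM2l => //; exact: ltW.
Qed.

Lemma psi_height_gt0 z l : upper_half_plane2 z -> L l -> 0 < height z l.
Proof.
move=> [y1 y2] Ll; have [_ c0 l0 _] := Lambda_plusP hD Ll.
rewrite psi_heightE//; apply: addr_gt0; apply: mulr_gt0 => //.
exact: divr_gt0 c0 l0.
Qed.

Lemma psi_trace_le z l M : L l -> `|complex.Re z.1| <= M -> `|complex.Re z.2| <= M ->
  `|trace z l| <= M * size l.
Proof.
move=> Ll x1 x2; have [_ c0 l0 sl] := Lambda_plusP hD Ll.
have cl : 0 <= c / iota l := divr_ge0 (ltW c0) (ltW l0).
rewrite /psi_trace sl; apply: le_trans (ler_normD _ _) _.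
rewrite !normrM normrN (gtr0_norm l0) (ger0_norm cl) mulrDr.
rewrite [M * iota l]mulrC [M * (_ / _)]mulrC.
by apply: lerD; apply: ler_wpM2l => //; exact: ltW.
Qed.

Let psi_base z l (k : int) : R := 1 + Normc.normc ((iota l)%:C * z.1 + (iota (sigma l))%:C * z.2 + k%:~R) ^+ 2 / scale z.

(** As [l * l' = - c], the square of [l y1 + l' y2] plus the scale is the square
    of the height. *)
Lemma psi_baseE z l k : upper_half_plane2 z -> L l ->
  psi_base z l k = (height z l ^+ 2 + (trace z l + k%:~R) ^+ 2) / scale z.
Proof.
move=> [y1 y2] Ll; have [_ c0 l0 sl] := Lambda_plusP hD Ll.
have S0 : 0 < scale z by rewrite psi_scaleE; apply: mulr_gt0 c0; rewrite !mulr_gt0.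
rewrite /psi_base normc_sqr.
have -> : complex.Re ((iota l)%:C * z.1 + (iota (sigma l))%:C * z.2 + k%:~R) = trace z l + k%:~R.
  by rewrite !ReD !ReZ -(rmorph_int (real_complex R)).
have -> : complex.Im ((iota l)%:C * z.1 + (iota (sigma l))%:C * z.2 + k%:~R) =
    iota l * complex.Im z.1 + iota (sigma l) * complex.Im z.2.
  by rewrite !ImD !ImZ -(rmorph_int (real_complex R)) addr0.
apply: (mulIf (lt0r_neq0 S0)); rewrite divfK ?(lt0r_neq0 S0)// mulrDl mul1r divfK ?(lt0r_neq0 S0)//.
rewrite /psi_height psi_scaleE sl.
move: (c) (iota l) l0 => k0 p p0.
by field; rewrite gt_eqF.
Qed.

Lemma psi_scale_gt0 z l : upper_half_plane2 z -> L l -> 0 < scale z.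
Proof.
move=> [y1 y2] Ll; have [_ c0 _ _] := Lambda_plusP hD Ll.
by rewrite psi_scaleE; apply: mulr_gt0 c0; rewrite !mulr_gt0.
Qed.

Lemma psi0_termE z s l k : upper_half_plane2 z -> L l ->
  psi0_term iota sigma D a m (l, k) z s =
  cpow (scale z) s * lattice_term (height z l) (trace z l) s k.
Proof.
move=> zU Ll; have S0 := psi_scale_gt0 zU Ll; have h0 := psi_height_gt0 zU Ll.
have hp : 0 < height z l ^+ 2 + (trace z l + k%:~R) ^+ 2.
  by rewrite ltr_pwDl ?sqr_ge0// exprn_gt0.
rewrite /psi0_term -/(psi_base z l k) psi_baseE// cpowM ?invr_gt0//.
by rewrite cpowVl// opprK mulrC.
Qed.

Lemma esum_size_lattice p : 2^-1 < p ->
  (\esum_(l in L) \esum_(k in [set: int]) ((size l ^+ 2 + k%:~R ^+ 2) `^ (- p))%:E < +oo)%E.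
Proof.
move=> p1; have [->|/set0P[l0 Ll0]] := eqVneq L set0.
  by rewrite esum_set0.
have [_ c0 _ _] := Lambda_plusP hD Ll0.
have [d d0 dL] := @Lambda_plus_separated R K iota sigma hK hsigma D a m hD ha.
have f0 l : L l -> 0 < iota l by move=> /(Lambda_plusP hD)[].
exact: (@esum_hyperbola_lattice R K L iota d c d0 c0 f0 dL p p1).
Qed.

(** The base of the power is at least 1, so the exponent may be lowered to a
    bound [p > 1 / 2] valid on the compact set; [lattice_ge] then leads to the majorant of
    [esum_size_lattice]. *)
Lemma normal_convergence_psi0 :
  normally_convergent (L `*` [set: int])
    (fun p (x : R[i]^o * R[i]^o * R[i]^o) => psi0_term iota sigma D a m p x.1 x.2)
    [set x | upper_half_plane2 x.1 /\ 2^-1 < complex.Re x.2].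
Proof.
move=> C cC CU; have [e [M [p [e0 M0 p1 b]]]] := compact_domain_bounds cC CU.
have p0 : 0 <= p by lra.
pose k1 := ((1 + 2 * M ^+ 2) / e ^+ 2 + 2) * (4 * M ^+ 2 * c).
pose g l (k : int) : \bar R := ((k1 `^ p)%:E * ((size l ^+ 2 + k%:~R ^+ 2) `^ (- p))%:E)%E.
have g0 l k : (0 <= g l k)%E by rewrite /g -EFinM lee_fin mulr_ge0 ?powR_ge0.
have gL : (\esum_(q in L `*` [set: int]) g q.1 q.2 < +oo)%E.
  rewrite -(@esum_esum _ _ _ L (fun=> [set: int]) g)//.
  rewrite (eq_esum (b := fun l => ((k1 `^ p)%:E *
      \esum_(k in [set: int]) ((size l ^+ 2 + k%:~R ^+ 2) `^ (- p))%:E)%E)); last first.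
    by move=> l _; rewrite /g esumZl ?powR_ge0// => k _; rewrite lee_fin powR_ge0.
  rewrite esumZl ?powR_ge0//.
    by rewrite lte_mul_pinfty ?lee_fin ?powR_ge0// esum_size_lattice.
  by move=> l _; apply: esum_ge0 => k _; rewrite lee_fin powR_ge0.
apply: le_lt_trans gL; apply: le_esum => -[l k] [Ll _]; have {}Ll : L l := Ll.
apply: ge_ereal_sup => _ [x Cx <-].
have [/andP[y1 y1M] /andP[y2 y2M] x1 x2 ps] := b _ Cx.
have [zU _] := CU _ Cx.
have [_ c0 l0 _] := Lambda_plusP hD Ll.
have cl : 0 < c / iota l := divr_gt0 c0 l0.
have H0 : 0 < size l := addr_gt0 l0 cl.
have Hl := psi_height_ge Ll y1 y2; have tl := psi_trace_le Ll x1 x2.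
have S0 := psi_scale_gt0 zU Ll.
set h := height _ _ in Hl; set t := trace _ _ in tl.
have base1 : 1 <= psi_base x.1 l k.
  by rewrite lerDl divr_ge0 ?sqr_ge0// ltW.
have base0 := lt_le_trans ltr01 base1.
have k10 : 0 < (1 + 2 * M ^+ 2) / e ^+ 2 + 2.
  by rewrite ltr_wpDl// divr_ge0 ?sqr_ge0// addr_ge0// mulr_ge0// sqr_ge0.
have Mc : 0 < 4 * M ^+ 2 * c.
  by apply: mulr_gt0 c0; rewrite mulr_gt0// exprn_gt0.
rewrite -[g _ _]/(g l k) /g -EFinM lee_fin /psi0_term -/(psi_base x.1 l k) normc_cpow// ReN.
apply: (@le_trans _ _ (psi_base x.1 l k `^ (- p))).
  by apply: ler_powR => //; rewrite lerN2.
apply: powRN_le_scale => //.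
- exact: mulr_gt0.
- by rewrite ltr_pwDl ?sqr_ge0// exprn_gt0.
apply: le_trans (lattice_ge k%:~R e0 (ltW H0) Hl tl) _.
rewrite -mulrA; apply: ler_wpM2l; first exact: ltW.
have -> : h ^+ 2 + (t + k%:~R) ^+ 2 = psi_base x.1 l k * scale x.1.
  by rewrite psi_baseE// divfK// gt_eqF.
rewrite mulrC; apply: ler_wpM2r; first exact: ltW.
rewrite psi_scaleE; apply: ler_wpM2r; first exact: ltW.
rewrite ler_wpM2l// expr2; apply: ler_pM => //.
- exact: le_trans (ltW e0) y1.
- exact: le_trans (ltW e0) y2.
Qed.

Section AtPoint.
Variables (z : R[i] * R[i]) (s : R[i]).
Hypotheses (zU : upper_half_plane2 z) (s1 : 2^-1 < complex.Re s).
Local Notation p := (complex.Re s).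

Let e : R := Num.min (complex.Im z.1) (complex.Im z.2).

Let e0 : 0 < e.
Proof. by have [y1 y2] := zU; rewrite lt_min y1. Qed.

Let height_ge l : L l -> e * size l <= height z l.
Proof. by move=> Ll; apply: psi_height_ge => //; rewrite ge_min lexx ?orbT. Qed.

Let size_gt0 l : L l -> 0 < size l.
Proof.
move=> Ll; have [_ c0 l0 _] := Lambda_plusP hD Ll.
exact: addr_gt0 l0 (divr_gt0 c0 l0).
Qed.

Lemma csummable_const : csummable L (psi0_const_term iota sigma s z).
Proof.
have [L0|/set0P[l0 Ll0]] := eqVneq L set0.
  by rewrite L0 csummableE rsummableE esum_set0.
have [_ c0 _ _] := Lambda_plusP hD Ll0.
have [d d0 dL] := @Lambda_plus_separated R K iota sigma hK hsigma D a m hD ha.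
have f0 l : L l -> 0 < iota l by move=> /(Lambda_plusP hD)[].
pose q := 2 * p - 1; have q0 : 0 < q by rewrite subr_gt0 -ltr_pdivrMl// mulr1.
have := @rsummable_hyperbola R K L iota d c d0 c0 f0 dL q q0.
move=> /(rsummableZ (e^-1 `^ q)); apply: le_csummable => l Ll.
have h0 := psi_height_gt0 zU Ll.
rewrite /psi0_const_term normc_cpow//.
have -> : complex.Re (1 - 2 * s) = - q.
  by rewrite ReD ReN Re1 -[2]/(2%:R) -(rmorph_nat (real_complex R)) ReZ opprB.
apply: powRN_le_scale; rewrite ?invr_gt0 ?(ltW q0)//; first exact: size_gt0.
by rewrite ler_pdivlMl// height_ge.
Qed.

Lemma csummable_fourier l : L l -> csummable Npos (psi0_fourier_term iota sigma s z l).
Proof. by move=> Ll; exact: (@csummable_bessel R (height z l) (trace z l) s (psi_height_gt0 zU Ll) s1). Qed.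

(** [esum_bessel_term_le] bounds the inner series by a lattice sum, and
    [lattice_ge] bounds this by the majorant of [esum_size_lattice]. *)
Lemma csummable_csum_fourier :
  csummable L (fun l => csum Npos (psi0_fourier_term iota sigma s z l)).
Proof.
have p0 : 0 < p by apply: lt_trans s1; rewrite invr_gt0.
pose k0 : R := 4 * Normc.normc (2^-1 * cpow pi (- (s - 2^-1))) * complex.Re (Gamma p%:C).
have k00 : 0 <= k0 by rewrite mulr_ge0 ?Gamma_real_ge0// mulr_ge0// normc_ge0.
pose k1 : R := (1 + 2 * 0 ^+ 2) / e ^+ 2 + 2.
have k10 : 0 < k1.
  by rewrite ltr_wpDl// divr_ge0 ?sqr_ge0// addr_ge0// mulr_ge0// sqr_ge0.
have lat0 l : (0 <= \esum_(k in [set: int]) ((size l ^+ 2 + k%:~R ^+ 2) `^ (- p))%:E)%E.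
  by apply: esum_ge0 => k _; rewrite lee_fin powR_ge0.
pose C := 2 * (k0 * k1 `^ p).
have C0 : 0 <= C by apply: mulr_ge0 => //; apply: mulr_ge0 => //; exact: powR_ge0.
rewrite csummableE ge0_rsummable => [|l _]; last exact: normc_ge0.
apply: (@le_lt_trans _ _ (\esum_(l in L) (C%:E *
    \esum_(k in [set: int]) ((size l ^+ 2 + k%:~R ^+ 2) `^ (- p))%:E))%E); last first.
  by rewrite esumZl// lte_mul_pinfty// esum_size_lattice.
apply: le_esum => l Ll.
have h0 := psi_height_gt0 zU Ll; have sl := csummable_fourier Ll.
have nf := normc_csum_le sl.
apply: (@le_trans _ _ (2%:E * \esum_(n in Npos) (Normc.normc (psi0_fourier_term iota sigma s z l n))%:E)%E).
  rewrite -[X in (_ <= _ * X)%E]fineK -?EFinM ?lee_fin//.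
  by apply: rsummable_fin => // n _; exact: normc_ge0.
rewrite /C EFinM -muleA; apply: lee_wpmul2l => //.
apply: le_trans (@esum_bessel_term_le R (height z l) (trace z l) s h0 s1) _.
rewrite -/k0 [(k0 * _)%:E]EFinM -muleA; apply: lee_wpmul2l; first by rewrite lee_fin.
rewrite -esumZl ?powR_ge0//; last by move=> k _; rewrite lee_fin powR_ge0.
apply: le_esum => k _; rewrite -EFinM lee_fin; apply: powRN_le_scale => //.
- exact: ltW.
- by rewrite ltr_pwDl ?sqr_ge0// exprn_gt0// size_gt0.
have := @lattice_ge R e 0 (size l) (height z l) 0 k%:~R e0 (ltW (size_gt0 Ll)) (height_ge Ll).
by rewrite normr0 mul0r add0r; exact.
Qed.

Lemma Psi0_fourier : Psi0 iota sigma D a m s z =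
  2 * cpow (scale z) s * Beta 2^-1 (s - 2^-1) * csum L (psi0_const_term iota sigma s z)
  + 4 * cpow pi s / Gamma s * cpow (scale z) s *
    csum L (fun l => csum Npos (psi0_fourier_term iota sigma s z l)).
Proof.
pose b1 := cpow (scale z) s * Beta 2^-1 (s - 2^-1).
pose b2 := cpow (scale z) s * (2 * cpow pi s / Gamma s).
have e1 l : L l -> csum [set: int] (fun k => psi0_term iota sigma D a m (l, k) z s) =
    b1 * psi0_const_term iota sigma s z l + b2 * csum Npos (psi0_fourier_term iota sigma s z l).
  move=> Ll; have h0 := psi_height_gt0 zU Ll.
  rewrite (eq_csum (fun k _ => psi0_termE s k zU Ll)).
  rewrite csumZ; last exact: csummable_lattice.
  by rewrite lattice_fourier// mulrDr !mulrA /b1 /b2 !mulrA.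
rewrite /Psi0 (eq_csum e1) csumD ?csumZ; first last.
- exact: csummableZ csummable_csum_fourier.
- exact: csummableZ csummable_const.
- exact: csummable_const.
- exact: csummable_csum_fourier.
set S1 := csum L _; set S2 := csum L _; rewrite /b1 /b2.
move: (cpow (scale z) s) (Beta _ _) (cpow pi s) (Gamma s)^-1 => x1 x2 x3 x4.
ring.
Qed.

End AtPoint.

End PsiSeries.

Theorem lemma4p5 (R : realType) (K : fieldExtType rat)
    (iota : {rmorphism K -> R}) (sigma : {rmorphism K -> K}) (D : int)
    (hK : \dim {:K} = 2%N) (hsigma : is_conjugation sigma)
    (hD : has_discriminant sigma D)
    (a : set K) (ha : fractional_ideal a) (m : nat) (hm : (0 < m)%N) :
  let L := Lambda_plus iota sigma D a m in
  let Npos := [set n : nat | (0 < n)%N] in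
  normally_convergent (L `*` [set: int])
    (fun p (x : R[i]^o * R[i]^o * R[i]^o) => psi0_term iota sigma D a m p x.1 x.2)
    [set x | upper_half_plane2 x.1 /\ 2^-1 < complex.Re x.2] /\
  forall (z : R[i] * R[i]) (s : R[i]),
    upper_half_plane2 z -> 2^-1 < complex.Re s ->
    [/\ csummable L (psi0_const_term iota sigma s z),
        (forall l, L l -> csummable Npos (psi0_fourier_term iota sigma s z l)),
        csummable L (fun l => csum Npos (psi0_fourier_term iota sigma s z l)) &
        Psi0 iota sigma D a m s z =
          2 * cpow (psi_scale iota sigma D a m z) s * Beta 2^-1 (s - 2^-1) *
            csum L (psi0_const_term iota sigma s z)
          + 4 * cpow pi s / Gamma s * cpow (psi_scale iota sigma D a m z) s *
            csum L (fun l => csum Npos (psi0_fourier_term iota sigma s z l))].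
Proof.
move=> L Npos; split; first exact: normal_convergence_psi0.
move=> z s zU s1; split.
- exact: csummable_const.
- by move=> l Ll; exact: csummable_fourier hD _ _ zU s1 _ Ll.
- exact: csummable_csum_fourier.
- exact: Psi0_fourier.
Qed.
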